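(* Let $M>0$ and let $g_*\in\mathcal P(M)$ be fixed. Consider the sequence of linear models described in the context, with $\mathbf y$ generated under the true prior $g_*$, and suppose that Assumption (D) (stated in the context) holds as $n,p\to\infty$. Let $\hat g_n\in\mathcal P(M)$ be any sequence of (data-dependent) priors such that, with probability approaching $1$ as $n,p\to\infty$, $$\bar F_n(g_* )-\bar F_n(\hat g_n)=\frac1p\Big(\log P_{\hat g_n}(\mathbf y)-\log P_{g_*}(\mathbf y)\Big)\ \ge\ -\delta_n$$ for some deterministic sequence $\delta_n\downarrow 0$. Then $\hat g_n\to g_*$ weakly in probability, i.e. $d(\hat g_n,g_* )\to0$ in probability for any metric $d$ metrizing weak convergence on $\mathcal P(M)$.
   Context: $\mathcal P(M)$ is the set of Borel probability measures on $[-M,M]$. We consider a sequence of problems indexed by $n$, with $p=p_n$ and $n,p\to\infty$; for each $n$ there are a deterministic design $\mathbf X\in\mathbb R^{n\times p}$ with columns $\mathbf x_1,\dots,\mathbf x_p$ and a noise variance $\sigma^2>0$ (both may depend on $n$). Under a prior $g$, the data are $$\mathbf y=\mathbf X\boldsymbol\theta+\boldsymbol\varepsilon,\qquad \theta_1,\dots,\theta_p\overset{iid}{\sim}g,\qquad \varepsilon_1,\dots,\varepsilon_n\overset{iid}{\sim}\mathcal N(0,\sigma^2),$$ with $\boldsymbol\theta,\boldsymbol\varepsilon$ independent. $P_g(\mathbf y)$ is the marginal Lebesgue density of $\mathbf y$, and $$\bar F_n(g)=-\frac1p\log P_g(\mathbf y)=-\frac1p\log\int\frac{1}{(2\pi\sigma^2)^{n/2}}\exp\Big(-\frac{\|\mathbf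 y-\mathbf X\boldsymbol\theta\|_2^2}{2\sigma^2}\Big)\prod_{j=1}^p dg(\theta_j).$$ $\|\cdot\|_{\mathrm{op}}$ and $\|\cdot\|_{\mathrm F}$ are the operator and Frobenius norms. Assumption (D). There are constants $C_*,c_*,\beta>0$ (independent of $n,p$) such that $\sigma^2\in\big(c_*\|\mathbf X\|_{\mathrm{op}}^2,\ \tfrac{C_*}{p}\|\mathbf X\|_{\mathrm F}^2\big)$ and, as $n,p\to\infty$: (a) with $\mathbf 1\in\mathbb R^p$ the all-ones vector, $\frac1p\|\mathbf X\mathbf 1\|_2^2\ge c_*\|\mathbf X\|_{\mathrm{op}}^2$; (b) for a subset $\mathcal S\subseteq\{1,\dots,p\}$ of size $|\mathcal S|\ge c_*p$ and each $j\in\mathcal S$ there is a vector $\mathbf z_j\in\mathbb R^n$ (deterministic given $\mathbf X$) with $\|\mathbf X\|_{\mathrm{op}}\|\mathbf z_j\|_2\in[c_*,C_*]$, $|\mathbf z_j^\top\mathbf X\mathbf 1|\le C_*$, $$\max_{j\in\mathcal S}|\mathbf z_j^\top\mathbf x_j-1|\to0,\qquad \max_{j\in\mathcal S}\sum_{k:k\ne j}|\mathbf z_j^\top\mathbf x_k|^{2+\beta}\to0,$$ and, for any $\{a_j:j\in\mathcal S\}$ with $|a_j|\le1$, $\ \|\mathbf X\|_{\mathrm{op}}^2\big\|\sum_{j\in\mathcal S}a_j\mathbf z_j\big\|_2^2\le C_*p$. *)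

(* Defs.v *)
From HB Require Import structures.
From mathcomp Require Export all_boot all_order all_algebra.
From mathcomp Require Export all_classical all_reals all_analysis.
Export Order.TTheory GRing.Theory Num.Theory.
Export numFieldNormedType.Exports.

Set Implicit Arguments.
Unset Strict Implicit.
Unset Printing Implicit Defensive.

Local Open Scope classical_set_scope.
Local Open Scope ring_scope.

Section Norms.
Context {R : realType}.

(* The norm provided by the library on matrices is the entrywise max norm. *)
Definition l2norm n (v : 'cV[R]_n) : R := Num.sqrt (\sum_i v i 0 ^+ 2).

Definition Fnorm n p (X : 'M[R]_(n, p)) : R :=
  Num.sqrt (\sum_i \sum_j X i j ^+ 2).

Definition opnorm n p (X : 'M[R]_(n, p)) : R :=
  sup [set l2norm (X *m v) | v in [set v : 'cV[R]_p | l2norm v <= 1]].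

Definition dotv n (u v : 'cV[R]_n) : R := (u^T *m v) 0 0.

Definition ones p : 'cV[R]_p := const_mx 1.

End Norms.

Section PowerMeasure.
Context {R : realType}.

Definition tuple_cons d (T : measurableType d) n (x : T * n.-tuple T) :
  n.+1.-tuple T := [the n.+1.-tuple T of x.1 :: x.2].

Lemma measurable_tuple_cons d (T : measurableType d) n :
  measurable_fun [set: T * n.-tuple T] (@tuple_cons d T n).
Proof. exact: measurable_cons. Qed.

HB.instance Definition _ d (T : measurableType d) n :=
  isMeasurableFun.Build _ _ _ _ (@tuple_cons d T n)
    (@measurable_tuple_cons d T n).

(* The n-fold product measure g (x) ... (x) g on n-tuples. *)
Fixpoint power_prob d (T : measurableType d) (g : probability T R) n :
    probability (n.-tuple T) R :=
  match n with
  | 0 => \d_ [tuple]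
  | n'.+1 => distribution (g \x power_prob g n')%E (@tuple_cons d T n')
  end.

End PowerMeasure.

Section Priors.
Context {R : realType}.

(* Borel probability measures on [-M, M], as Borel probability measures on the
   line which give mass 1 to [-M, M]. *)
Record prior (M : R) := Prior {
  prior_prob :> probability R R ;
  prior_supp : prior_prob `[- M, M]%classic = 1%E }.

Definition weak_cvg (M : R) (g_ : nat -> prior M) (g : prior M) : Prop :=
  forall f : R -> R, continuous f -> (exists K : R, forall x, `|f x| <= K) ->
    \int[g_ k]_x f x @[k --> \oo] --> \int[g]_x f x.

(* A measure is represented by a function on all sets, whose values outside the
   sigma-algebra are irrelevant: two priors are identified when they agree on
   the measurable sets. *)
Definition prior_eq (M : R) (g h : prior M) : Prop :=
  forall A : set R, measurable A -> g A = h A.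

Definition is_metric (M : R) (d : prior M -> prior M -> R) : Prop :=
  [/\ forall g h, 0 <= d g h,
      forall g h, d g h = 0 <-> prior_eq g h,
      forall g h, d g h = d h g
    & forall g h k, d g k <= d g h + d h k].

Definition metrizes_weak_cvg (M : R) (d : prior M -> prior M -> R) : Prop :=
  is_metric d /\
  forall (g_ : nat -> prior M) (g : prior M),
    d (g_ k) g @[k --> \oo] --> 0 <-> weak_cvg g_ g.

End Priors.

Section Model.
Context {R : realType}.

Definition mutually_independent d (T : measurableType d) (P : probability T R)
    (I : finType) (Z : I -> {RV P >-> R}) : Prop :=
  forall (J : {set I}) (A : I -> set R),
    (forall i, measurable (A i)) ->
    P (\bigcap_(i in [set i | i \in J]) (Z i @^-1` A i)) =
    (\prod_(i in J) P (Z i @^-1` A i))%E.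

(* The coordinates of theta are iid g, those of eps are iid N(0, s2), and theta
   and eps are independent: equivalently, these p + n variables have the
   prescribed laws and are mutually independent.  The second parameter of
   normal_prob is the standard deviation. *)
Definition model_law d (T : measurableType d) (P : probability T R) (n p : nat)
    (g : probability R R) (s2 : R)
    (theta : 'I_p -> {RV P >-> R}) (eps : 'I_n -> {RV P >-> R}) : Prop :=
  [/\ forall j (A : set R), measurable A -> distribution P (theta j) A = g A,
      forall i (A : set R), measurable A ->
        distribution P (eps i) A = normal_prob 0 (Num.sqrt s2) A
    & mutually_independent (fun k : 'I_p + 'I_n =>
        match k with inl j => theta j | inr i => eps i end)].

Definition observation d (T : measurableType d) (P : probability T R)
    (n p : nat) (X : 'M[R]_(n, p)) (theta : 'I_p -> {RV P >-> R})
    (eps : 'I_n -> {RV P >-> R}) (w : T) : 'cV[R]_n :=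
  X *m (\col_j theta j w) + \col_i eps i w.

Definition marginal_density (n p : nat) (X : 'M[R]_(n, p)) (s2 : R)
    (g : probability R R) (y : 'cV[R]_n) : R :=
  \int[power_prob g p]_t
    (((2 * pi * s2) `^ (n%:R / 2))^-1 *
     expR (- (l2norm (y - X *m (\col_j tnth t j)) ^+ 2 / (2 * s2)))).

Definition free_energy (n p : nat) (X : 'M[R]_(n, p)) (s2 : R)
    (y : 'cV[R]_n) (g : probability R R) : R :=
  - (p%:R^-1 * ln (marginal_density X s2 g y)).

(* "With probability approaching 1".  The events E n need not be measurable:
   they are required to contain measurable events whose probability tends to 1,
   which for measurable E n means that P n (E n) tends to 1. *)
Definition whp (d : nat -> measure_display) (T : forall n, measurableType (d n))
    (P : forall n, probability (T n) R) (E : forall n, set (T n)) : Prop :=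
  exists A : forall n, set (T n),
    [/\ forall n, measurable (A n), forall n, A n `<=` E n
      & P n (A n) @[n --> \oo] --> 1%E].

End Model.

Section DesignAssumption.
Context {R : realType}.

Definition assumption_D (p : nat -> nat) (X : forall n, 'M[R]_(n, p n))
    (s2 : nat -> R) : Prop :=
  exists Cs cs beta : R, [/\ 0 < Cs, 0 < cs & 0 < beta] /\
  [/\ \forall n \near \oo,
        cs * opnorm (X n) ^+ 2 < s2 n < Cs / (p n)%:R * Fnorm (X n) ^+ 2,
      \forall n \near \oo,
        cs * opnorm (X n) ^+ 2 <=
        (p n)%:R^-1 * l2norm (X n *m ones (p n)) ^+ 2
    & exists (S : forall n, {set 'I_(p n)})
             (z : forall n, 'I_(p n) -> 'cV[R]_n),
      [/\ \forall n \near \oo,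
            cs * (p n)%:R <= #|S n|%:R /\
            forall j, j \in S n ->
              cs <= opnorm (X n) * l2norm (z n j) <= Cs /\
              `|dotv (z n j) (X n *m ones (p n))| <= Cs,
          (\big[Num.max/0]_(j in S n) `|dotv (z n j) (col j (X n)) - 1|)
            @[n --> \oo] --> 0,
          (\big[Num.max/0]_(j in S n)
             \sum_(k | k != j) `|dotv (z n j) (col k (X n))| `^ (2 + beta))
            @[n --> \oo] --> 0
        & \forall n \near \oo, forall a : 'I_(p n) -> R,
            (forall j, j \in S n -> `|a j| <= 1) ->
            opnorm (X n) ^+ 2 * l2norm (\sum_(j in S n) a j *: z n j) ^+ 2
              <= Cs * (p n)%:R]].

End DesignAssumption.

(* Main.v *)
From HB Require Import structures.
Require Import Defs.
From mathcomp Require Import measurable_realfun ring lra complex.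

Set Implicit Arguments.
Unset Strict Implicit.
Unset Printing Implicit Defensive.

Local Open Scope classical_set_scope.
Local Open Scope ring_scope.

(** Why the theorem is true.  A prior [g] that is far from [gstar] differs from
    it in its characteristic function at one of finitely many frequencies.  It
    is shown that this difference can be tested, with exponentially small
    errors, by statistics of [y]; a prior that can be tested against [gstar]
    has, with probability tending to one, a likelihood smaller than that of
    [gstar] by a factor [exp (- c p)], and cannot be the near maximizer [ghat].

    Testing statistics.  Three kinds of functions of [y] are used, all with a
    Lipschitz constant of order [1 / (sqrt p |X|)]: [mean_stat], the projection
    on [X 1]; [energy_stat], the norm of [X^T y]; and [phase_stat], an average
    over [S] of the real parts of [c_j exp (i tau z_j . y)].  Under every prior
    on [-M, M] such a statistic is within [t] of its mean except with
    probability [exp (- c p)], with [c] independent of the prior and of the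
    design ([concentration]).  As the statistics are not convex, Talagrand's
    inequality for bounded coordinates does not apply; the bound comes from
    Maurey's property (tau), which tensorizes: for Gaussian
    coordinates with a quadratic cost ([property_tau_gauss], by the
    Prekopa-Leindler inequality), and for bounded coordinates with a quadratic
    cost [b (u - v)^2] at the price of a constant [exp (O (b^2))] per
    coordinate ([property_tau_prior]); small [b] makes this affordable.

    Identification ([identification]).  The mean of [mean_stat] determines the
    mean of the prior, by the hypothesis on [X 1].  Given the mean, that of
    [energy_stat] determines its variance.  The mean of [exp (i tau z_j . y)] is
    a product over the coordinates; as the vector of the [z_j . x_k], [k != j],
    has bounded norm and small entries, the factors with [k != j] depend on the
    prior only through its mean and variance (Lindeberg's comparison,
    [prod_cf_close]), while the factor [k = j] is close to the characteristic
    function of the prior at [tau].  The last one is therefore controlled by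
    the means of the three statistics.

    From tests to likelihoods.  The priors are covered by a finite net in the
    sense of one-sided domination ([net]); replacing a prior by its neighbour in
    the net multiplies its likelihood by at most [exp (small p)] where
    [energy_stat] is near its mean ([lik_domination]).  If some statistic
    separates the net element [h] from [gstar], then the event that all
    statistics are near their means under [gstar] has probability at most
    [exp (- c p)] under [h].  Changing the measure ([lik_ratio_bound]), the
    probability under [gstar] that this event occurs and that the likelihood of
    [h] is at least [exp (- c p / 2)] times that of [gstar] is at most
    [exp (- c p / 2)], and the net is finite ([good_event], [testing_step]).
    Finally the frequencies [j / M] suffice because continuous functions on
    [-M, M] are uniform limits of polynomials in [sin (x / M)]
    ([trig_determines]). *)

(** * The Prekopa-Leindler inequality on the line *)

Lemma le_of_eq d (T : porderType d) (x y : T) : x = y -> (x <= y)%O.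
Proof. by move=> ->. Qed.

Section cumul.
Context {R : realType}.
Notation mu := (@lebesgue_measure R).

Definition cumul (f : R -> R) (x : R) : R := \int[mu]_(t in `]-oo, x]) f t.

Variable f : R -> R.
Hypothesis f0 : forall x, 0 < f x.
Hypothesis cf : continuous f.
Hypothesis intf : mu.-integrable setT (EFin \o f).

Let intS (A : set R) : measurable A -> mu.-integrable A (EFin \o f).
Proof. by move=> mA; apply: integrableS intf. Qed.

Lemma is_derive_cumul (x : R) : is_derive x 1 (cumul f) (f x).
Proof.
have [] := @continuous_FTC1 R f -oo%O x (x + 1) _ _ _ _.
- by rewrite ltrDl.
- by apply: intS.
- by rewrite ltNyr.
- exact: cf.
move=> dF F'; apply: DeriveDef; [exact: dF | by rewrite -derive1E].
Qed.

Lemma continuous_cumul : continuous (cumul f).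
Proof.
move=> x; have := is_derive_cumul x => -[dF _].
by apply: differentiable_continuous; apply/derivable1_diffP.
Qed.

Lemma cumul_lt x y : x < y -> cumul f x < cumul f y.
Proof.
move=> xy.
have [c _] := @MVT R (cumul f) f x y xy (fun z _ => is_derive_cumul z)
  (continuous_subspaceT continuous_cumul).
by move=> h; rewrite -subr_gt0 h mulr_gt0 ?f0// subr_gt0.
Qed.

Lemma cumul_inj : injective (cumul f).
Proof.
move=> x y h; case: (ltgtP x y) => // /cumul_lt; rewrite h ltxx //.
Qed.

Lemma cumul_ge0 x : 0 <= cumul f x.
Proof. by apply: Rintegral_ge0 => y _; rewrite ltW. Qed.

Lemma cumul_le_total x : cumul f x <= \int[mu]_t f t.
Proof.
rewrite fine_le//.
- by apply: integrable_fin_num => //; apply: intS.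
- exact: integrable_fin_num.
- apply: ge0_subset_integral => //; first by case/integrableP: intf.
  by move=> y _; rewrite lee_fin ltW.
Qed.

(** Almost all the mass lies between two points; this stands in for the limits
    of the distribution function at infinity. *)
Lemma cumul_window e : 0 < e ->
  exists x y, cumul f x < e /\ \int[mu]_t f t - e < cumul f y.
Proof.
move=> e0.
pose F (n : nat) : set R := `](- n%:R), n%:R]%classic.
have FT : \bigcup_n F n = setT.
  rewrite -subTset => t _; exists (Num.truncn `|t|).+1 => //=.
  rewrite /F /= in_itv /=.
  have := truncnS_gt `|t|; rewrite ltr_norml => /andP[-> /ltW ->] //.
have H : (\int[mu]_(x in F n) (f x)%:E)%E @[n --> \oo] --> (\int[mu]_x (f x)%:E)%E.
  rewrite -[X in (\int[mu]_(x in X) _)%E]FT; apply: ge0_nondecreasing_set_cvg_integral => //.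
  - move=> n m nm; apply/subsetPset => x; rewrite /F /= !in_itv /= => /andP[h1 h2].
    rewrite (le_trans h2) ?ler_nat// andbT (le_lt_trans _ h1)// lerN2 ler_nat//.
  - by move=> i; apply: measurable_itv.
  - by move=> i; case/integrableP: (@intS (F i) (measurable_itv _)).
  - by move=> n x _; rewrite lee_fin ltW.
have finf : (\int[mu]_x (f x)%:E)%E \is a fin_num by exact: integrable_fin_num.
have : fine (\int[mu]_(x in F n) (f x)%:E)%E @[n --> \oo] --> fine (\int[mu]_x (f x)%:E)%E.
  by apply: fine_cvg; rewrite fineK.
move=> /cvgrPdist_lt /(_ _ e0) [N _ /(_ N (leqnn N))] /=.
rewrite -/(Rintegral mu setT f) -/(Rintegral mu (F N) f).
have -> : Rintegral mu (F N) f = cumul f N%:R - cumul f (- N%:R).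
  rewrite /cumul /F Rintegral_itvB//.
  - exact: intS.
  - by rewrite bnd_simp; have := ler0n R N; lra.
rewrite ltr_norml => /andP[_ h].
exists (- N%:R), N%:R.
have := cumul_ge0 (- N%:R); have := cumul_le_total (N%:R).
by move: h; rewrite -/(Rintegral mu setT f); lra.
Qed.

Lemma cumul_gt0 x : 0 < cumul f x.
Proof. by apply: (le_lt_trans (cumul_ge0 (x - 1))); apply: cumul_lt; lra. Qed.

Lemma cumul_lt_total x : cumul f x < \int[mu]_t f t.
Proof. by apply: lt_le_trans (cumul_le_total (x + 1)); apply: cumul_lt; lra. Qed.

Lemma cumul_surj s : 0 < s < \int[mu]_t f t -> exists x, cumul f x = s.
Proof.
move=> /andP[s0 s1].
have [x [_ [hx _]]] := cumul_window s0.
have [_ [y [_ hy]]] := @cumul_window (\int[mu]_t f t - s) ltac:(by rewrite subr_gt0).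
have hy' : s < cumul f y by lra.
have xy : x <= y.
  rewrite leNgt; apply/negP => /cumul_lt; lra.
have [c _ <-] := @IVT R (cumul f) x y s xy (continuous_subspaceT continuous_cumul)
  ltac:(rewrite ge_min le_max (ltW hx) (ltW hy') orbT //).
by exists c.
Qed.

End cumul.

Section PL.
Context {R : realType}.
Notation mu := (@lebesgue_measure R).

Lemma is_derive_eqR (f : R -> R) (x a b : R) : is_derive x 1 f a -> a = b -> is_derive x 1 f b.
Proof. by move=> h <-. Qed.

Let PL_arith (e p q s t w z : R) : t < e / 2 -> z - e / 2 < w -> 0 <= p ->
  q <= s -> p - t <= q - w -> z <= s + e.
Proof. lra. Qed.

(** Mass transport.  Let [v] be the increasing map that carries the normalized
    density [a] to [b], so that [v' = k a / b(v)] with [k] the ratio of the two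
    masses.  Along the midpoint [(x + v x) / 2] the distribution function of
    [m] grows at the rate [m (1 + v') / 2], which by hypothesis and by the
    arithmetic-geometric inequality is at least [sqrt (a b(v) v') = sqrt k a].
    Integrating over the line gives [sqrt k] times the mass of [a]. *)
Lemma prekopa_leindler1 (a b m : R -> R) :
  continuous a -> continuous b -> continuous m ->
  (forall x, 0 < a x) -> (forall x, 0 < b x) -> (forall x, 0 < m x) ->
  mu.-integrable setT (EFin \o a) -> mu.-integrable setT (EFin \o b) ->
  mu.-integrable setT (EFin \o m) ->
  (forall u v, a u * b v <= m ((u + v) / 2) ^+ 2) ->
  (\int[mu]_t a t) * (\int[mu]_t b t) <= (\int[mu]_t m t) ^+ 2.
Proof.
move=> ca cb cm a0 b0 m0 ia ib im hab.
set Ia := \int[mu]_t a t; set Ib := \int[mu]_t b t; set Im := \int[mu]_t m t.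
have Ia0 : 0 < Ia by apply: lt_trans (cumul_lt_total a0 ca ia 0); exact: cumul_gt0.
have Ib0 : 0 < Ib by apply: lt_trans (cumul_lt_total b0 cb ib 0); exact: cumul_gt0.
pose k := Ib / Ia.
have k0 : 0 < k by rewrite divr_gt0.
have hv x : exists v, cumul b v = cumul a x * k.
  apply: cumul_surj => //; rewrite mulr_gt0 ?cumul_gt0//=.
  rewrite /k mulrA ltr_pdivrMr// mulrC ltr_pM2l//; exact: cumul_lt_total.
(* inverse of the distribution function of b *)
pose g s := xget 0 [set v | cumul b v = s].
have gK v : g (cumul b v) = v.
  rewrite /g; case: xgetP => [y _ /= /(cumul_inj b0 cb ib)//|/(_ v)]; by case.
pose v x := g (cumul a x * k).
have hvE x : cumul b (v x) = cumul a x * k.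
  by have [w hw] := hv x; rewrite /v -hw gK.
have dv (x : R) : is_derive x 1 v (a x * k / b (v x)).
  have d1 : is_derive (cumul b (v x)) 1 g (b (v x))^-1.
    apply: is_derive_inverse.
    - by near=> y; exact: gK.
    - by near=> y; apply: continuous_cumul.
    - exact: is_derive_cumul.
    - by rewrite gt_eqF.
  rewrite hvE in d1.
  have d2 : is_derive x 1 (fun x => cumul a x * k) (a x * k).
    have da := is_derive_cumul ca ia x.
    rewrite (_ : (fun x => _) = (k *: cumul a)); last by apply/funext => y /=; rewrite mulrC.
    by apply: is_derive_eqR; rewrite /GRing.scale /= mulrC.
  by apply: is_derive_eqR (is_derive1_comp _ _) _ => //=; rewrite mulrC /=.
pose r := Num.sqrt k.
pose H x := cumul m ((x + v x) / 2) - r * cumul a x.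
have dH (x : R) : is_derive x 1 H (m ((x + v x) / 2) * ((1 + a x * k / b (v x)) / 2) - r * a x).
  have d1 : is_derive x 1 (fun x => (x + v x) / 2) ((1 + a x * k / b (v x)) / 2).
    have := dv x => dvx.
    rewrite (_ : (fun x => _) = (2^-1 *: (id + v))); last by apply/funext => y /=; rewrite mulrC.
    by apply: is_derive_eqR; rewrite /GRing.scale /= mulrC.
  have dm := is_derive_cumul cm im ((x + v x) / 2).
  have d2 : is_derive x 1 (cumul m \o (fun x => (x + v x) / 2)) (m ((x + v x) / 2) * ((1 + a x * k / b (v x)) / 2)).
    by apply: is_derive_eqR (is_derive1_comp _ _) _ => //=; rewrite mulrC.
  have da := is_derive_cumul ca ia x.
  rewrite (_ : H = (cumul m \o (fun x => (x + v x) / 2)) - (r *: cumul a)) //.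
  by apply: is_derive_eqR.
have dH0 x : 0 <= m ((x + v x) / 2) * ((1 + a x * k / b (v x)) / 2) - r * a x.
  rewrite subr_ge0.
  set t := a x * k / b (v x).
  have t0 : 0 < t by rewrite /t; apply: divr_gt0; [apply: mulr_gt0|].
  have h1 : Num.sqrt (a x * b (v x)) <= m ((x + v x) / 2).
    rewrite -(@ger0_norm _ (m _)) ?(ltW (m0 _))// -sqrtr_sqr ler_wsqrtr//.
  have h2 : Num.sqrt t <= (1 + t) / 2.
    have := sqr_ge0 (1 - Num.sqrt t); rewrite sqrrB expr1n sqr_sqrtr ?(ltW t0)//. lra.
  have -> : r * a x = Num.sqrt (a x * b (v x)) * Num.sqrt t.
    rewrite /r -sqrtrM; last by rewrite mulr_ge0// ltW.
    have -> : a x * b (v x) * t = k * (a x) ^+ 2.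
      by rewrite /t; field; rewrite gt_eqF.
    by rewrite [RHS](@sqrtrM _ k (a x ^+ 2)) ?(ltW k0)// sqrtr_sqr ger0_norm// ltW.
  by apply: ler_pM => //; rewrite sqrtr_ge0.
have ndH x y : x <= y -> H x <= H y.
  rewrite le_eqVlt => /predU1P[->//|xy].
  have cH : continuous H.
    move=> z; have := dH z => -[dF _].
    by apply: differentiable_continuous; apply/derivable1_diffP.
  have [c _ h] := @MVT R H _ x y xy (fun z _ => dH z) (continuous_subspaceT cH).
  by rewrite -subr_ge0 h mulr_ge0// subr_ge0 ltW.
have key : r * Ia <= Im.
  apply/ler_addgt0Pr => e e0.
  have r0 : 0 < r by rewrite sqrtr_gt0.
  (* outside these points a has mass at most e / (2 r); the minimum orders them *)
  have [x [y [hx hy]]] := cumul_window a0 ia (e := e / (2 * r)) ltac:(by rewrite divr_gt0// mulr_gt0).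
  have {}hx : r * cumul a (Num.min x y) < e / 2.
    have: cumul a (Num.min x y) <= cumul a x.
      have := ge_min x x y; rewrite lexx /= le_eqVlt => /predU1P[->//|/(cumul_lt a0 ca ia)/ltW//].
    move=> h; have := le_lt_trans h hx; rewrite ltr_pdivlMr ?mulr_gt0//; lra.
  have {}hy : r * Ia - e / 2 < r * cumul a y.
    move: hy; rewrite -/Ia ltrBlDr -(ltr_pM2l r0) mulrDr (_ : r * (e / (2 * r)) = e / 2); first by rewrite ltrBlDr.
    by field; rewrite gt_eqF.
  have hm : Num.min x y <= y by rewrite ge_min lexx orbT.
  have := ndH _ _ hm; rewrite /H.
  have := cumul_le_total m0 im ((y + v y) / 2).
  have := cumul_ge0 m0 ((Num.min x y + v (Num.min x y)) / 2).
  rewrite -/Im => hA hB hC.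
  exact: PL_arith hx hy hA hB hC.
have -> : Ia * Ib = (r * Ia) ^+ 2.
  rewrite exprMn sqr_sqrtr ?(ltW k0)// /k; field; by rewrite gt_eqF.
rewrite ler_sqr ?nnegrE// ?mulr_ge0 ?sqrtr_ge0 ?(ltW Ia0)//.
by apply: le_trans key; rewrite mulr_ge0 ?sqrtr_ge0 ?(ltW Ia0).
Unshelve. all: by end_near.
Qed.
End PL.

(** * Power measures and the Gaussian law *)

Ltac meas := first [ by [] | exact: measurable_cst | exact: measurable_id |
  lazymatch goal with
  | |- measurable_fun _ (fun x => EFin _) => apply/measurable_EFinP; meas
  | |- measurable_fun _ (EFin \o _) => apply/measurable_EFinP; meas
  | |- measurable_fun _ (fun x => GRing.add _ (GRing.opp _)) => apply: measurable_funB; meas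
  | |- measurable_fun _ (fun x => GRing.add _ _) => apply: measurable_funD; meas
  | |- measurable_fun _ (fun x => GRing.mul _ _) => apply: measurable_funM; meas
  | |- measurable_fun _ (fun x => GRing.exp _ _) => apply: measurable_funX; meas
  | |- measurable_fun _ (fun x => GRing.opp _) => apply: measurableT_comp; meas
  | |- measurable_fun _ (fun x => expR _) => apply: measurableT_comp; meas
  | |- measurable_fun _ (fun x => Num.norm _) => apply: measurableT_comp; meas
  end | idtac ].

Section integral_facts.
Context {R : realType}.

Lemma Rintegral_prod d1 d2 (T1 : measurableType d1) (T2 : measurableType d2)
  (m1 : probability T1 R) (m2 : probability T2 R) (f : T1 * T2 -> R) :
  (m1 \x m2)%E.-integrable setT (EFin \o f) ->
  \int[(m1 \x m2)%E]_z f z = \int[m1]_x \int[m2]_y f (x, y).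
Proof.
move=> intf; rewrite /Rintegral -(integral12_prod_meas1 intf); congr fine.
have mF := measurable_fubini_F intf.
apply: ae_eq_integral => //.
  by apply/measurable_EFinP/measurableT_comp => //; exact: mF.
have := ae_integrable1 intf; apply: filterS => x /= ix _.
by rewrite fineK//; exact: integrable_fin_num.
Qed.

Definition tcons n (u : R) (x : n.-tuple R) : n.+1.-tuple R :=
  tuple_cons (u, x).

Lemma measurable_tcons n u : measurable_fun setT (@tcons n u).
Proof.
apply: (@measurableT_comp _ _ _ _ _ _ (@tuple_cons _ R n) _ (pair u)) => //.
Qed.

Lemma measurable_tcons2 n : measurable_fun setT (fun z : R * n.-tuple R => tcons z.1 z.2).
Proof.
rewrite (_ : (fun z => _) = @tuple_cons _ R n); last by apply/funext => -[].
exact: measurable_tuple_cons.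
Qed.

Lemma ge0_integral_powerS (g : probability R R) n (F : n.+1.-tuple R -> \bar R) :
  measurable_fun setT F -> (forall x, 0 <= F x)%E ->
  (\int[power_prob g n.+1]_x F x = \int[g]_u \int[power_prob g n]_x F (tcons u x))%E.
Proof.
move=> mF F0; rewrite [LHS]ge0_integral_distribution//.
by rewrite fubini_tonelli1 //; [apply: measurableT_comp | move=> x; exact: F0].
Qed.

Lemma Rintegral_powerS (g : probability R R) n (F : n.+1.-tuple R -> R) :
  (power_prob g n.+1).-integrable setT (EFin \o F) ->
  \int[power_prob g n.+1]_x F x = \int[g]_u \int[power_prob g n]_x F (tcons u x).
Proof.
move=> iF.
have mF : measurable_fun setT F by apply/measurable_EFinP; case/integrableP: iF.
have iF' : (g \x power_prob g n)%E.-integrable setT (EFin \o (F \o @tuple_cons _ R n)).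
  apply/integrableP; split.
    by apply/measurable_EFinP; apply: measurableT_comp.
  case/integrableP: iF => _; rewrite ge0_integral_distribution//.
  by apply: measurableT_comp => //; apply/measurable_EFinP.
rewrite {1}/Rintegral /= integral_distribution//; last exact/measurable_EFinP.
exact: (Rintegral_prod iF').
Qed.

Lemma integrable_powerS (g : probability R R) n (F : n.+1.-tuple R -> R) :
  measurable_fun setT F ->
  (g \x power_prob g n)%E.-integrable setT (EFin \o (F \o @tuple_cons _ R n)) ->
  (power_prob g n.+1).-integrable setT (EFin \o F).
Proof.
move=> mF /integrableP[mF' h]; apply/integrableP; split; first exact/measurable_EFinP.
rewrite ge0_integral_distribution//.
by apply: measurableT_comp => //; apply/measurable_EFinP.
Qed.

Lemma integral_power0 (g : probability R R) (F : 0.-tuple R -> R) :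
  \int[power_prob g 0]_x F x = F [tuple].
Proof.
rewrite /Rintegral /= integral_dirac//; last first.
  apply/measurable_EFinP.
  rewrite (_ : F = cst (F [tuple])); first exact: measurable_cst.
  by apply/funext => x /=; rewrite (tuple0 x).
by rewrite diracT mul1e.
Qed.

End integral_facts.

Section gaussian.
Context {R : realType}.
Notation mu := (@lebesgue_measure R).

(** The Radon-Nikodym derivative of the normal law and its density have the same
    integral over every measurable set, hence agree almost everywhere. *)
Lemma ge0_integral_normal_prob (s : R) (f : R -> \bar R) : s != 0 ->
  measurable_fun setT f -> (forall x, 0 <= f x)%E ->
  (\int[normal_prob 0 s]_x f x = \int[mu]_x (f x * (normal_pdf 0 s x)%:E))%E.
Proof.
move=> s0 mf f0.
have dom := @normal_prob_dominates R 0 s.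
rewrite -(Radon_Nikodym_SigmaFinite.change_of_variables dom)//.
apply: ge0_ae_eq_integral => //.
- apply: emeasurable_funM => //.
  by apply: measurable_int; exact: Radon_Nikodym_SigmaFinite.f_integrable.
- by apply: emeasurable_funM => //; apply/measurable_EFinP; exact: measurable_normal_pdf.
- by move=> x _; rewrite mule_ge0//; exact: Radon_Nikodym_SigmaFinite.f_ge0.
- by move=> x _; rewrite mule_ge0// lee_fin normal_pdf_ge0.
apply: ae_eqe_mul2l; apply: integral_ae_eq => //.
- exact: Radon_Nikodym_SigmaFinite.f_integrable.
- by apply/measurable_EFinP; exact: measurable_normal_pdf.
- by move=> E _ mE; rewrite -Radon_Nikodym_SigmaFinite.f_integral.
Qed.

Definition translate (a : R) (x : measurableTypeR R) : measurableTypeR R :=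
  (x : R) + a.

Lemma measurable_translate a : measurable_fun setT (translate a).
Proof. exact: measurable_funD. Qed.

HB.instance Definition _ a := isMeasurableFun.Build _ _ _ _ (translate a)
  (measurable_translate a).

Lemma ge0_integral_translation (a : R) (f : R -> \bar R) :
  measurable_fun setT f -> (forall x, 0 <= f x)%E ->
  (\int[mu]_x f ((x : R) + a)%R = \int[mu]_x f x)%E.
Proof.
move=> mf f0.
have e A : measurable A -> mu A = pushforward mu (translate a) A.
  apply: lebesgue_measure_unique => //= _ [[u v]] _ <-.
  rewrite /pushforward /=.
  rewrite (_ : _ @^-1` _ = `]u - a, v - a]%classic); last first.
    apply/seteqP; split => x /=; rewrite !in_itv /= /translate => /andP[? ?];
      apply/andP; split; lra.
  rewrite !lebesgue_measure_itv /= !lte_fin ltrD2r.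
  by case: ifP => // _; rewrite -!EFinD; congr EFin; ring.
rewrite [RHS](eq_measure_integral (pushforward mu (translate a))); last by move=> A mA _; exact: e.
by rewrite ge0_integral_pushforward.
Qed.

(** Cameron-Martin formula: complete the square in the density. *)
Lemma ge0_integral_normal_shift (s a : R) (h : R -> \bar R) : s != 0 ->
  measurable_fun setT h -> (forall x, 0 <= h x)%E ->
  (\int[normal_prob 0 s]_x h (a + x)%R =
   \int[normal_prob 0 s]_x (h x * (expR (a * x / s ^+ 2 - a ^+ 2 / (2 * s ^+ 2)))%:E))%E.
Proof.
move=> s0 mh h0.
have ms : measurable_fun setT (fun x : R => a * x / s ^+ 2 - a ^+ 2 / (2 * s ^+ 2)).
  by apply: measurable_funB => //; apply: measurable_funM => //; apply: measurable_funM.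
have ma : measurable_fun setT (fun x : R => h (a + x)).
  by apply: measurableT_comp => //; exact: measurable_funD.
rewrite !ge0_integral_normal_prob//; last 2 first.
- apply: emeasurable_funM => //; apply/measurable_EFinP.
  by apply: measurableT_comp.
- by move=> x; rewrite mule_ge0// lee_fin expR_ge0.
rewrite -[RHS](ge0_integral_translation a); last 2 first.
- apply: emeasurable_funM; last by apply/measurable_EFinP; exact: measurable_normal_pdf.
  apply: emeasurable_funM => //; apply/measurable_EFinP.
  by apply: measurableT_comp.
- by move=> x; rewrite !mule_ge0// lee_fin ?expR_ge0 ?normal_pdf_ge0.
apply: eq_integral => x _; rewrite addrC -muleA -EFinM; congr (_ * EFin _)%E.
rewrite !normal_pdfE// /normal_fun mulrCA -expRD; congr (_ * expR _).
by field.
Qed.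

(** Integrals over tuples use the default Borel structure of the line, whereas the
    normal law lives on a copy of the line with a structure of its own; the
    identity between the two carries the law over. *)
Definition borel_id (x : measurableTypeR R) : R := x.

Lemma measurable_borel_id : measurable_fun setT borel_id.
Proof. by move=> _ A mA; rewrite setTI; exact: mA. Qed.

HB.instance Definition _ := isMeasurableFun.Build _ _ _ _ borel_id
  measurable_borel_id.

Definition gauss (s : R) : probability R R :=
  distribution (normal_prob 0 s) borel_id.

Lemma ge0_integral_gaussE (s : R) (f : R -> \bar R) :
  measurable_fun setT f -> (forall x, 0 <= f x)%E ->
  (\int[gauss s]_x f x = \int[normal_prob 0 s]_x f x)%E.
Proof. by move=> mf f0; rewrite ge0_integral_distribution. Qed.

(** The shift formula for the constant function 1. *)
Lemma normal_expRM (s t : R) : s != 0 ->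
  (\int[normal_prob 0 s]_x (expR (t * x))%:E = (expR (t ^+ 2 * s ^+ 2 / 2))%:E)%E.
Proof.
move=> s0.
have := @ge0_integral_normal_shift s (t * s ^+ 2) (cst 1%E) s0 (measurable_cst _) (fun _ => lee01).
rewrite integral_cst//= probability_setT mul1e => h.
have e x : expR (t * x) = expR (t ^+ 2 * s ^+ 2 / 2) *
  expR (t * s ^+ 2 * x / s ^+ 2 - (t * s ^+ 2) ^+ 2 / (2 * s ^+ 2)).
  by rewrite -expRD; congr expR; field.
under eq_integral do rewrite e EFinM.
rewrite ge0_integralZl//; last first.
  apply/measurable_EFinP; apply: measurableT_comp => //.
  by apply: measurable_funB => //; apply: measurable_funM => //; apply: measurable_funM.
rewrite [X in (_ * X)%E](_ : _ = 1%E) ?mule1// h.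
by apply: eq_integral => x _; rewrite mul1e.
Qed.

Lemma integrable_normal_expRabs (s t : R) : s != 0 ->
  (normal_prob 0 s).-integrable setT (fun x => (expR (t * `|x|))%:E).
Proof.
move=> s0; apply/integrableP; split.
  apply/measurable_EFinP; apply: measurableT_comp => //.
  by apply: measurable_funM.
have mt u : measurable_fun setT (fun x : R => (expR (u * x))%:E) by meas.
apply: (@le_lt_trans _ _ (\int[normal_prob 0 s]_x ((expR (t * x))%:E + (expR (- t * x))%:E)))%E.
  apply: ge0_le_integral => //.
  - by apply: measurableT_comp => //; meas.
  - by apply: emeasurable_funD; exact: mt.
  move=> x _; rewrite /= ger0_norm ?expR_ge0// -EFinD lee_fin.
  case: (leP 0 x) => x0; first by rewrite ger0_norm// lerDl expR_ge0.
  by rewrite ltr0_norm// mulrN -mulNr lerDr expR_ge0.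
rewrite ge0_integralD//; [|exact: mt|exact: mt].
by rewrite !normal_expRM// -EFinD ltry.
Qed.

Lemma ge0_integral_gauss_shift (s a : R) (h : R -> \bar R) : s != 0 ->
  measurable_fun setT h -> (forall x, 0 <= h x)%E ->
  (\int[gauss s]_x h (a + x)%R =
   \int[gauss s]_x (h x * (expR (a * x / s ^+ 2 - a ^+ 2 / (2 * s ^+ 2)))%:E))%E.
Proof.
move=> s0 mh h0; rewrite !ge0_integral_gaussE//; [exact: ge0_integral_normal_shift| | |].
- apply: emeasurable_funM => //; meas.
- by move=> x; rewrite mule_ge0// lee_fin expR_ge0.
- have ma : measurable_fun setT (fun x : R => a + x) by exact: measurable_funD.
  exact: (measurableT_comp mh ma).
Qed.

Lemma gauss_expRM (s t : R) : s != 0 ->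
  (\int[gauss s]_x (expR (t * x))%:E = (expR (t ^+ 2 * s ^+ 2 / 2))%:E)%E.
Proof.
move=> s0; rewrite ge0_integral_gaussE//; first exact: normal_expRM.
- by meas.
Qed.

Lemma integrable_gauss_expRabs (s t : R) : s != 0 ->
  (gauss s).-integrable setT (fun x => (expR (t * `|x|))%:E).
Proof.
move=> s0; have /integrableP[_ h] := @integrable_normal_expRabs s t s0.
apply/integrableP; split; first by meas.
rewrite ge0_integral_gaussE//.
by apply: measurableT_comp => //; meas.
Qed.

End gaussian.

(** * Two-function inequalities and their tensorization *)

Section generalities.
Context {R : realType}.

Lemma Rintegral_gt0 d (T : measurableType d) (mu : probability T R) (f : T -> R) :
  mu.-integrable setT (EFin \o f) -> (forall x, 0 < f x) -> 0 < \int[mu]_x f x.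
Proof.
move=> fi f0; rewrite lt_neqAle Rintegral_ge0 ?andbT; last by move=> x _; exact: ltW.
apply/eqP => h.
have mf : measurable_fun setT (EFin \o f) by case/integrableP: fi.
have : (\int[mu]_x `|(EFin \o f) x| = 0)%E.
  under eq_integral do rewrite /= gtr0_norm ?f0//.
  rewrite -[LHS]fineK; last exact: integrable_fin_num.
  by rewrite -/(Rintegral mu setT f) -h.
move/(ae_eq_integral_abs mu measurableT mf) => [N [mN N0 sub]].
have : (1 <= mu N)%E.
  rewrite -(@probability_setT _ _ _ mu); apply: le_measure; rewrite ?inE//.
  by move=> x _; apply: sub => /= /(_ I) [h0]; have := f0 x; rewrite h0 ltxx.
by rewrite N0; apply/negP; rewrite -ltNge lte01.
Qed.

Lemma integrable_dominated d (T : measurableType d) (mu : {measure set T -> \bar R})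
  (f h : T -> R) : measurable_fun setT f ->
  mu.-integrable setT (EFin \o h) -> (forall x, `|f x| <= h x) ->
  mu.-integrable setT (EFin \o f).
Proof.
move=> mf ih fh; apply: le_integrable ih => //; first exact/measurable_EFinP.
by move=> x _ /=; rewrite lee_fin (le_trans (fh x))// ler_norm.
Qed.

Lemma integrable_bounded d (T : measurableType d) (mu : probability T R)
  (f : T -> R) C : measurable_fun setT f -> (forall x, `|f x| <= C) ->
  mu.-integrable setT (EFin \o f).
Proof.
move=> mf fC; apply: (integrable_dominated (h := cst C)) => //.
exact: finite_measure_integrable_cst.
Qed.

Section real_integrable.
Context d (T : measurableType d) (mu : probability T R).
Implicit Types f : T -> R.

Lemma integrableR_cst k : mu.-integrable setT (EFin \o (fun=> k : R)).
Proof. exact: finite_measure_integrable_cst. Qed.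

Lemma integrableRZ k f : mu.-integrable setT (EFin \o f) ->
  mu.-integrable setT (EFin \o (fun x => k * f x)).
Proof.
move=> fi; rewrite (_ : EFin \o _ = fun x => (k%:E * (f x)%:E)%E) //.
exact: integrableZl.
Qed.

Lemma integrableRD f1 f2 : mu.-integrable setT (EFin \o f1) ->
  mu.-integrable setT (EFin \o f2) ->
  mu.-integrable setT (EFin \o (fun x => f1 x + f2 x)).
Proof.
move=> i1 i2; rewrite (_ : EFin \o _ = (EFin \o f1) \+ (EFin \o f2))%E //.
exact: integrableD.
Qed.

Lemma integrableRB f1 f2 : mu.-integrable setT (EFin \o f1) ->
  mu.-integrable setT (EFin \o f2) ->
  mu.-integrable setT (EFin \o (fun x => f1 x - f2 x)).
Proof.
move=> i1 i2; rewrite (_ : EFin \o _ = (EFin \o f1) \- (EFin \o f2))%E //.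
exact: integrableB.
Qed.

Lemma RintegralP_cst k : \int[mu]_x (k : R) = k.
Proof. by rewrite /Rintegral integral_cst//= probability_setT mule1. Qed.

Lemma measurable_le_set f1 f2 : measurable_fun setT f1 -> measurable_fun setT f2 ->
  measurable [set x | f1 x <= f2 x].
Proof.
by move=> m1 m2; rewrite -[X in measurable X]setTI; exact: measurable_fun_le.
Qed.

Lemma Rintegral_sum (J : Type) (r : seq J) (F : J -> T -> R) :
  (forall j, mu.-integrable setT (EFin \o F j)) ->
  mu.-integrable setT (EFin \o (fun x => \sum_(j <- r) F j x)) /\
  \int[mu]_x (\sum_(j <- r) F j x) = \sum_(j <- r) \int[mu]_x F j x.
Proof.
move=> iF; elim: r => [|j r [IH1 IH2]].
  split; first by under eq_fun do rewrite big_nil; exact: integrableR_cst.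
  by under eq_Rintegral do rewrite big_nil; rewrite RintegralP_cst big_nil.
split; first by under eq_fun do rewrite big_cons; exact: integrableRD.
under eq_Rintegral do rewrite big_cons.
by rewrite RintegralD// big_cons IH2.
Qed.

End real_integrable.

End generalities.

Section loglip.
Context {R : realType}.

Definition l1dist n (x y : n.-tuple R) : R := \sum_i `|tnth x i - tnth y i|.

(** A class that contains [exp (c T)] for Lipschitz [T], that is stable under
    partial integration, and whose members are integrable for laws with
    exponential moments: integrability is settled inside this class. *)
Definition loglip n (L : R) (A : n.-tuple R -> R) : Prop :=
  [/\ measurable_fun setT A, forall x, 0 < A x
    & forall x y, A x <= expR (L * l1dist x y) * A y].

Definition loglip1 (L : R) (A : R -> R) : Prop :=
  [/\ measurable_fun setT A, forall x, 0 < A x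
    & forall x y, A x <= expR (L * `|x - y|) * A y].

Definition expmom (mu : probability R R) : Prop :=
  forall t, mu.-integrable setT (fun x => (expR (t * `|x|))%:E).

Lemma l1dist_tcons n u v (x y : n.-tuple R) :
  l1dist (tcons u x) (tcons v y) = `|u - v| + l1dist x y.
Proof.
rewrite /l1dist big_ord_recl /= !tnth0; congr (_ + _).
by apply: eq_bigr => i _; rewrite !tnthS.
Qed.

Lemma l1dist0 n (x : n.-tuple R) : l1dist x x = 0.
Proof. by rewrite /l1dist big1// => i _; rewrite subrr normr0. Qed.

Lemma loglip_tcons n L (A : n.+1.-tuple R -> R) u :
  loglip L A -> loglip L (A \o tcons u).
Proof.
case=> mA A0 Al; split => //.
- by apply: measurableT_comp => //; exact: measurable_tcons.
- by move=> x; exact: A0.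
- by move=> x y; have := Al (tcons u x) (tcons u y); rewrite l1dist_tcons subrr normr0 add0r.
Qed.

Lemma loglip1_integrable (mu : probability R R) L A : expmom mu -> loglip1 L A ->
  mu.-integrable setT (EFin \o A).
Proof.
move=> emu [mA A0 Al].
apply: (@integrable_dominated _ _ _ mu A (fun x => A 0 * expR (L * `|x|))) => //.
  rewrite (_ : EFin \o _ = (fun x => (A 0)%:E * (expR (L * `|x|))%:E)%E).
    exact: integrableZl.
  by apply/funext => x /=; rewrite EFinM.
by move=> x; rewrite gtr0_norm ?A0// mulrC -[X in `|X|]subr0; exact: Al.
Qed.

(** Induction on the dimension: the section at [u] is at most [exp (L |u|)] times
    the section at 0. *)
Lemma loglip_integrable (mu : probability R R) n L (A : n.-tuple R -> R) :
  expmom mu -> loglip L A -> (power_prob mu n).-integrable setT (EFin \o A).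
Proof.
move=> emu; elim: n => [|n IH] in A *.
  case=> mA A0 Al; apply: (@integrable_bounded _ _ _ _ A (A [tuple])) => // x.
  by rewrite (tuple0 x) gtr0_norm.
move=> HA; have [mA A0 Al] := HA.
apply: integrable_powerS => //; apply/integrable12ltyP.
  by apply/measurable_EFinP; apply: measurableT_comp.
have i0 := IH _ (loglip_tcons 0 HA).
have fin0 : (\int[power_prob mu n]_x (A (tcons 0 x))%:E)%E \is a fin_num.
  exact: integrable_fin_num i0.
apply: (@le_lt_trans _ _ (\int[mu]_u ((expR (L * `|u|))%:E *
    \int[power_prob mu n]_x (A (tcons 0 x))%:E)))%E.
  apply: ge0_le_integral => //.
  - by move=> u _; exact: integral_ge0.
  - apply: (measurable_fun_fubini_tonelli_F (m2 := power_prob mu n)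
       (fun z => `|(EFin \o (A \o @tuple_cons _ R n)) z|%E)) => //.
    apply: measurableT_comp => //; apply/measurable_EFinP; exact: measurableT_comp.
  - by apply: emeasurable_funM => //; case/integrableP: (emu L).
  move=> u _; rewrite -ge0_integralZl//.
  - apply: ge0_le_integral => //.
    + apply: measurableT_comp => //; apply/measurable_EFinP.
      exact: (measurableT_comp mA (@measurable_tcons R n u)).
    + apply: emeasurable_funM => //; by case/integrableP: i0.
    move=> x _; rewrite /= gtr0_norm// -EFinM lee_fin.
    by have := Al (tcons u x) (tcons 0 x); rewrite l1dist_tcons l1dist0 subr0 addr0.
  - by case/integrableP: i0.
  - by move=> x _; rewrite lee_fin ltW.
rewrite ge0_integralZr//.
- by rewrite ltey_eq fin_numM//; exact: integrable_fin_num (emu L).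
- by case/integrableP: (emu L).
- by apply: integral_ge0 => x _; rewrite lee_fin ltW.
Qed.

(** The Lipschitz bound compares two sections pointwise by a factor, and a factor
    passes through the integral. *)
Lemma loglip_marginal (mu : probability R R) n L (A : n.+1.-tuple R -> R) :
  expmom mu -> loglip L A ->
  loglip1 L (fun u => \int[power_prob mu n]_x A (tcons u x)).
Proof.
move=> emu HA; have [mA A0 Al] := HA.
have iu u := loglip_integrable emu (loglip_tcons u HA).
split.
- apply: measurableT_comp => //.
  apply: (measurable_fun_fubini_tonelli_F (m2 := power_prob mu n)
     (EFin \o (A \o @tuple_cons _ R n))) => //.
    by apply/measurable_EFinP; exact: measurableT_comp.
  by move=> x; exact: ltW (A0 _).
- by move=> u; apply: Rintegral_gt0 (iu u) _ => x; exact: A0.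
- move=> u v; rewrite -RintegralZl//; last exact: iu.
  apply: le_Rintegral => //; first exact: iu.
    by rewrite (_ : EFin \o _ = fun x => ((expR (L * `|u - v|))%:E * (A (tcons v x))%:E)%E);
      [apply: integrableZl => //; exact: iu | apply/funext => x /=; rewrite EFinM].
  by move=> x _; have := Al (tcons u x) (tcons v x); rewrite l1dist_tcons l1dist0 addr0.
Qed.

(** Maurey's property (tau) for the cost [c].  The customary form, with the
    infimum convolution of the logarithm of [A], is the case where [B] is the
    largest function that the condition allows. *)
Definition property_tau (mu : probability R R) (c : R -> R -> R) (K : R) : Prop :=
  forall L A B, loglip1 L A -> loglip1 L B ->
    (forall u v, A u * B v <= expR (c u v)) ->
    (\int[mu]_x A x) * (\int[mu]_x B x) <= K.

Lemma loglip1Z L k A : 0 < k -> loglip1 L A -> loglip1 L (fun u => k * A u).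
Proof.
move=> k0 [mA A0 Al]; split.
- exact: measurable_funM.
- by move=> x; rewrite mulr_gt0.
- by move=> x y; rewrite mulrCA ler_pM2l.
Qed.

(** Induction on the dimension.  For fixed first coordinates [u] and [v], the
    inequality in the remaining coordinates bounds the product of the two
    marginals at [u] and [v] by a multiple of [exp (c u v)], which is the
    hypothesis of the inequality in dimension one. *)
Lemma property_tau_tensor (mu : probability R R) c K n L (A B : n.-tuple R -> R) D :
  expmom mu -> 0 < K -> property_tau mu c K -> 0 < D -> loglip L A -> loglip L B ->
  (forall x y, A x * B y <= D * expR (\sum_i c (tnth x i) (tnth y i))) ->
  (\int[power_prob mu n]_x A x) * (\int[power_prob mu n]_x B x) <= D * K ^+ n.
Proof.
move=> emu K0 H1; elim: n => [|n IH] in A B D *.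
  move=> D0 HA HB h; rewrite !integral_power0 expr0 mulr1.
  by have := h [tuple] [tuple]; rewrite big_ord0 expR0 mulr1.
move=> D0 HA HB hAB.
rewrite (Rintegral_powerS (loglip_integrable emu HA)).
rewrite (Rintegral_powerS (loglip_integrable emu HB)).
set A' := fun u => \int[power_prob mu n]_x A (tcons u x).
set B' := fun u => \int[power_prob mu n]_x B (tcons u x).
have hA' : loglip1 L A' by exact: loglip_marginal.
have hB' : loglip1 L B' by exact: loglip_marginal.
have DK0 : 0 < D * K ^+ n by rewrite mulr_gt0// exprn_gt0.
have hAB' u v : A' u * B' v <= D * K ^+ n * expR (c u v).
  rewrite mulrAC; apply: IH.
  - by rewrite mulr_gt0// expR_gt0.
  - exact: loglip_tcons.
  - exact: loglip_tcons.
  move=> x y; have := hAB (tcons u x) (tcons v y).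
  rewrite big_ord_recl /= !tnth0 expRD mulrA.
  by under eq_bigr do rewrite !tnthS.
have := H1 L (fun u => (D * K ^+ n)^-1 * A' u) B'
  (loglip1Z (k := (D * K ^+ n)^-1) ltac:(by rewrite invr_gt0) hA') hB'.
rewrite RintegralZl//; last exact: loglip1_integrable emu hA'.
move=> h; have {}h : (D * K ^+ n)^-1 * (\int[mu]_x A' x) * (\int[mu]_x B' x) <= K.
  by apply: h => u v; rewrite -mulrA ler_pdivrMl.
by move: h; rewrite -mulrA ler_pdivrMl// exprSr mulrA.
Qed.

End loglip.

(** * Two-function inequalities for Gaussian and for bounded laws *)

Section one_dim.
Context {R : realType}.
Notation mu := (@lebesgue_measure R).

Lemma loglip1_continuous L (A : R -> R) : loglip1 L A -> continuous A.
Proof.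
move=> [_ A0 Al].
pose k := `|L| + 1.
have k0 : 0 < k by rewrite ltr_wpDl.
have lnA x y : ln (A x) - ln (A y) <= k * `|x - y|.
  have : A x <= expR (k * `|x - y|) * A y.
    apply: le_trans (Al x y) _; rewrite ler_pM2r// ler_expR ler_wpM2r//.
    by rewrite (le_trans (ler_norm L))// lerDl.
  rewrite -ler_ln ?posrE ?mulr_gt0 ?expR_gt0// lnM ?posrE ?expR_gt0// expRK.
  by rewrite lerBlDr.
have cln : continuous (fun x => ln (A x)).
  move=> x; apply/cvgrPdist_le => /= e e0; near=> y.
  have h : `|ln (A x) - ln (A y)| <= k * `|x - y|.
    by rewrite ler_norml lerNl opprB lnA distrC lnA.
  apply: (le_trans h); rewrite mulrC -ler_pdivlMr//.
  by near: y; apply: cvgr_dist_le => //; rewrite divr_gt0.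
rewrite (_ : A = expR \o (fun x => ln (A x))); last first.
  by apply/funext => x /=; rewrite lnK// posrE.
by move=> x; apply: continuous_comp; [exact: cln | exact: continuous_expR].
Unshelve. all: by end_near. Qed.

Lemma expmom_gauss (s : R) : s != 0 -> expmom (gauss s).
Proof. by move=> s0 t; exact: integrable_gauss_expRabs. Qed.

Lemma Rintegral_gauss (s : R) (A : R -> R) : s != 0 -> measurable_fun setT A ->
  (forall x, 0 <= A x) ->
  \int[gauss s]_x A x = \int[mu]_x (A x * normal_pdf 0 s x).
Proof.
move=> s0 mA A0; rewrite /Rintegral.
by rewrite ge0_integral_gaussE ?ge0_integral_normal_prob//; exact/measurable_EFinP.
Qed.

(** Prekopa-Leindler for [A] and [B] times the density [phi]: by the
    parallelogram identity [phi u phi v = phi ((u + v) / 2)^2 exp (- (u - v)^2 / (4 s^2))],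
    so that this cost is exactly what the density absorbs. *)
Lemma property_tau_gauss (s : R) : s != 0 ->
  property_tau (gauss s) (fun u v => (u - v) ^+ 2 / (4 * s ^+ 2)) 1.
Proof.
move=> s0 L A B HA HB hAB.
have [mA A0 _] := HA; have [mB B0 _] := HB.
have pdf0 x : 0 < normal_pdf 0 s x.
  by rewrite normal_pdfE// mulr_gt0 ?normal_peak_gt0// expR_gt0.
rewrite !Rintegral_gauss//; try by move=> x; exact: ltW.
have cpdf := @continuous_normal_pdf R 0 s s0.
have c A' : loglip1 L A' -> continuous (fun x => A' x * normal_pdf 0 s x).
  move=> H x; apply: cvgM; [exact: (loglip1_continuous H) | exact: cpdf].
have i A' : loglip1 L A' -> mu.-integrable setT (EFin \o (fun x => A' x * normal_pdf 0 s x)).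
  move=> H; have [mA' A0' _] := H.
  have := loglip1_integrable (expmom_gauss s0) H.
  move=> /integrableP[_ h]; apply/integrableP; split.
    by apply/measurable_EFinP; apply: measurable_funM => //; exact: measurable_normal_pdf.
  have mA1 : measurable_fun setT (fun x => `|(EFin \o A') x|)%E.
    by apply: measurableT_comp => //; exact/measurable_EFinP.
  move: h; rewrite ge0_integral_gaussE// ge0_integral_normal_prob//.
  apply: le_lt_trans; apply: le_of_eq.
  by apply: eq_integral => x _; rewrite /= normrM EFinM (gtr0_norm (pdf0 x)).
have -> : 1 = (\int[mu]_x normal_pdf 0 s x) ^+ 2.
  by rewrite /Rintegral integral_normal_pdf /= expr1n.
apply: prekopa_leindler1 => //.
- exact: c.
- exact: c.
- by move=> x; rewrite mulr_gt0.
- by move=> x; rewrite mulr_gt0.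
- exact: i.
- exact: i.
- exact: integrable_normal_pdf.
move=> u v; rewrite mulrACA.
apply: (@le_trans _ _ (expR ((u - v) ^+ 2 / (4 * s ^+ 2)) *
  (normal_pdf 0 s u * normal_pdf 0 s v))).
  by rewrite ler_wpM2r ?hAB// mulr_ge0// ltW.
apply: le_of_eq.
rewrite !normal_pdfE// /normal_fun.
have alg (e1 e2 e3 e4 k : R) : e1 * (e2 * e3) = e4 * e4 ->
    e1 * (k * e2 * (k * e3)) = (k * e4) ^+ 2.
  by move=> h; rewrite exprMn [e4 ^+ 2]expr2 -h; ring.
by apply: alg; rewrite -!expRD; congr expR; field.
Qed.

(** For [x <= 1/2] use [exp (- x) <= 1 / (1 + x)] and its mirror image, for
    larger [x] simply [x <= 2 x^2]. *)
Lemma cosh_le (x : R) : expR x + expR (- x) <= 2 * expR (2 * x ^+ 2).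
Proof.
wlog x0 : x / 0 <= x.
  move=> H; case: (leP 0 x) => [/H//|/ltW h].
  by have := H (- x); rewrite opprK sqrrN addrC; apply; rewrite oppr_ge0.
case: (leP x (2^-1)) => hx.
  have h1 : expR x <= (1 - x)^-1.
    rewrite -[x in leLHS]opprK expRN lef_pV2 ?posrE ?expR_gt0//; last by lra.
    by have := expR_ge1Dx (- x); lra.
  have h2 : expR (- x) <= (1 + x)^-1.
    rewrite expRN lef_pV2 ?posrE ?expR_gt0//; last by lra.
    exact: expR_ge1Dx.
  have h3 : (1 - x)^-1 + (1 + x)^-1 <= 2 * (1 + 2 * x ^+ 2).
    have p1 : 0 < 1 - x by lra.
    have p2 : 0 < 1 + x by lra.
    have x2 : x ^+ 2 <= 4^-1 by nra.
    have p3 : 0 < 1 - x ^+ 2 by lra.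
    rewrite (_ : _ + _ = 2 / (1 - x ^+ 2)); last by field; rewrite !gt_eqF.
    rewrite ler_pdivrMr//; have := sqr_ge0 x; nra.
  have := expR_ge1Dx (2 * x ^+ 2); lra.
have h1 : expR x <= expR (2 * x ^+ 2) by rewrite ler_expR; nra.
have h2 : expR (- x) <= expR x by rewrite ler_expR; lra.
lra.
Qed.

End one_dim.

Section prior.
Context {R : realType} {M : R}.
Implicit Types g : prior M.

Lemma prior_ae g : {ae g, forall x, x \in `[- M, M]%classic}.
Proof.
exists (~` `[- M, M]%classic); split.
- exact: measurableC.
- by have := probability_setC g (measurable_itv `[- M, M]); rewrite prior_supp subee.
- by move=> x /= h hx; apply: h; rewrite inE.
Qed.

Lemma prior_integral_itv g (f : R -> R) : measurable_fun setT f ->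
  \int[g]_x f x = \int[g]_(x in `[- M, M]) f x.
Proof.
move=> mf; rewrite [RHS]Rintegral_mkcond; congr fine; apply: ae_eq_integral => //.
- exact/measurable_EFinP.
- apply/measurable_EFinP; apply/(measurable_restrictT f) => //.
  exact: measurable_funTS.
have := prior_ae g; apply: filterS => x /= hx _.
by rewrite patchE hx.
Qed.

Lemma prior_le g (f1 f2 : R -> R) :
  g.-integrable setT (EFin \o f1) -> g.-integrable setT (EFin \o f2) ->
  (forall x, - M <= x <= M -> f1 x <= f2 x) -> \int[g]_x f1 x <= \int[g]_x f2 x.
Proof.
move=> i1 i2 h.
have m1 : measurable_fun setT f1 by apply/measurable_EFinP; case/integrableP: i1.
have m2 : measurable_fun setT f2 by apply/measurable_EFinP; case/integrableP: i2.
rewrite (prior_integral_itv g m1) (prior_integral_itv g m2); apply: le_Rintegral => //.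
- exact: integrableS i1.
- exact: integrableS i2.
Qed.

Let prior_setT g : g [set: R] = 1%E.
Proof. exact: probability_setT. Qed.

Lemma prior_integrable g (f : R -> R) C : measurable_fun setT f ->
  (forall x, - M <= x <= M -> `|f x| <= C) -> g.-integrable setT (EFin \o f).
Proof.
move=> mf h; apply/integrableP; split; first exact/measurable_EFinP.
apply: (@le_lt_trans _ _ (\int[g]_x C%:E)%E); last first.
  by rewrite integral_cst//= prior_setT mule1 ltry.
have mC : measurable_fun setT (fun x => `|(EFin \o f) x|%E).
  by apply: measurableT_comp => //; exact/measurable_EFinP.
pose D : set R := `[- M, M]%classic.
have mD : measurable D by exact: measurable_itv.
have -> : (\int[g]_x `|(EFin \o f) x| =
    \int[g]_x ((fun x => `|(EFin \o f) x|) \_ D) x)%E.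
  apply: ae_eq_integral => //.
    apply/(measurable_restrictT (fun x => `|(EFin \o f) x|%E)) => //.
    exact: measurable_funTS.
  have := prior_ae g; apply: filterS => x /= hx _.
  by rewrite patchE hx.
rewrite -integral_mkcond.
apply: (@le_trans _ _ (\int[g]_(x in D) C%:E)%E).
  apply: ge0_le_integral => //.
  exact: measurable_funTS.
by rewrite !integral_cst//= /D prior_supp prior_setT.
Qed.

Lemma expmom_prior g : expmom g.
Proof.
move=> t; apply: (@prior_integrable g (fun x => expR (t * `|x|)) (expR (`|t| * M))).
  by meas.
move=> x /andP[h1 h2]; rewrite gtr0_norm ?expR_gt0// ler_expR.
apply: le_trans (ler_norm _) _; rewrite normrM normr_id ler_wpM2l//.
by rewrite ler_norml h1.
Qed.

(** Under [x y <= 1] the sum is largest when one term is [E] and the other [E^-1]. *)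
Lemma sym_le (E x y : R) : 0 < x -> 0 < y -> 1 <= E -> x <= E -> y <= E -> x * y <= 1 ->
  x + y <= E + E^-1.
Proof.
wlog xy : x y / y <= x.
  move=> H; case: (leP y x) => [/H//|/ltW /H h] *; rewrite addrC; apply: h => //.
  by rewrite mulrC.
move=> x0 y0 E1 xE yE xy1.
case: (leP x 1) => x1.
  apply: (@le_trans _ _ (1 + 1)); first by apply: lerD => //; exact: le_trans x1.
  have E0 : 0 < E by exact: lt_le_trans E1.
  rewrite -subr_ge0 (_ : _ - _ = (E - 1) ^+ 2 / E); last by field; rewrite gt_eqF.
  by rewrite divr_ge0 ?sqr_ge0// ltW.
have E0 : 0 < E by exact: lt_le_trans E1.
have h : y <= x^-1 by rewrite -[leRHS]mul1r ler_pdivlMr// mulrC.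
apply: (@le_trans _ _ (x + x^-1)); first by rewrite lerD2l.
rewrite -subr_ge0 (_ : _ - _ = (E - x) * (E * x - 1) / (E * x)); last first.
  by field; rewrite !gt_eqF.
apply: divr_ge0; last by rewrite mulr_ge0// ltW.
apply: mulr_ge0; first by rewrite subr_ge0.
by rewrite subr_ge0 -[leLHS]mul1r; apply: ler_pM => //; exact: ltW.
Qed.

Lemma sqr_sub_le (u v : R) : - M <= u <= M -> - M <= v <= M ->
  (u - v) ^+ 2 <= 4 * M ^+ 2.
Proof.
move=> /andP[u1 u2] /andP[v1 v2].
have h1 : 0 <= 2 * M - (u - v) by lra.
have h2 : 0 <= 2 * M + (u - v) by lra.
have := mulr_ge0 h1 h2; lra.
Qed.

(** Symmetrize in the two variables.  On the diagonal the condition says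
    [A w B w <= 1], hence the product of [A u B v] and [A v B u] is at most 1
    and their sum at most twice the hyperbolic cosine of the cost.  Since
    [cosh x <= exp (2 x^2)], the constant is of second order in [b]; this gain
    over the trivial bound [exp (O b)] is what the concentration below lives
    on. *)
Lemma property_tau_prior g (b : R) : 0 <= b ->
  property_tau g (fun u v => b * (u - v) ^+ 2) (expR (2 * (4 * b * M ^+ 2) ^+ 2)).
Proof.
move=> b0 L A B HA HB hAB.
have [mA A0 _] := HA; have [mB B0 _] := HB.
have iA := loglip1_integrable (expmom_prior g) HA.
have iB := loglip1_integrable (expmom_prior g) HB.
set c := 4 * b * M ^+ 2.
set IA := \int[g]_x A x; set IB := \int[g]_x B x.
(* the symmetrized pointwise bound, then integrated twice *)
have key u v : - M <= u <= M -> - M <= v <= M ->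
    A u * B v + A v * B u <= 2 * expR (2 * c ^+ 2).
  move=> hu hv.
  have hc : b * (u - v) ^+ 2 <= c.
    rewrite /c (_ : 4 * b * M ^+ 2 = b * (4 * M ^+ 2)); last by ring.
    by apply: ler_wpM2l => //; exact: sqr_sub_le.
  have hc' : b * (v - u) ^+ 2 <= c by rewrite -sqrrN opprB.
  apply: le_trans (cosh_le c).
  rewrite expRN; apply: sym_le.
  - by rewrite mulr_gt0.
  - by rewrite mulr_gt0.
  - by rewrite -expR0 ler_expR; apply: mulr_ge0; [apply: mulr_ge0|exact: sqr_ge0].
  - by apply: le_trans (hAB u v) _; rewrite ler_expR.
  - by apply: le_trans (hAB v u) _; rewrite ler_expR.
  - rewrite mulrACA [B v * _]mulrC mulrACA.
    have h w : A w * B w <= 1 by have := hAB w w; rewrite subrr expr0n mulr0 expR0.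
    by rewrite -[leRHS]mulr1; apply: ler_pM; rewrite ?h// mulr_ge0// ltW.
have step1 u : - M <= u <= M -> A u * IB + IA * B u <= 2 * expR (2 * c ^+ 2).
  move=> hu; rewrite -(RintegralP_cst g (2 * _)).
  have -> : A u * IB + IA * B u = \int[g]_v (A u * B v + B u * A v).
    rewrite RintegralD//; [|exact: integrableRZ|exact: integrableRZ].
    by rewrite !RintegralZl// [IA * _]mulrC.
  apply: prior_le; [apply: integrableRD; exact: integrableRZ | exact: integrableR_cst | ].
  by move=> v hv; rewrite [B u * _]mulrC; exact: key.
have : IA * IB + IA * IB <= 2 * expR (2 * c ^+ 2).
  rewrite -[leRHS](RintegralP_cst g (2 * _)).
  have -> : IA * IB + IA * IB = \int[g]_u (IB * A u + IA * B u).
    rewrite RintegralD//; [|exact: integrableRZ|exact: integrableRZ].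
    by rewrite !RintegralZl// [IB * _]mulrC.
  apply: prior_le; [apply: integrableRD; exact: integrableRZ | exact: integrableR_cst | ].
  by move=> u hu; rewrite [IB * _]mulrC; exact: step1.
by rewrite -mulr2n -[leLHS]mulr_natl ler_pM2l.
Qed.

End prior.

(** * Euclidean and operator norms *)

Section l2norm.
Context {R : realType}.

Lemma l2norm_ge0 n (v : 'cV[R]_n) : 0 <= l2norm v.
Proof. exact: sqrtr_ge0. Qed.

Lemma l2norm_sqr n (v : 'cV[R]_n) : l2norm v ^+ 2 = \sum_i v i 0 ^+ 2.
Proof. by rewrite sqr_sqrtr// sumr_ge0// => i _; exact: sqr_ge0. Qed.

Lemma dotvE n (u v : 'cV[R]_n) : dotv u v = \sum_i u i 0 * v i 0.
Proof. by rewrite /dotv !mxE; apply: eq_bigr => i _; rewrite !mxE. Qed.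

Lemma dotvC n (u v : 'cV[R]_n) : dotv u v = dotv v u.
Proof. by rewrite !dotvE; apply: eq_bigr => i _; rewrite mulrC. Qed.

Lemma dotvDr n (u v w : 'cV[R]_n) : dotv u (v + w) = dotv u v + dotv u w.
Proof. by rewrite /dotv mulmxDr !mxE. Qed.

Lemma dotvBr n (u v w : 'cV[R]_n) : dotv u (v - w) = dotv u v - dotv u w.
Proof. by rewrite /dotv mulmxBr !mxE. Qed.

Lemma dotvZr n a (u v : 'cV[R]_n) : dotv u (a *: v) = a * dotv u v.
Proof. by rewrite /dotv -scalemxAr !mxE. Qed.

Lemma dotvv n (v : 'cV[R]_n) : dotv v v = l2norm v ^+ 2.
Proof. by rewrite dotvE l2norm_sqr. Qed.

Lemma dotv_sumr n (I : finType) (P : pred I) (u : 'cV[R]_n) (v : I -> 'cV[R]_n) :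
  dotv u (\sum_(i | P i) v i) = \sum_(i | P i) dotv u (v i).
Proof. by rewrite /dotv mulmx_sumr summxE. Qed.

Lemma dotv_mul n p (X : 'M[R]_(n, p)) u v : dotv u (X *m v) = dotv (X^T *m u) v.
Proof. by rewrite /dotv trmx_mul trmxK mulmxA. Qed.

Lemma cauchy_schwarz n (u v : 'cV[R]_n) : `|dotv u v| <= l2norm u * l2norm v.
Proof.
have key : dotv u v ^+ 2 <= l2norm u ^+ 2 * l2norm v ^+ 2.
  have [v0|v0] := eqVneq (l2norm v ^+ 2) 0.
    have {}v0 i : v i 0 = 0.
      move: v0; rewrite l2norm_sqr => /eqP; rewrite psumr_eq0; last by move=> j _; exact: sqr_ge0.
      by move/allP/(_ i (mem_index_enum i)); rewrite /= sqrf_eq0 => /eqP.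
    rewrite dotvE big1 ?expr0n/=; first by rewrite mulr_ge0 ?sqr_ge0.
    by move=> i _; rewrite v0 mulr0.
  have vp : 0 < l2norm v ^+ 2 by rewrite lt_neqAle eq_sym v0 sqr_ge0.
  have h t : 0 <= l2norm u ^+ 2 - 2 * t * dotv u v + t ^+ 2 * l2norm v ^+ 2.
    have -> : l2norm u ^+ 2 - 2 * t * dotv u v + t ^+ 2 * l2norm v ^+ 2 =
        l2norm (u - t *: v) ^+ 2.
      rewrite -!dotvv !dotvBr !dotvZr ![dotv (_ - _) _]dotvC !dotvBr !dotvZr (dotvC v u).
      by ring.
    exact: sqr_ge0.
  have := h (dotv u v / l2norm v ^+ 2).
  rewrite (_ : _ + _ = l2norm u ^+ 2 - dotv u v ^+ 2 / l2norm v ^+ 2); last by field; move: v0; rewrite sqrf_eq0.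
  by rewrite subr_ge0 ler_pdivrMr.
rewrite -(@ler_pXn2r _ 2) ?nnegrE ?mulr_ge0 ?l2norm_ge0//.
by rewrite exprMn real_normK ?num_real.
Qed.

Lemma l2normD n (u v : 'cV[R]_n) : l2norm (u + v) <= l2norm u + l2norm v.
Proof.
rewrite -(@ler_pXn2r _ 2) ?nnegrE ?addr_ge0 ?l2norm_ge0//.
have -> : l2norm (u + v) ^+ 2 = l2norm u ^+ 2 + 2 * dotv u v + l2norm v ^+ 2.
  by rewrite -!dotvv dotvDr ![dotv (_ + _) _]dotvC !dotvDr (dotvC v u); ring.
have := le_trans (ler_norm _) (cauchy_schwarz u v).
rewrite sqrrD -mulr_natl; lra.
Qed.

Lemma l2normZ n a (v : 'cV[R]_n) : l2norm (a *: v) = `|a| * l2norm v.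
Proof.
rewrite -sqrtr_sqr /l2norm -sqrtrM ?sqr_ge0// mulr_sumr; congr Num.sqrt.
by apply: eq_bigr => i _; rewrite mxE exprMn.
Qed.

Lemma l2normN n (v : 'cV[R]_n) : l2norm (- v) = l2norm v.
Proof. by rewrite -scaleN1r l2normZ normrN1 mul1r. Qed.

Lemma l2norm0 n : l2norm (0 : 'cV[R]_n) = 0.
Proof. by rewrite -(scale0r (0 : 'cV[R]_n)) l2normZ normr0 mul0r. Qed.

Lemma l2norm_dist n (u v : 'cV[R]_n) : `|l2norm u - l2norm v| <= l2norm (u - v).
Proof.
have h (a b : 'cV[R]_n) : l2norm a - l2norm b <= l2norm (a - b).
  by rewrite lerBlDr -{1}(subrK b a) l2normD.
by rewrite ler_norml lerNl opprB h -(l2normN (u - v)) opprB h.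
Qed.

Lemma l2norm_le_l1 n (v : 'cV[R]_n) : l2norm v <= \sum_i `|v i 0|.
Proof.
have h0 : 0 <= \sum_i `|v i 0| by exact: sumr_ge0.
rewrite -(@ler_pXn2r _ 2) ?nnegrE ?l2norm_ge0// l2norm_sqr expr2 mulr_suml.
apply: ler_sum => i _; rewrite -real_normK ?num_real// expr2 ler_wpM2l//.
by rewrite (bigD1 i)//= lerDl sumr_ge0.
Qed.

Lemma l2norm_delta n (j : 'I_n) : l2norm (delta_mx j 0 : 'cV[R]_n) = 1.
Proof.
rewrite /l2norm (bigD1 j)//= mxE !eqxx expr1n big1 ?addr0 ?sqrtr1// => i ij.
by rewrite mxE (negbTE ij) expr0n.
Qed.

Lemma l2norm_unif n (v : 'cV[R]_n) C : 0 <= C -> (forall i, `|v i 0| <= C) ->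
  l2norm v <= C * Num.sqrt n%:R.
Proof.
move=> C0 h; rewrite -[C]ger0_norm// -sqrtr_sqr -sqrtrM ?sqr_ge0// /l2norm.
apply: ler_wsqrtr; rewrite mulr_natr.
apply: (@le_trans _ _ (\sum_(i < n) C ^+ 2)).
  by apply: ler_sum => i _; rewrite -real_normK ?num_real// ler_pXn2r ?nnegrE.
by rewrite sumr_const card_ord.
Qed.

End l2norm.

Section opnorm.
Context {R : realType}.
Variables (n p : nat) (X : 'M[R]_(n, p)).

Lemma FnormE : Fnorm X ^+ 2 = \sum_i \sum_j X i j ^+ 2.
Proof.
by apply: sqr_sqrtr; apply: sumr_ge0 => i _; apply: sumr_ge0 => j _; exact: sqr_ge0.
Qed.

Lemma l2norm_mul_Fnorm v : l2norm (X *m v) <= Fnorm X * l2norm v.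
Proof.
have F0 : 0 <= Fnorm X by exact: sqrtr_ge0.
rewrite -(@ler_pXn2r _ 2) ?nnegrE ?mulr_ge0 ?l2norm_ge0// exprMn.
rewrite FnormE (l2norm_sqr (X *m v)) mulr_suml; apply: ler_sum => i _.
have := cauchy_schwarz (row i X)^T v.
rewrite (_ : dotv _ _ = (X *m v) i 0); last first.
  by rewrite dotvE mxE; apply: eq_bigr => j _; rewrite !mxE.
move=> h; rewrite -real_normK ?num_real//.
rewrite (_ : \sum_j X i j ^+ 2 = l2norm (row i X)^T ^+ 2); last first.
  by rewrite l2norm_sqr; apply: eq_bigr => j _; rewrite !mxE.
by rewrite -exprMn ler_pXn2r ?nnegrE ?mulr_ge0 ?l2norm_ge0.
Qed.

Let opset := [set l2norm (X *m v) | v in [set v : 'cV[R]_p | l2norm v <= 1]].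

Let opset_ub : ubound opset (Fnorm X).
Proof.
move=> _ [v /= hv <-]; apply: le_trans (l2norm_mul_Fnorm v) _.
by rewrite ler_piMr// sqrtr_ge0.
Qed.

Let opset_sup : has_sup opset.
Proof.
split; last by exists (Fnorm X); exact: opset_ub.
by exists (l2norm (X *m 0)), 0 => //=; rewrite l2norm0.
Qed.

Lemma opnorm_ge0 : 0 <= opnorm X.
Proof.
apply: ub_le_sup; first by case: opset_sup.
by exists 0; rewrite /= ?mulmx0 l2norm0.
Qed.

Lemma l2norm_mul v : l2norm (X *m v) <= opnorm X * l2norm v.
Proof.
have [v0|v0] := eqVneq (l2norm v) 0.
  have := l2norm_mul_Fnorm v; rewrite v0 !mulr0 => h; exact: h.
have vp : 0 < l2norm v by rewrite lt_neqAle eq_sym v0 l2norm_ge0.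
have : l2norm (X *m ((l2norm v)^-1 *: v)) <= opnorm X.
  apply: ub_le_sup; first by case: opset_sup.
  exists ((l2norm v)^-1 *: v) => //=.
  by rewrite l2normZ gtr0_norm ?invr_gt0// mulVf.
by rewrite -scalemxAr l2normZ gtr0_norm ?invr_gt0// mulrC ler_pdivrMr.
Qed.

(** Duality: the squared norm of [X^T u] is the pairing of [u] with [X (X^T u)]. *)
Lemma l2norm_trmul u : l2norm (X^T *m u) <= opnorm X * l2norm u.
Proof.
have [v0|v0] := eqVneq (l2norm (X^T *m u)) 0.
  by rewrite v0 mulr_ge0 ?opnorm_ge0 ?l2norm_ge0.
have vp : 0 < l2norm (X^T *m u) by rewrite lt_neqAle eq_sym v0 l2norm_ge0.
rewrite -(ler_pM2l vp) -expr2 -dotvv -dotv_mul.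
apply: le_trans (ler_norm _) _; apply: le_trans (cauchy_schwarz _ _) _.
rewrite [leRHS]mulrA [leRHS]mulrC; apply: ler_wpM2l; first exact: l2norm_ge0.
by rewrite [leRHS]mulrC; exact: l2norm_mul.
Qed.

Lemma l2norm_col j : l2norm (col j X) <= opnorm X.
Proof. by rewrite colE -[leRHS]mulr1 -(@l2norm_delta R p j) l2norm_mul. Qed.

Lemma Fnorm_sqr : Fnorm X ^+ 2 = \sum_j l2norm (col j X) ^+ 2.
Proof.
rewrite FnormE exchange_big /=; apply: eq_bigr => j _; rewrite l2norm_sqr.
by apply: eq_bigr => i _; rewrite mxE.
Qed.

Lemma Fnorm_le : Fnorm X ^+ 2 <= p%:R * opnorm X ^+ 2.
Proof.
rewrite Fnorm_sqr; apply: (@le_trans _ _ (\sum_(j < p) opnorm X ^+ 2)).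
  apply: ler_sum => j _; rewrite ler_pXn2r ?nnegrE ?l2norm_ge0 ?opnorm_ge0//.
  exact: l2norm_col.
by rewrite sumr_const card_ord mulr_natl.
Qed.

End opnorm.

(** * Exponential moments of Lipschitz statistics *)

Section loglip2.
Context {R : realType}.
Variables (mu nu : probability R R) (p n : nat).
Hypotheses (emu : expmom mu) (enu : expmom nu).

Definition loglip2 (L : R) (F : p.-tuple R * n.-tuple R -> R) : Prop :=
  [/\ measurable_fun setT F, forall z, 0 < F z
    & forall z z', F z <= expR (L * (l1dist z.1 z'.1 + l1dist z.2 z'.2)) * F z'].

Variables (L : R) (F : p.-tuple R * n.-tuple R -> R).
Hypothesis HF : loglip2 L F.

Lemma loglip2_section th : loglip L (fun x => F (th, x)).
Proof.
have [mF F0 Fl] := HF; split => //.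
- exact: measurableT_comp mF (measurable_pair1 th).
- by move=> x y; have := Fl (th, x) (th, y); rewrite /= l1dist0 add0r.
Qed.

Let isec th := loglip_integrable enu (loglip2_section th).

Lemma loglip2_marginal : loglip L (fun th => \int[power_prob nu n]_x F (th, x)).
Proof.
have [mF F0 Fl] := HF; split.
- apply: measurableT_comp => //.
  apply: (measurable_fun_fubini_tonelli_F (m2 := power_prob nu n) (EFin \o F)) => //.
    exact/measurable_EFinP.
  by move=> x; exact: ltW (F0 _).
- by move=> th; apply: Rintegral_gt0 (isec th) _.
- move=> u v; rewrite -RintegralZl//.
  apply: le_Rintegral => //.
    exact: integrableRZ (isec v).
  by move=> x _; have := Fl (u, x) (v, x); rewrite /= l1dist0 addr0.
Qed.

Lemma loglip2_integrable :
  (power_prob mu p \x power_prob nu n)%E.-integrable setT (EFin \o F).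
Proof.
have [mF F0 Fl] := HF.
apply/integrable12ltyP; first exact/measurable_EFinP.
have /integrableP[_] := loglip_integrable emu loglip2_marginal.
apply: le_lt_trans; apply: le_of_eq.
apply: eq_integral => th _ /=.
rewrite gtr0_norm; last by apply: Rintegral_gt0 (isec th) _.
rewrite fineK; last exact: integrable_fin_num (isec th).
by apply: eq_integral => x _; rewrite gtr0_norm.
Qed.

Lemma loglip2_Rintegral :
  \int[(power_prob mu p \x power_prob nu n)%E]_z F z =
  \int[power_prob mu p]_th \int[power_prob nu n]_x F (th, x).
Proof. exact: Rintegral_prod loglip2_integrable. Qed.

End loglip2.

Section observations.
Context {R : realType}.

Definition tcol n (x : n.-tuple R) : 'cV[R]_n := \col_i tnth x i.

Definition obs n p (X : 'M[R]_(n, p)) (z : p.-tuple R * n.-tuple R) : 'cV[R]_n :=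
  X *m tcol z.1 + tcol z.2.

Definition coltup n (v : 'cV[R]_n) : n.-tuple R := [tuple v i 0 | i < n].

Lemma coltupK n (v : 'cV[R]_n) : tcol (coltup v) = v.
Proof. by apply/colP => i; rewrite mxE tnth_mktuple. Qed.

Lemma measurable_obs n p (X : 'M[R]_(n, p)) :
  measurable_fun setT (fun z => coltup (obs X z)).
Proof.
apply/measurable_fun_tnthP => i.
rewrite (_ : _ \o _ = fun z => \sum_j X i j * tnth z.1 j + tnth z.2 i); last first.
  apply/funext => z /=; rewrite tnth_mktuple !mxE; congr (_ + _).
  by apply: eq_bigr => j _; rewrite mxE.
apply: measurable_funD.
- apply: measurable_sum => j; apply: measurable_funM => //.
  exact: measurableT_comp (measurable_tnth j) measurable_fst.
- exact: measurableT_comp (measurable_tnth i) measurable_snd.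
Qed.

Definition lipschitz n (l : R) (T : 'cV[R]_n -> R) : Prop :=
  forall y y', `|T y - T y'| <= l * l2norm (y - y').

Definition mtest n (T : 'cV[R]_n -> R) : Prop :=
  measurable_fun setT (fun x : n.-tuple R => T (tcol x)).

Lemma mtest_obs n p (X : 'M[R]_(n, p)) T : mtest T ->
  measurable_fun setT (fun z => T (obs X z)).
Proof.
move=> mT; rewrite (_ : (fun z => _) = (fun x => T (tcol x)) \o (fun z => coltup (obs X z))).
  by apply: measurableT_comp => //; exact: measurable_obs.
by apply/funext => z /=; rewrite coltupK.
Qed.

Lemma tcolB n (x y : n.-tuple R) i : (tcol x - tcol y) i 0 = tnth x i - tnth y i.
Proof. by rewrite !mxE. Qed.

Lemma l2norm_tcol_l1 n (x y : n.-tuple R) : l2norm (tcol x - tcol y) <= l1dist x y.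
Proof.
apply: le_trans (l2norm_le_l1 _) _; rewrite /l1dist.
by apply: ler_sum => i _; rewrite tcolB.
Qed.

Lemma obsB n p (X : 'M[R]_(n, p)) z z' :
  l2norm (obs X z - obs X z') <=
  opnorm X * l2norm (tcol z.1 - tcol z'.1) + l2norm (tcol z.2 - tcol z'.2).
Proof.
rewrite /obs opprD addrACA -mulmxBr; apply: le_trans (l2normD _ _) _.
by rewrite lerD2r l2norm_mul.
Qed.

End observations.

Definition joint {R : realType} {M : R} (n p : nat) (s : R) (g : prior M) :
    probability (p.-tuple R * n.-tuple R)%type R :=
  (power_prob g p \x power_prob (gauss s) n)%E.

Section concentration.
Context {R : realType} {M : R}.
Variables (n p : nat) (X : 'M[R]_(n, p)) (s : R).
Hypothesis s0 : 0 < s.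

Lemma AMGM (a b d : R) : 0 < b -> a * d <= a ^+ 2 / (4 * b) + b * d ^+ 2.
Proof.
move=> b0; rewrite -subr_ge0.
rewrite (_ : _ - _ = (a / (2 * b) - d) ^+ 2 * b); last by field; rewrite gt_eqF.
by rewrite mulr_ge0 ?sqr_ge0 ?ltW.
Qed.

Lemma weighted_le (o a b u v : R) : 0 <= o -> 0 <= u -> 0 <= v -> u <= a ->
  v <= b -> o * u + v <= (o + 1) * (a + b).
Proof.
move=> o0 u0 v0 ua vb; have := ler_wpM2l o0 ua.
have : 0 <= o * b by rewrite mulr_ge0// (le_trans v0).
rewrite mulrDl mul1r mulrDr; lra.
Qed.

Variables (T : 'cV[R]_n -> R) (l : R).
Hypotheses (l0 : 0 <= l) (mT : mtest T) (lT : lipschitz l T).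

Lemma loglip2_test c :
  loglip2 (`|c| * l * (opnorm X + 1)) (fun z => expR (c * T (obs X z))).
Proof.
split.
- apply: measurableT_comp => //; apply: measurable_funM => //; exact: mtest_obs.
- by move=> z; exact: expR_gt0.
move=> z z'; rewrite -expRD ler_expR -lerBlDr -mulrBr.
apply: le_trans (ler_norm _) _; rewrite normrM -!mulrA; apply: ler_wpM2l => //.
apply: le_trans (lT _ _) _; apply: ler_wpM2l => //.
apply: le_trans (obsB _ _ _) _.
by apply: weighted_le; rewrite ?opnorm_ge0 ?l2norm_ge0 ?l2norm_tcol_l1.
Qed.

(** Property (tau), tensorized first in the noise and then in [theta], for
    [exp (c T)] and [exp (- c T)].  In the noise the Lipschitz bound is absorbed
    by the Gaussian cost.  In [theta] the coefficient [b] of the cost is free: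
    absorbing the Lipschitz bound costs a multiple of [1 / b], and the
    constants of the bounded law cost [p] times a multiple of [b^2]. *)
Lemma mgf_two_sided (g : prior M) (c b : R) : 0 <= c -> 0 < b ->
  (\int[joint n p s g]_z expR (c * T (obs X z))) *
  (\int[joint n p s g]_z expR (- c * T (obs X z))) <=
  expR (c ^+ 2 * l ^+ 2 * s ^+ 2 + (c * l * opnorm X) ^+ 2 / (4 * b)
        + p%:R * (32 * b ^+ 2 * M ^+ 4)).
Proof.
move=> c0 b0.
have s_neq0 : s != 0 by rewrite gt_eqF.
have eg := expmom_prior g; have es := expmom_gauss s_neq0.
have HA := loglip2_test c; have HB := loglip2_test (- c).
rewrite normrN in HB.
rewrite (loglip2_Rintegral eg es HA) (loglip2_Rintegral eg es HB).
have cl0 : 0 <= c * l by rewrite mulr_ge0.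
pose D := expR (c ^+ 2 * l ^+ 2 * s ^+ 2 + (c * l * opnorm X) ^+ 2 / (4 * b)).
have -> : expR (c ^+ 2 * l ^+ 2 * s ^+ 2 + (c * l * opnorm X) ^+ 2 / (4 * b)
        + p%:R * (32 * b ^+ 2 * M ^+ 4)) = D * expR (2 * (4 * b * M ^+ 2) ^+ 2) ^+ p.
  by rewrite expRD -expRM_natl; congr (_ * expR (_ * _)); ring.
apply: (property_tau_tensor eg (expR_gt0 _) (property_tau_prior g (ltW b0)) (expR_gt0 _)
  (loglip2_marginal es HA) (loglip2_marginal es HB)).
move=> x y.
apply: (@le_trans _ _ (expR (c ^+ 2 * l ^+ 2 * s ^+ 2 + c * l * opnorm X * l2norm (tcol x - tcol y)))).
  rewrite -[leRHS]mulr1 -[X in _ <= _ * X](expr1n _ n).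
  apply: (property_tau_tensor es ltr01 (property_tau_gauss s_neq0) (expR_gt0 _)
    (loglip2_section HA x) (loglip2_section HB y)).
  move=> u v; rewrite -!expRD ler_expR mulNr -mulrBr.
  apply: (@le_trans _ _ (c * (l * (opnorm X * l2norm (tcol x - tcol y) + l2norm (tcol u - tcol v))))).
    apply: ler_wpM2l => //; apply: le_trans (ler_norm _) _; apply: le_trans (lT _ _) _.
    by apply: ler_wpM2l => //; exact: obsB (x, u) (y, v).
  have -> : \sum_(i < n) (tnth u i - tnth v i) ^+ 2 / (4 * s ^+ 2) =
     (4 * s ^+ 2)^-1 * l2norm (tcol u - tcol v) ^+ 2.
    rewrite l2norm_sqr mulr_sumr; apply: eq_bigr => i _.
    by rewrite tcolB mulrC.
  have := @AMGM (c * l) (4 * s ^+ 2)^-1 (l2norm (tcol u - tcol v)).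
  rewrite invr_gt0 mulr_gt0 ?exprn_gt0// => /(_ isT).
  rewrite (_ : (c * l) ^+ 2 / _ = c ^+ 2 * l ^+ 2 * s ^+ 2); last by field.
  by lra.
rewrite /D -expRD ler_expR -addrA lerD2l.
apply: le_trans (AMGM _ _ b0) _; rewrite lerD2l l2norm_sqr mulr_sumr.
by apply: ler_sum => i _; rewrite tcolB.
Qed.

Lemma integrable_mgf (g : prior M) (c : R) :
  (joint n p s g).-integrable setT (EFin \o (fun z => expR (c * T (obs X z)))).
Proof.
have s_neq0 : s != 0 by rewrite gt_eqF.
exact: (loglip2_integrable (expmom_prior g) (expmom_gauss s_neq0) (loglip2_test c)).
Qed.

Lemma integrable_test (g : prior M) :
  (joint n p s g).-integrable setT (EFin \o (fun z => T (obs X z))).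
Proof.
apply: (integrable_dominated (h := fun z => expR (1 * T (obs X z)) + expR (- 1 * T (obs X z)))).
- exact: mtest_obs.
- exact: integrableRD (integrable_mgf g 1) (integrable_mgf g (- 1)).
move=> z; rewrite mul1r mulN1r; set t := T _.
have h1 := expR_ge1Dx t; have h2 := expR_ge1Dx (- t).
have h3 := expR_gt0 t; have h4 := expR_gt0 (- t).
by rewrite ler_norml; apply/andP; split; lra.
Qed.

End concentration.

Section deviations.
Context {R : realType} d (T : measurableType d) (mu : probability T R).
Variables (f : T -> R) (c W : R).
Hypotheses (c0 : 0 < c) (fi : mu.-integrable setT (EFin \o f)).
Hypothesis i1 : mu.-integrable setT (EFin \o (fun x => expR (c * f x))).
Hypothesis i2 : mu.-integrable setT (EFin \o (fun x => expR (- c * f x))).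
Hypothesis hW : (\int[mu]_x expR (c * f x)) * (\int[mu]_x expR (- c * f x)) <= W.
Let m := \int[mu]_x f x.

(** The tangent line of the exponential at the mean. *)
Lemma jensen_expR (a : R) : mu.-integrable setT (EFin \o (fun x => expR (a * f x))) ->
  expR (a * m) <= \int[mu]_x expR (a * f x).
Proof.
move=> ia.
have ii : mu.-integrable setT (EFin \o (fun x => expR (a * m) * (1 + (a * f x - a * m)))).
  apply: integrableRZ; apply: integrableRD; first exact: integrableR_cst.
  by apply: integrableRB; [exact: integrableRZ | exact: integrableR_cst].
have -> : expR (a * m) = \int[mu]_x (expR (a * m) * (1 + (a * f x - a * m))).
  rewrite RintegralZl//; last first.
    apply: integrableRD; first exact: integrableR_cst.
    by apply: integrableRB; [exact: integrableRZ | exact: integrableR_cst].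
  rewrite RintegralD//; [|exact: integrableR_cst|]; last first.
    by apply: integrableRB; [exact: integrableRZ | exact: integrableR_cst].
  rewrite RintegralB//; [|exact: integrableRZ|exact: integrableR_cst].
  by rewrite RintegralZl// !RintegralP_cst -/m subrr addr0 mulr1.
apply: le_Rintegral => // x _.
have -> : expR (a * f x) = expR (a * m) * expR (a * f x - a * m).
  by rewrite -expRD; congr expR; ring.
by apply: ler_wpM2l; [exact: expR_ge0 | exact: expR_ge1Dx].
Qed.

Lemma mgf_upper : \int[mu]_x expR (c * f x) <= W * expR (c * m).
Proof.
have h := jensen_expR i2.
have p1 : 0 < expR (- c * m) by exact: expR_gt0.
have : (\int[mu]_x expR (c * f x)) * expR (- c * m) <= W.
  apply: le_trans hW; apply: ler_wpM2l => //.
  by apply: Rintegral_ge0 => x _; exact: expR_ge0.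
by rewrite -ler_pdivlMr// -expRN mulNr opprK.
Qed.

Lemma mgf_lower : \int[mu]_x expR (- c * f x) <= W * expR (- c * m).
Proof.
have h := jensen_expR i1.
have p1 : 0 < expR (c * m) by exact: expR_gt0.
have : (\int[mu]_x expR (- c * f x)) * expR (c * m) <= W.
  apply: le_trans hW; rewrite [leRHS]mulrC; apply: ler_wpM2l => //.
  by apply: Rintegral_ge0 => x _; exact: expR_ge0.
by rewrite -ler_pdivlMr// -expRN mulNr.
Qed.

(** Chernoff's bound.  Jensen's inequality bounds either exponential moment from
    below, so that a bound of their product controls each of them around the
    mean. *)
Lemma deviation (t : R) : (mu [set x | (t <= `|f x - m|)%R] <= (2 * W * expR (- (c * t)))%:E)%E.
Proof.
have mf : measurable_fun setT f by apply/measurable_EFinP; case/integrableP: fi.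
have mS : measurable [set x | t <= `|f x - m|].
  by apply: measurable_le_set => //; meas.
pose h x := expR (- c * m - c * t) * expR (c * f x) + expR (c * m - c * t) * expR (- c * f x).
have ih : mu.-integrable setT (EFin \o h).
  by apply: integrableRD; exact: integrableRZ.
apply: (@le_trans _ _ (\int[mu]_x h x)%:E); last first.
  rewrite lee_fin RintegralD//; [|exact: integrableRZ|exact: integrableRZ].
  rewrite !RintegralZl//.
  have h1 : expR (- c * m - c * t) * (\int[mu]_x expR (c * f x)) <= W * expR (- (c * t)).
    apply: (le_trans (ler_wpM2l (expR_ge0 _) mgf_upper)).
    rewrite mulrCA -expRD (_ : - c * m - c * t + c * m = - (c * t)) //; ring.
  have h2 : expR (c * m - c * t) * (\int[mu]_x expR (- c * f x)) <= W * expR (- (c * t)).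
    apply: (le_trans (ler_wpM2l (expR_ge0 _) mgf_lower)).
    rewrite mulrCA -expRD (_ : c * m - c * t + - c * m = - (c * t)) //; ring.
  by apply: le_trans (lerD h1 h2) _; rewrite -mulr2n -mulrA mulr_natl.
rewrite -(@setIT _ [set x | _]) -integral_indic// /Rintegral fineK; last exact: integrable_fin_num.
apply: ge0_le_integral => //.
- by apply/measurable_EFinP; exact: measurable_indic.
- by case/integrableP: ih.
move=> x _ /=; rewrite lee_fin indicE.
case: (boolP (x \in _)) => [|_]; last by rewrite addr_ge0// mulr_ge0// expR_ge0.
rewrite inE /= => hx; rewrite /h -!expRD.
move: hx; rewrite ler_normr => /orP[] hx.
  apply: (@le_trans _ _ (expR (- c * m - c * t + c * f x))); last by rewrite lerDl expR_ge0.
  rewrite -expR0 ler_expR; have := ler_wpM2l (ltW c0) hx; lra.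
apply: (@le_trans _ _ (expR (c * m - c * t + - c * f x))); last by rewrite lerDr expR_ge0.
rewrite -expR0 ler_expR; have := ler_wpM2l (ltW c0) hx; lra.
Qed.

Lemma sqr_le_cosh (x : R) : x ^+ 2 <= 4 * (expR x + expR (- x) - 2).
Proof.
wlog x0 : x / 0 <= x.
  move=> H; case: (leP 0 x) => [/H//|/ltW h].
  by have := H (- x); rewrite opprK sqrrN [expR (- x) + _]addrC; apply; rewrite oppr_ge0.
have e1 : expR x = expR (x / 2) ^+ 2 by rewrite expr2 -expRD -splitr.
have e2 : expR (- x) = expR (- (x / 2)) ^+ 2 by rewrite expr2 -expRD -opprD -splitr.
have e3 : expR (x / 2) * expR (- (x / 2)) = 1 by rewrite -expRD subrr expR0.
have -> : expR x + expR (- x) - 2 = (expR (x / 2) - expR (- (x / 2))) ^+ 2.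
  by rewrite e1 e2 sqrrB e3; ring.
have h1 := expR_ge1Dx (x / 2).
have h2 : expR (- (x / 2)) <= 1 by rewrite -[leRHS]expR0 ler_expR; lra.
have -> : x ^+ 2 = 4 * (x / 2) ^+ 2 by field.
rewrite ler_pM2l//.
have h3 : x / 2 <= expR (x / 2) - expR (- (x / 2)) by lra.
have h4 : 0 <= x / 2 by rewrite divr_ge0.
by rewrite ler_pXn2r// nnegrE (le_trans h4).
Qed.

(** By [sqr_le_cosh], whose right-hand side has a small integral when [W] is close
    to 1. *)
Lemma variance_le : mu.-integrable setT (EFin \o (fun x => (f x - m) ^+ 2)) /\
  \int[mu]_x (f x - m) ^+ 2 <= 8 * (W - 1) / c ^+ 2.
Proof.
have mf : measurable_fun setT f by apply/measurable_EFinP; case/integrableP: fi.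
pose h x := 4 / c ^+ 2 * (expR (- c * m) * expR (c * f x) + expR (c * m) * expR (- c * f x) - 2).
have ih1 : mu.-integrable setT (EFin \o (fun x => expR (- c * m) * expR (c * f x) + expR (c * m) * expR (- c * f x))).
  by apply: integrableRD; exact: integrableRZ.
have ih : mu.-integrable setT (EFin \o h).
  by apply: integrableRZ; apply: integrableRB => //; exact: integrableR_cst.
have hle x : (f x - m) ^+ 2 <= h x.
  rewrite /h -!expRD mulrAC ler_pdivlMr ?exprn_gt0//.
  have := sqr_le_cosh (c * (f x - m)).
  rewrite exprMn mulrC (_ : - c * m + c * f x = c * (f x - m)); last by ring.
  by rewrite (_ : c * m + - c * f x = - (c * (f x - m))); last by ring.
have i0 : mu.-integrable setT (EFin \o (fun x => (f x - m) ^+ 2)).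
  apply: (integrable_dominated (h := h)) => //; first by meas.
  by move=> x; rewrite ger0_norm ?sqr_ge0.
split => //.
apply: (@le_trans _ _ (\int[mu]_x h x)); first exact: le_Rintegral.
rewrite RintegralZl//; last by apply: integrableRB => //; exact: integrableR_cst.
rewrite RintegralB//; last exact: integrableR_cst.
rewrite RintegralP_cst RintegralD//; [|exact: integrableRZ|exact: integrableRZ].
rewrite !RintegralZl//.
have h1 : expR (- c * m) * (\int[mu]_x expR (c * f x)) <= W.
  apply: (le_trans (ler_wpM2l (expR_ge0 _) mgf_upper)).
  by rewrite mulrCA -expRD mulNr addNr expR0 mulr1.
have h2 : expR (c * m) * (\int[mu]_x expR (- c * f x)) <= W.
  apply: (le_trans (ler_wpM2l (expR_ge0 _) mgf_lower)).
  by rewrite mulrCA -expRD mulNr subrr expR0 mulr1.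
have hc : 0 <= 4 / c ^+ 2 by rewrite divr_ge0// sqr_ge0.
have h3 : expR (- c * m) * (\int[mu]_x expR (c * f x)) +
  expR (c * m) * (\int[mu]_x expR (- c * f x)) - 2 <= 2 * (W - 1) by lra.
apply: le_trans (ler_wpM2l hc h3) _.
by apply: le_of_eq; ring.
Qed.

End deviations.

(** * Uniform concentration *)

Section uniform_concentration.
Context {R : realType} {M : R}.
Hypothesis M0 : 0 < M.

(** The scale at which a statistic concentrates: its Lipschitz constant is of
    order [p^(-1/2)] relative to the norm of [X] and to the noise level. *)
Record good_stat (C : R) n p (X : 'M[R]_(n, p)) (s : R) (T : 'cV[R]_n -> R) (l : R) : Prop :=
  GoodStat {
    good_l0 : 0 <= l ;
    good_mtest : mtest T ;
    good_lip : lipschitz l T ;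
    good_op : p%:R * (l * opnorm X) ^+ 2 <= C ;
    good_noise : p%:R * (l * s) ^+ 2 <= C }.

Variable C : R.
Let K := 2 * C + 32 * M ^+ 4.

(** With [c = r^3 p] and [b = r^2] in [mgf_two_sided], all terms of the exponent
    are of order [p r^4]. *)
Lemma good_exponent (pr r l s N : R) : 0 < pr -> 0 < r -> r <= 1 ->
  pr * (l * N) ^+ 2 <= C -> pr * (l * s) ^+ 2 <= C ->
  (r ^+ 3 * pr) ^+ 2 * l ^+ 2 * s ^+ 2 + (r ^+ 3 * pr * l * N) ^+ 2 / (4 * r ^+ 2)
        + pr * (32 * (r ^+ 2) ^+ 2 * M ^+ 4) <= pr * r ^+ 4 * K.
Proof.
move=> p0 r0 r1 h1 h2.
have C0 : 0 <= C by apply: le_trans h1; rewrite mulr_ge0 ?sqr_ge0 ?ltW.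
have -> : (r ^+ 3 * pr) ^+ 2 * l ^+ 2 * s ^+ 2 + (r ^+ 3 * pr * l * N) ^+ 2 / (4 * r ^+ 2)
        + pr * (32 * (r ^+ 2) ^+ 2 * M ^+ 4) =
  pr * r ^+ 4 * (r ^+ 2 * (pr * (l * s) ^+ 2) + 4^-1 * (pr * (l * N) ^+ 2) + 32 * M ^+ 4).
  by field; rewrite gt_eqF.
rewrite ler_wpM2l//; first by rewrite mulr_ge0 ?exprn_ge0 ?ltW.
rewrite /K lerD2r.
have h3 : r ^+ 2 * (pr * (l * s) ^+ 2) <= C.
  apply: le_trans h2; rewrite ler_piMl ?exprn_ile1 ?(ltW r0)//.
  by rewrite mulr_ge0 ?sqr_ge0 ?ltW.
lra.
Qed.

Lemma mgf_good n p (X : 'M[R]_(n, p)) s T l (g : prior M) (r : R) :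
  (0 < p)%N -> 0 < s -> good_stat C X s T l -> 0 < r -> r <= 1 ->
  (\int[joint n p s g]_z expR (r ^+ 3 * p%:R * T (obs X z))) *
  (\int[joint n p s g]_z expR (- (r ^+ 3 * p%:R) * T (obs X z))) <=
  expR (p%:R * r ^+ 4 * K).
Proof.
move=> p0 s0 [l0 mT lT h1 h2] r0 r1.
have c0 : 0 <= r ^+ 3 * p%:R by rewrite mulr_ge0 ?exprn_ge0 ?(ltW r0).
apply: le_trans (mgf_two_sided X s0 l0 mT lT g c0 (exprn_gt0 2 r0)) _.
by rewrite ler_expR good_exponent// ltr0n.
Qed.

(** The exponent [p r^4 K] lost in [mgf_good] is smaller than the gain [r^3 p t]
    of Chernoff's bound once [r] is small compared to [t / K]. *)
Lemma concentration t : 0 < t -> 0 <= C -> exists2 c, 0 < c &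
  forall n p (X : 'M[R]_(n, p)) s T l (g : prior M),
  (0 < p)%N -> 0 < s -> good_stat C X s T l ->
  (joint n p s g [set z | (t <= `|T (obs X z) - \int[joint n p s g]_z T (obs X z)|)%R]
   <= (2 * expR (- (c * p%:R)))%:E)%E.
Proof.
move=> t0 C0.
have K0 : 0 < K by rewrite /K ltr_wpDl// ?mulr_ge0// mulr_gt0// exprn_gt0.
(* r K <= t / 2 leaves half of the gain *)
pose r := Num.min 1 (t / (2 * K)).
have r0 : 0 < r by rewrite lt_min ltr01 divr_gt0// mulr_gt0.
have r1 : r <= 1 by rewrite ge_min lexx.
have rt : r * K <= t / 2.
  have : r <= t / (2 * K) by rewrite ge_min lexx orbT.
  rewrite ler_pdivlMr ?mulr_gt0//; lra.
exists (r ^+ 3 * t / 2); first by rewrite divr_gt0// mulr_gt0// exprn_gt0.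
move=> n p X s T l g p0 s0 GT; have [l0 mT lT h1 h2] := GT.
have c0 : 0 < r ^+ 3 * p%:R by rewrite mulr_gt0 ?exprn_gt0// ltr0n.
have := deviation c0 (integrable_test X s0 l0 mT lT g)
  (integrable_mgf X s0 l0 mT lT g _) (integrable_mgf X s0 l0 mT lT g _)
  (mgf_good g p0 s0 GT r0 r1) t.
move=> h; apply: le_trans h _; rewrite lee_fin -mulrA ler_pM2l// -expRD ler_expR.
have h3 : 0 <= r ^+ 3 * p%:R by exact: ltW.
have := ler_wpM2l h3 rt.
move: (p%:R : R) => q; rewrite (_ : q * r ^+ 4 * K = r ^+ 3 * q * (r * K)); last by ring.
lra.
Qed.

(** Take [r = p^(-1/4)], for which the exponent [p r^4 K] is bounded. *)
Lemma variance_good n p (X : 'M[R]_(n, p)) s T l (g : prior M) :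
  (0 < p)%N -> 0 < s -> good_stat C X s T l ->
  (joint n p s g).-integrable setT
    (EFin \o (fun z => (T (obs X z) - \int[joint n p s g]_z T (obs X z)) ^+ 2)) /\
  \int[joint n p s g]_z (T (obs X z) - \int[joint n p s g]_z T (obs X z)) ^+ 2 <=
  8 * expR K / Num.sqrt p%:R.
Proof.
move=> p0 s0 GT; have [l0 mT lT h1 h2] := GT.
have q0 : 0 < p%:R :> R by rewrite ltr0n.
have q1 : 1 <= p%:R :> R by rewrite ler1n.
pose w := Num.sqrt (p%:R : R).
have w0 : 0 < w by rewrite sqrtr_gt0.
have w2 : w ^+ 2 = p%:R by rewrite sqr_sqrtr// ltW.
pose r := Num.sqrt w^-1.
have r0 : 0 < r by rewrite sqrtr_gt0 invr_gt0.
have r2 : r ^+ 2 = w^-1 by rewrite sqr_sqrtr// invr_ge0 ltW.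
have w1 : 1 <= w.
  by rewrite -(@ler_pXn2r _ 2) ?nnegrE ?(ltW w0)// w2 expr1n.
have r1 : r <= 1.
  by rewrite -(@ler_pXn2r _ 2) ?nnegrE ?(ltW r0)// r2 expr1n invf_le1.
have c0 : 0 < r ^+ 3 * p%:R by rewrite mulr_gt0 ?exprn_gt0.
have := variance_le c0 (integrable_test X s0 l0 mT lT g)
  (integrable_mgf X s0 l0 mT lT g _) (integrable_mgf X s0 l0 mT lT g _)
  (mgf_good g p0 s0 GT r0 r1).
have -> : (r ^+ 3 * p%:R) ^+ 2 = w.
  rewrite (_ : (r ^+ 3 * p%:R) ^+ 2 = (r ^+ 2) ^+ 3 * p%:R ^+ 2); last by ring.
  by rewrite r2 -w2; field; rewrite gt_eqF.
have -> : p%:R * r ^+ 4 * K = K.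
  rewrite (_ : r ^+ 4 = (r ^+ 2) ^+ 2); last by ring.
  by rewrite r2 -w2; field; rewrite gt_eqF.
case=> h3 h4; split => //; apply: le_trans h4 _.
rewrite -/w ler_pM2r ?invr_gt0// ler_pM2l// lerBlDr lerDl//.
Qed.

End uniform_concentration.

Section cameron_martin.
Context {R : realType}.
Variable s : R.
Hypothesis s0 : s != 0.

Definition tadd n (w x : n.-tuple R) : n.-tuple R := [tuple tnth w i + tnth x i | i < n].

Lemma measurable_tadd n w : measurable_fun setT (@tadd n w).
Proof.
apply/measurable_fun_tnthP => i.
rewrite (_ : _ \o _ = fun x => tnth w i + tnth x i); last first.
  by apply/funext => x /=; rewrite tnth_mktuple.
by apply: measurable_funD => //; exact: measurable_tnth.
Qed.

Definition tdot n (w x : n.-tuple R) := \sum_i tnth w i * tnth x i.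

Lemma measurable_tdot n w : measurable_fun setT (@tdot n w).
Proof.
apply: measurable_sum => i; apply: measurable_funM => //; exact: measurable_tnth.
Qed.

Lemma tcons_eta n (x : n.+1.-tuple R) : x = tcons (thead x) (behead_tuple x).
Proof. by apply: val_inj; rewrite [in LHS](tuple_eta x). Qed.

Lemma tadd_tcons n a (w : n.-tuple R) u x :
  tadd (tcons a w) (tcons u x) = tcons (a + u) (tadd w x).
Proof.
apply: eq_from_tnth => i; rewrite tnth_mktuple.
case: (unliftP ord0 i) => [j|] ->; last by rewrite !tnth0.
by rewrite !tnthS tnth_mktuple.
Qed.

Lemma tdot_tcons n a (w : n.-tuple R) u x :
  tdot (tcons a w) (tcons u x) = a * u + tdot w x.
Proof.
rewrite /tdot big_ord_recl !tnth0; congr (_ + _).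
by apply: eq_bigr => i _; rewrite !tnthS.
Qed.

(** The Cameron-Martin formula, one coordinate at a time. *)
Lemma ge0_integral_power_shift n (w : n.-tuple R) (h : n.-tuple R -> \bar R) :
  measurable_fun setT h -> (forall x, 0 <= h x)%E ->
  (\int[power_prob (gauss s) n]_x h (tadd w x) =
   \int[power_prob (gauss s) n]_x
     (h x * (expR (tdot w x / s ^+ 2 - tdot w w / (2 * s ^+ 2)))%:E))%E.
Proof.
elim: n => [|n IH] in w h *.
  move=> mh h0; apply: eq_integral => x _.
  rewrite (tuple0 w) (tuple0 x) /tdot !big_ord0 !mul0r subrr expR0 mule1.
  by congr h; exact: tuple0.
move=> mh h0; have mE m (v : m.-tuple R) : measurable_fun setT
    (fun x => (expR (tdot v x / s ^+ 2 - tdot v v / (2 * s ^+ 2)))%:E).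
  apply/measurable_EFinP; apply: measurableT_comp => //; apply: measurable_funB => //.
  by apply: measurable_funM => //; exact: measurable_tdot.
have mh1 u : measurable_fun setT (fun x => h (tcons u x)).
  exact: measurableT_comp mh (measurable_tcons u).
rewrite ge0_integral_powerS; [|exact: measurableT_comp mh (measurable_tadd w)|by move=> x; exact: h0].
rewrite ge0_integral_powerS; last 2 first.
- by apply: emeasurable_funM => //; exact: mE.
- by move=> x; rewrite mule_ge0// lee_fin expR_ge0.
rewrite (tcons_eta w); set a := thead w; set v := behead_tuple w.
pose H u := (\int[power_prob (gauss s) n]_x
  (h (tcons u x) * (expR (tdot v x / s ^+ 2 - tdot v v / (2 * s ^+ 2)))%:E))%E.
have mH : measurable_fun setT H.
  apply: (measurable_fun_fubini_tonelli_F (m2 := power_prob (gauss s) n)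
   (fun z => (h (tcons z.1 z.2) * (expR (tdot v z.2 / s ^+ 2 - tdot v v / (2 * s ^+ 2)))%:E)%E)).
  - apply: emeasurable_funM.
      exact: measurableT_comp mh (@measurable_tcons2 R n).
    exact: measurableT_comp (mE n v) measurable_snd.
  - by move=> z; rewrite mule_ge0// lee_fin expR_ge0.
transitivity (\int[gauss s]_u H (a + u)%R)%E.
  apply: eq_integral => u _; rewrite /H -(IH v (fun x => h (tcons (a + u) x)))//.
  by apply: eq_integral => x _; rewrite tadd_tcons.
have H0 u : (0 <= H u)%E.
  by apply: integral_ge0 => x _; rewrite mule_ge0// lee_fin expR_ge0.
apply: etrans (ge0_integral_gauss_shift a s0 mH H0) _.
apply: eq_integral => u _; rewrite /H -ge0_integralZr//.
- apply: eq_integral => x _; rewrite -muleA -EFinM -expRD; congr (_ * EFin (expR _))%E.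
  by rewrite !tdot_tcons -expr2; field.
- by apply: emeasurable_funM => //; exact: mE.
- by move=> x _; rewrite mule_ge0// lee_fin expR_ge0.
Qed.

End cameron_martin.

(** * The law of the model *)

Section boxes.
Context {R : realType}.

Definition box n (A : 'I_n -> set R) : set (n.-tuple R) :=
  [set x | forall i, A i (tnth x i)].

Lemma measurable_box n (A : 'I_n -> set R) :
  (forall i, measurable (A i)) -> measurable (box A).
Proof.
move=> mA; rewrite (_ : box A = \bigcap_(i in setT) (fun x => tnth x i) @^-1` A i).
  apply: fin_bigcap_measurable => // i _.
  by rewrite -[X in measurable X]setTI; exact: measurable_tnth.
by apply/seteqP; split => x /= h i; [move=> _; exact: h | exact: h].
Qed.

Lemma power_prob_box (g : probability R R) n (A : 'I_n -> set R) :
  (forall i, measurable (A i)) -> power_prob g n (box A) = (\prod_i g (A i))%E.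
Proof.
elim: n => [|n IH] in A * => mA.
  rewrite big_ord0 /= diracE (_ : _ \in _) // inE => -[] //.
rewrite big_ord_recl -(IH (fun i => A (lift ord0 i)))//.
rewrite /= /distribution /pushforward.
rewrite -product_measure1E//; last by apply: measurable_box => i; exact: mA.
congr (_ _); apply/seteqP; split => -[u x] /=.
  move=> h; split; first by have := h ord0; rewrite tnth0.
  by move=> i; have := h (lift ord0 i); rewrite tnthS.
move=> [hu hx] i; case: (unliftP ord0 i) => [j|] ->; last by rewrite tnth0.
by rewrite tnthS; exact: hx.
Qed.

End boxes.

Section joint_law.
Context {R : realType} {M : R}.
Context d (T : measurableType d) (P : probability T R) (n p : nat).
Variables (g : prior M) (s2 : R) (theta : 'I_p -> {RV P >-> R}) (eps : 'I_n -> {RV P >-> R}).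

Definition model_tuple (w : T) : p.-tuple R * n.-tuple R :=
  ([tuple theta j w | j < p], [tuple eps i w | i < n]).

Lemma measurable_model_tuple : measurable_fun setT model_tuple.
Proof.
apply: measurable_fun_pair; apply/measurable_fun_tnthP => i.
- rewrite (_ : _ \o _ = theta i) //; apply/funext => w /=; exact: tnth_mktuple.
- rewrite (_ : _ \o _ = eps i) //; apply/funext => w /=; exact: tnth_mktuple.
Qed.

HB.instance Definition _ := isMeasurableFun.Build _ _ _ _ model_tuple
  measurable_model_tuple.

Let G : set (set (p.-tuple R * n.-tuple R)) :=
  [set C | exists A B, [/\ forall i, measurable (A i), forall i, measurable (B i)
     & C = box A `*` box B]].

Let measurableG : measurable = <<s G >>.
Proof.
apply/seteqP; split; last first.
  apply: smallest_sub; first exact: sigma_algebra_measurable.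
  move=> _ [A [B [mA mB ->]]].
  by apply: measurableX; exact: measurable_box.
have boxT m : box (fun=> setT) = [set: m.-tuple R].
  by apply/seteqP; split.
pose D := g_sigma_algebraType G.
have h1 : measurable_fun setT (fun z : D => (z : p.-tuple R * n.-tuple R)).
  apply/measurable_fun_pairP; split; apply/measurable_fun_tnthP => i _ A mA; rewrite setTI.
  - apply: sub_sigma_algebra.
    exists (fun k => if k == i then A else setT), (fun=> setT); split => //.
      by move=> k; case: ifP.
    rewrite boxT; apply/seteqP; split => -[x y] /=.
      by move=> hx; split => // k; case: eqP => // ->.
    by move=> [hx _]; have := hx i; rewrite eqxx.
  - apply: sub_sigma_algebra.
    exists (fun=> setT), (fun k => if k == i then A else setT); split => //.
      by move=> k; case: ifP.
    rewrite boxT; apply/seteqP; split => -[x y] /=.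
      by move=> hx; split => // k; case: eqP => // ->.
    by move=> [_ hx]; have := hx i; rewrite eqxx.
by move=> A mA; have := h1 measurableT A mA; rewrite setTI.
Qed.

(** Mutual independence gives the law on boxes, which are stable under
    intersection and generate the product structure. *)
Lemma joint_law : model_law g s2 theta eps -> forall A, measurable A ->
  P (model_tuple @^-1` A) = joint n p (Num.sqrt s2) g A.
Proof.
move=> [lt le ind] A mA.
change (distribution P model_tuple A = joint n p (Num.sqrt s2) g A).
apply: (measure_unique G (fun=> setT)) => //.
- move=> _ _ [A1 [B1 [mA1 mB1 ->]]] [A2 [B2 [mA2 mB2 ->]]].
  exists (fun i => A1 i `&` A2 i), (fun i => B1 i `&` B2 i); split.
  + by move=> i; exact: measurableI.
  + by move=> i; exact: measurableI.
  apply/seteqP; split => -[x y] /=.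
    by move=> [[a b] [c e]]; split => i; split.
  by move=> [h1 h2]; split; split => i; [case: (h1 i)|case: (h2 i)|case: (h1 i)|case: (h2 i)].
- move=> _; exists (fun=> setT), (fun=> setT); split => //.
  by apply/seteqP; split.
- by rewrite bigcup_const.
- move=> _ [A1 [B1 [mA1 mB1 ->]]].
  transitivity (power_prob g p (box A1) * power_prob (gauss (Num.sqrt s2)) n (box B1))%E; last first.
    by apply/esym/product_measure1E; exact: measurable_box.
  rewrite !power_prob_box//.
  have := ind [set x : 'I_p + 'I_n | true]%SET (fun k => match k with inl j => A1 j | inr i => B1 i end).
  rewrite big_sumType /=.
  move=> h.
  have e1 : (\prod_i g (A1 i) = \prod_(i | inl i \in [set x : 'I_p + 'I_n | true]%SET)
      P (theta i @^-1` A1 i))%E.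
    by apply: eq_big => [i|i _]; [rewrite inE | exact: esym (lt i (A1 i) (mA1 i))].
  have e2 : (\prod_i gauss (Num.sqrt s2) (B1 i) =
      \prod_(i | inr i \in [set x : 'I_p + 'I_n | true]%SET) P (eps i @^-1` B1 i))%E.
    by apply: eq_big => [i|i _]; [rewrite inE | exact: esym (le i (B1 i) (mB1 i))].
  rewrite e1 e2 -h; last by case.
  rewrite /distribution /pushforward; congr (P _); apply/seteqP; split => w /=.
    move=> [h1 h2] [j|i] _ /=.
      by have := h1 j; rewrite tnth_mktuple.
    by have := h2 i; rewrite tnth_mktuple.
  move=> h1; split => i; rewrite tnth_mktuple.
    by apply: (h1 (inl i)); rewrite /= inE.
  by apply: (h1 (inr i)); rewrite /= inE.
- by move=> _; apply: (@le_lt_trans _ _ 1%E); [exact: probability_le1 | exact: ltry].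
Qed.

End joint_law.

(** * Likelihood ratios *)

Section likelihood.
Context {R : realType} {M : R}.
Variables (n p : nat) (X : 'M[R]_(n, p)) (s : R).
Hypothesis s0 : 0 < s.

Definition kern (t : p.-tuple R) (y : 'cV[R]_n) : R :=
  expR (- (l2norm (y - X *m tcol t) ^+ 2 / (2 * s ^+ 2))).

(** The marginal density up to the normalizing constant, which does not depend on
    the prior. *)
Definition lik (g : probability R R) (y : 'cV[R]_n) : R :=
  \int[power_prob g p]_t kern t y.

Lemma kern_gt0 t y : 0 < kern t y. Proof. exact: expR_gt0. Qed.

Lemma kern_le1 t y : kern t y <= 1.
Proof.
rewrite /kern -expR0 ler_expR oppr_le0 divr_ge0 ?sqr_ge0// mulr_ge0// sqr_ge0//.
Qed.

Lemma measurable_kern : measurable_fun setT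
  (fun z : p.-tuple R * n.-tuple R => kern z.1 (tcol z.2)).
Proof.
apply: measurableT_comp => //; apply: measurable_funN; apply: measurable_funM => //.
rewrite (_ : (fun z => _) = fun z => \sum_i (tnth z.2 i - \sum_j X i j * tnth z.1 j) ^+ 2).
  apply: measurable_sum => i; apply: measurable_funX; apply: measurable_funB.
    exact: measurableT_comp (measurable_tnth i) measurable_snd.
  apply: measurable_sum => j; apply: measurable_funM => //.
  exact: measurableT_comp (measurable_tnth j) measurable_fst.
apply/funext => z; rewrite l2norm_sqr; apply: eq_bigr => i _; rewrite !mxE; congr ((_ - _) ^+ 2).
by apply: eq_bigr => j _; rewrite mxE.
Qed.

Lemma measurable_kern1 y : measurable_fun setT (fun t : p.-tuple R => kern t y).
Proof.
rewrite -(coltupK y).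
exact: measurableT_comp measurable_kern (measurable_pair2 (coltup y)).
Qed.

Lemma integrable_kern (g : probability R R) y :
  (power_prob g p).-integrable setT (EFin \o (fun t => kern t y)).
Proof.
apply: (@integrable_bounded _ _ _ _ _ 1); first exact: measurable_kern1.
by move=> t; rewrite gtr0_norm ?kern_gt0// kern_le1.
Qed.

Lemma lik_gt0 g y : 0 < lik g y.
Proof. by apply: Rintegral_gt0; [exact: integrable_kern | move=> t; exact: kern_gt0]. Qed.

Lemma measurable_lik g : measurable_fun setT (fun x : n.-tuple R => lik g (tcol x)).
Proof.
apply: measurableT_comp => //.
apply: (measurable_fun_fubini_tonelli_G (m1 := power_prob g p)
  (EFin \o (fun z : p.-tuple R * n.-tuple R => kern z.1 (tcol z.2)))) => //.
  by apply/measurable_EFinP; exact: measurable_kern.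
by move=> z; rewrite lee_fin ltW ?kern_gt0.
Qed.

Lemma marginal_densityE g y :
  marginal_density X (s ^+ 2) g y = ((2 * pi * s ^+ 2) `^ (n%:R / 2))^-1 * lik g y.
Proof.
by rewrite /marginal_density RintegralZl//; exact: integrable_kern.
Qed.

Lemma free_energy_sub g h y : (0 < p)%N ->
  free_energy X (s ^+ 2) y g - free_energy X (s ^+ 2) y h =
  p%:R^-1 * ln (lik h y / lik g y).
Proof.
move=> p0; rewrite /free_energy !marginal_densityE.
set k := (_ `^ _)^-1.
have k0 : 0 < k.
  by rewrite invr_gt0 powR_gt0// !mulr_gt0 ?pi_gt0// exprn_gt0.
have lg := lik_gt0 g y; have lh := lik_gt0 h y.
rewrite (lnM k0 lg) (lnM k0 lh) ln_div ?posrE//.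
ring.
Qed.

(** Given [theta], the observation is the noise shifted by [X theta]; the
    Cameron-Martin formula gives its density with respect to the pure noise, and
    [lik] is the mixture over [theta]. *)
Lemma change_of_measure (g : prior M) (h : n.-tuple R -> \bar R) :
  measurable_fun setT h -> (forall x, 0 <= h x)%E ->
  (\int[joint n p s g]_z h (coltup (obs X z)) =
   \int[power_prob (gauss s) n]_x
     (h x * (expR (l2norm (tcol x) ^+ 2 / (2 * s ^+ 2)) * lik g (tcol x))%:E))%E.
Proof.
move=> mh h0.
have s_neq0 : s != 0 by rewrite gt_eqF.
pose Ex (x : n.-tuple R) := expR (l2norm (tcol x) ^+ 2 / (2 * s ^+ 2)).
have mEx : measurable_fun setT Ex.
  apply: measurableT_comp => //; apply: measurable_funM => //.
  rewrite (_ : (fun x => _) = fun x : n.-tuple R => \sum_i tnth x i ^+ 2).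
    by apply: measurable_sum => i; apply: measurable_funX; exact: measurable_tnth.
  by apply/funext => x; rewrite l2norm_sqr; apply: eq_bigr => i _; rewrite mxE.
have tiltE t x : expR (tdot (coltup (X *m tcol t)) x / s ^+ 2 -
     tdot (coltup (X *m tcol t)) (coltup (X *m tcol t)) / (2 * s ^+ 2)) = Ex x * kern t (tcol x).
  rewrite /Ex /kern -expRD; congr expR.
  have tdotE (u v : n.-tuple R) : tdot u v = dotv (tcol u) (tcol v).
    by rewrite dotvE; apply: eq_bigr => i _; rewrite !mxE.
  rewrite !tdotE coltupK; set w := X *m _; set y := tcol x.
  rewrite -!dotvv !dotvBr ![dotv (_ - _) _]dotvC !dotvBr (dotvC y w); field.
  by rewrite gt_eqF.
have mF : measurable_fun setT (fun z : p.-tuple R * n.-tuple R =>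
    (h z.2 * (Ex z.2 * kern z.1 (tcol z.2))%:E)%E).
  apply: emeasurable_funM; first exact: measurableT_comp mh measurable_snd.
  apply/measurable_EFinP; apply: measurable_funM; last exact: measurable_kern.
  exact: measurableT_comp mEx measurable_snd.
have F0 z : (0 <= h z.2 * (Ex z.2 * kern z.1 (tcol z.2))%:E)%E.
  by rewrite mule_ge0// lee_fin mulr_ge0// expR_ge0.
transitivity (\int[power_prob g p]_t \int[power_prob (gauss s) n]_x
    (h x * (Ex x * kern t (tcol x))%:E))%E.
  have mo : measurable_fun setT (fun z => h (coltup (obs X z))).
    exact: measurableT_comp mh (measurable_obs X).
  apply: etrans (@fubini_tonelli1 _ _ _ _ R (power_prob g p) (power_prob (gauss s) n)
    _ mo (fun z => h0 _)) _.
  apply: eq_integral => t _.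
  transitivity (\int[power_prob (gauss s) n]_x h (tadd (coltup (X *m tcol t)) x))%E.
    apply: eq_integral => x _; congr h; apply: eq_from_tnth => i.
    by rewrite !tnth_mktuple /obs /= !mxE.
  rewrite ge0_integral_power_shift//.
  by apply: eq_integral => x _; rewrite tiltE.
apply: etrans (@fubini_tonelli _ _ _ _ R (power_prob g p) (power_prob (gauss s) n)
  _ mF F0) _.
apply: eq_integral => x _; rewrite /fubini_G /=.
transitivity (\int[power_prob g p]_t ((h x * (Ex x)%:E) * (kern t (tcol x))%:E))%E.
  by apply: eq_integral => t _; rewrite EFinM muleA.
rewrite ge0_integralZl//; last 3 first.
- by apply/measurable_EFinP; exact: measurable_kern1.
- by move=> t _; rewrite lee_fin ltW ?kern_gt0.
- by rewrite mule_ge0// lee_fin expR_ge0.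
rewrite EFinM muleA; congr (_ * _)%E.
by rewrite /lik /Rintegral fineK//; exact: integrable_fin_num (integrable_kern _ _).
Qed.

(** Error bound of the likelihood ratio test: where the likelihood of [h] is at
    least [a] times that of [g], the law of the observation under [g] is at most
    [a^-1] times its law under [h]. *)
Lemma lik_ratio_bound (g h : prior M) (B : set (n.-tuple R)) (a : R) :
  measurable B -> 0 < a ->
  (joint n p s g [set z | B (coltup (obs X z)) /\ (a * lik g (obs X z) <= lik h (obs X z))%R]
   <= a^-1%:E * joint n p s h [set z | B (coltup (obs X z))])%E.
Proof.
move=> mB a0.
pose D : set (n.-tuple R) := B `&` [set x | a * lik g (tcol x) <= lik h (tcol x)].
have mD : measurable D.
  apply: measurableI => //; apply: measurable_le_set; last exact: measurable_lik.
  by apply: measurable_funM => //; exact: measurable_lik.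
have toint (f : prior M) (C : set (n.-tuple R)) : measurable C ->
    joint n p s f [set z | C (coltup (obs X z))] =
    (\int[power_prob (gauss s) n]_x ((\1_C x)%:E *
      (expR (l2norm (tcol x) ^+ 2 / (2 * s ^+ 2)) * lik f (tcol x))%:E))%E.
  move=> mC; rewrite -(change_of_measure f (h := fun x => (\1_C x)%:E))//; last first.
    by apply/measurable_EFinP; exact: measurable_indic.
  rewrite (_ : (fun z => (\1_C (coltup (obs X z)))%:E) = fun z =>
    (\1_[set z | C (coltup (obs X z))] z)%:E) //.
  rewrite integral_indic ?setIT//.
  have := measurable_obs X measurableT mC; rewrite setTI; exact.
have -> : [set z | B (coltup (obs X z)) /\ (a * lik g (obs X z) <= lik h (obs X z))%R] =
   [set z | D (coltup (obs X z))].
  by apply/seteqP; split => z /=; rewrite /D /= coltupK.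
rewrite (toint g D mD) (toint h B mB).
have mI C (f : prior M) : measurable C -> measurable_fun setT (fun x : n.-tuple R => ((\1_C x)%:E *
      (expR (l2norm (tcol x) ^+ 2 / (2 * s ^+ 2)) * lik f (tcol x))%:E)%E).
  move=> mC; apply: emeasurable_funM; first by apply/measurable_EFinP; exact: measurable_indic.
  apply/measurable_EFinP; apply: measurable_funM; last exact: measurable_lik.
  apply: measurableT_comp => //; apply: measurable_funM => //.
  rewrite (_ : (fun x => _) = fun x : n.-tuple R => \sum_i tnth x i ^+ 2).
    by apply: measurable_sum => i; apply: measurable_funX; exact: measurable_tnth.
  by apply/funext => x; rewrite l2norm_sqr; apply: eq_bigr => i _; rewrite mxE.
have pos C (f : prior M) x : (0 <= (\1_C x)%:E *
      (expR (l2norm (tcol x) ^+ 2 / (2 * s ^+ 2)) * lik f (tcol x))%:E)%E.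
  by rewrite -EFinM lee_fin !mulr_ge0 ?expR_ge0 ?(ltW (lik_gt0 _ _)).
rewrite -ge0_integralZl//; [|exact: mI|by rewrite lee_fin invr_ge0 ltW].
apply: ge0_le_integral => //; [exact: mI| |].
  by apply: emeasurable_funM => //; exact: mI.
move=> x _; rewrite -!EFinM lee_fin !indicE.
case: (boolP (x \in D)) => hD; last first.
  by rewrite mul0r !mulr_ge0 ?invr_ge0 ?(ltW a0) ?expR_ge0 ?(ltW (lik_gt0 _ _)).
move: hD; rewrite inE => -[/mem_set -> /= hle].
rewrite !mul1r ler_pdivlMl// mulrCA ler_wpM2l ?expR_ge0//.
Qed.

End likelihood.

(** * Discrete laws and domination of power measures *)

Section discrete.
Context {R : realType}.
Variables (K : nat) (w : nat -> {nonneg R}) (x : nat -> R).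

Definition discrete : set R -> \bar R :=
  msum (fun k => mscale (w k) (\d_(x k))) K.

HB.instance Definition _ := Measure.on discrete.

Hypothesis total : \sum_(k < K) (w k)%:num = 1.

Lemma discrete_setT : discrete setT = 1%E.
Proof.
rewrite /discrete /msum /mscale /= -total -sumEFin; apply: eq_bigr => k _.
by rewrite /mscale /= diracT mule1.
Qed.

Definition discrete_prob : probability R R :=
  HB.pack discrete (Measure_isProbability.Build _ _ _ discrete discrete_setT).

Lemma discrete_prob_supp A : measurable A -> (forall k, (k < K)%N -> A (x k)) ->
  discrete_prob A = 1%E.
Proof.
move=> mA hA; rewrite -discrete_setT /= /discrete /msum /mscale /=.
apply: eq_bigr => k _.
by rewrite /mscale /= diracT diracE mem_set//; exact: hA.
Qed.

Lemma ge0_integral_discrete (f : R -> \bar R) : measurable_fun setT f ->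
  (forall u, 0 <= f u)%E ->
  (\int[discrete_prob]_u f u = \sum_(k < K) (w k)%:num%:E * f (x k))%E.
Proof.
move=> mf f0.
transitivity (\int[discrete]_u f u)%E; first by apply: eq_measure_integral.
rewrite ge0_integral_measure_sum//.
apply: eq_bigr => k _; rewrite ge0_integral_mscale//.
by rewrite integral_dirac// diracT mul1e.
Qed.

End discrete.

Section power_domination.
Context {R : realType}.

Definition tmap n (q : R -> R) (t : n.-tuple R) : n.-tuple R := [tuple q (tnth t i) | i < n].

Lemma tmap_tcons n q u (t : n.-tuple R) : tmap q (tcons u t) = tcons (q u) (tmap q t).
Proof.
apply: eq_from_tnth => i; rewrite tnth_mktuple.
case: (unliftP ord0 i) => [j|] ->; last by rewrite !tnth0.
by rewrite !tnthS tnth_mktuple.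
Qed.

Lemma measurable_tmap n q : measurable_fun setT q -> measurable_fun setT (@tmap n q).
Proof.
move=> mq; apply/measurable_fun_tnthP => i.
rewrite (_ : _ \o _ = fun t => q (tnth t i)); last first.
  by apply/funext => t /=; rewrite tnth_mktuple.
exact: measurableT_comp mq (measurable_tnth i).
Qed.

(** Domination multiplies over independent coordinates.  The maps [q] and [r] are
    two ways of rounding a coordinate. *)
Lemma power_domination (g h : probability R R) (q r : R -> R) (a : R) :
  measurable_fun setT q -> measurable_fun setT r -> 0 <= a ->
  (forall f : R -> \bar R, measurable_fun setT f -> (forall x, 0 <= f x)%E ->
    (\int[g]_x f (q x) <= a%:E * \int[h]_x f (r x))%E) ->
  forall n (F : n.-tuple R -> \bar R), measurable_fun setT F -> (forall x, 0 <= F x)%E ->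
    (\int[power_prob g n]_t F (tmap q t) <= (a ^+ n)%:E * \int[power_prob h n]_t F (tmap r t))%E.
Proof.
move=> mq mr a0 H; elim => [|n IH] F mF F0.
  rewrite expr0 mul1e /= !integral_dirac//.
  - by rewrite !diracT (tuple0 (tmap q _)) (tuple0 (tmap r _)).
  - exact: measurableT_comp mF (measurable_tmap mr).
  - exact: measurableT_comp mF (measurable_tmap mq).
have mF1 u : measurable_fun setT (fun t : n.-tuple R => F (tcons u t)).
  exact: measurableT_comp mF (measurable_tcons u).
have mq' := measurableT_comp mF (@measurable_tmap n.+1 q mq).
have mr' := measurableT_comp mF (@measurable_tmap n.+1 r mr).
rewrite (ge0_integral_powerS g mq' (fun=> F0 _)) (ge0_integral_powerS h mr' (fun=> F0 _)).
pose G (u : R) := (\int[power_prob h n]_t F (tcons u (tmap r t)))%E.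
have mG : measurable_fun setT G.
  apply: (measurable_fun_fubini_tonelli_F (m2 := power_prob h n)
    (fun z : R * n.-tuple R => F (tcons z.1 (tmap r z.2)))) => //.
  apply: measurableT_comp mF _.
  rewrite (_ : (fun z => _) = (fun z : R * n.-tuple R => tcons z.1 z.2) \o
    (fun z => (z.1, tmap r z.2))) //.
  apply: measurableT_comp (@measurable_tcons2 R n) _.
  apply: measurable_fun_pair => //.
  exact: measurableT_comp (measurable_tmap mr) measurable_snd.
have G0 u : (0 <= G u)%E by apply: integral_ge0 => t _; exact: F0.
apply: (@le_trans _ _ (\int[g]_u ((a ^+ n)%:E * G (q u)))%E).
  apply: ge0_le_integral => //.
  - by move=> u _; apply: integral_ge0 => t _; exact: F0.
  - apply: (measurable_fun_fubini_tonelli_F (m2 := power_prob g n)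
      (fun z : R * n.-tuple R => F (tmap q (tcons z.1 z.2)))) => //.
    exact: measurableT_comp mq' (@measurable_tcons2 R n).
  - by apply: emeasurable_funM => //; exact: measurableT_comp mG mq.
  move=> u _; apply: le_trans (IH (fun t => F (tcons (q u) t)) (mF1 _) (fun=> F0 _)).
  apply: le_of_eq.
  by apply: eq_integral => t _ /=; rewrite tmap_tcons.
rewrite ge0_integralZl//; last 2 first.
- exact: measurableT_comp mG mq.
- by rewrite lee_fin exprn_ge0.
rewrite exprSr EFinM -muleA; apply: lee_wpmul2l; first by rewrite lee_fin exprn_ge0.
apply: le_trans (H G mG G0) _.
apply: le_of_eq; congr (_ * _)%E.
by apply: eq_integral => u _; apply: eq_integral => t _ /=; rewrite tmap_tcons.
Qed.

End power_domination.

(** * A finite net of priors *)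

Section net.
Context {R : realType} (M : R).
Hypothesis M0 : 0 < M.

Section grid.
Variable m : nat.
Hypothesis m0 : (0 < m)%N.

Definition gpoint (k : nat) : R := - M + 2 * M / m%:R * k%:R.
Definition gcell (k : nat) : set R := `[gpoint k, gpoint k.+1[%classic.

Let step0 : 0 < 2 * M / m%:R.
Proof. by rewrite divr_gt0 ?mulr_gt0// ltr0n. Qed.

Lemma gpoint_itv k : (k <= m)%N -> - M <= gpoint k <= M.
Proof.
move=> km; rewrite /gpoint lerDl mulr_ge0 ?(ltW step0)//=.
rewrite [leRHS](_ : M = - M + 2 * M / m%:R * m%:R); last by field; rewrite pnatr_eq0 -lt0n.
by rewrite lerD2l ler_wpM2l ?(ltW step0)// ler_nat.
Qed.

Lemma gpoint_mono i j : (i <= j)%N -> gpoint i <= gpoint j.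
Proof. by move=> ij; rewrite lerD2l ler_wpM2l ?(ltW step0)// ler_nat. Qed.

Lemma gcell_disj i j u : gcell i u -> gcell j u -> i = j.
Proof.
rewrite /gcell /= !in_itv /= => /andP[i1 i2] /andP[j1 j2].
case: (ltngtP i j) => // ij.
  by have := le_lt_trans (le_trans (gpoint_mono ij) j1) i2; rewrite ltxx.
by have := le_lt_trans (le_trans (gpoint_mono ij) i1) j2; rewrite ltxx.
Qed.

Lemma gcell_cover u : - M <= u <= M -> exists2 k, (k < m.+1)%N & gcell k u.
Proof.
move=> /andP[u1 u2].
pose t := (u + M) / (2 * M / m%:R).
have t0 : 0 <= t by rewrite divr_ge0 ?(ltW step0)// -(opprK M) subr_ge0.
have ut : u = - M + 2 * M / m%:R * t.
  by rewrite /t; field; rewrite pnatr_eq0 -lt0n m0 gt_eqF.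
have tm : t <= m%:R.
  rewrite /t ler_pdivrMr//.
  by rewrite (_ : m%:R * _ = 2 * M); [lra|field; rewrite pnatr_eq0 -lt0n].
exists (Num.truncn t).
  by rewrite ltnS -(ler_nat R); apply: le_trans tm; rewrite truncn_le.
rewrite /gcell /= in_itv /= /gpoint; move: ut t0; move: t {tm} => t -> t0.
by rewrite lerD2l ltrD2l ler_pM2l// ltr_pM2l// truncn_le t0 truncnS_gt.
Qed.

(** Rounding to the left end of the cell, written as a sum of indicators to make
    measurability and integration immediate. *)
Definition rnd (u : R) : R := \sum_(k < m.+1) gpoint k * \1_(gcell k) u.

Lemma measurable_rnd : measurable_fun setT rnd.
Proof.
apply: measurable_sum => k; apply: measurable_funM => //.
by apply: measurable_indic; exact: measurable_itv.
Qed.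

Lemma rndE k u : (k < m.+1)%N -> gcell k u -> rnd u = gpoint k.
Proof.
move=> km ku; rewrite /rnd (bigD1 (Ordinal km))//= indicE mem_set// mulr1 big1 ?addr0//.
move=> i ik; rewrite indicE memNset ?mulr0// => iu.
by move/eqP: ik; apply; apply/val_inj; exact: (gcell_disj iu ku).
Qed.

Lemma rnd_close u : - M <= u <= M -> `|rnd u - u| <= 2 * M / m%:R /\ - M <= rnd u <= M.
Proof.
move=> hu; have [k km ku] := gcell_cover hu; rewrite (rndE km ku); split; last first.
  by apply: gpoint_itv; rewrite -ltnS.
move: ku; rewrite /gcell /= in_itv /= => /andP[k1 k2].
rewrite ler0_norm ?subr_le0// opprB; move: k2; rewrite /gpoint -(natr1 k) mulrDr mulr1; lra.
Qed.

Variable N : nat.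
Hypothesis N0 : (0 < N)%N.

(** The weights are proportional to [c k + 1]: the successor rounds the mass of a
    cell up, which is what domination requires, and keeps the total positive. *)
Definition gweight (c : {ffun 'I_m.+1 -> 'I_N.+1}) (k : nat) : {nonneg R} :=
  NngNum (divr_ge0 (ler0n R (c (inord k)).+1) (ler0n R (\sum_(i < m.+1) (c i).+1)%N)).

Lemma gweight_total c : \sum_(k < m.+1) (gweight c k)%:num = 1.
Proof.
rewrite /gweight /= -mulr_suml.
have -> : \sum_(i < m.+1) ((c (inord i)).+1%:R : R) = (\sum_(i < m.+1) (c i).+1)%N%:R.
  by rewrite natr_sum; apply: eq_bigr => i _; rewrite inord_val.
by rewrite divff// pnatr_eq0 -lt0n big_ord_recl addSn.
Qed.

Lemma gprior_supp c : discrete_prob gpoint (gweight_total c) `[- M, M]%classic = 1%E.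
Proof.
by apply: discrete_prob_supp => // k km; rewrite /= in_itv /=; apply: gpoint_itv; rewrite -ltnS.
Qed.

Definition gprior c : prior M := Prior (gprior_supp c).

(** Let [c k] be the integer part of [N] times the mass of the [k]-th cell.  Then
    the mass is at most [(c k + 1) / N], and these numbers add up to at most
    [1 + (m + 1) / N]. *)
Lemma net_domination (g : prior M) : exists c, forall f : R -> \bar R,
  measurable_fun setT f -> (forall u, 0 <= f u)%E ->
  (\int[g]_u f (rnd u) <= (1 + m.+1%:R / N%:R)%:E * \int[gprior c]_u f u)%E.
Proof.
pose w k := fine (g (gcell k)).
have mcell k : measurable (gcell k) by exact: measurable_itv.
have w0 k : 0 <= w k by rewrite fine_ge0.
have wE k : g (gcell k) = (w k)%:E by rewrite fineK// fin_num_measure.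
have N0' : 0 < N%:R :> R by rewrite ltr0n.
have w1 : \sum_(k < m.+1) w k <= 1.
  rewrite -lee_fin -sumEFin; under eq_bigr do rewrite -wE.
  rewrite -measure_bigsetU//.
    by apply: probability_le1; apply: bigsetU_measurable.
  by apply/trivIsetP => i j _ _; apply: contraNeq => /set0P[u [iu ju]];
    apply/eqP; exact: (gcell_disj iu ju).
have wk1 k : (k < m.+1)%N -> w k <= 1.
  move=> km; apply: le_trans w1; rewrite (bigD1 (Ordinal km))//= lerDl.
  by apply: sumr_ge0.
pose c : {ffun 'I_m.+1 -> 'I_N.+1} := [ffun k : 'I_m.+1 => inord (Num.truncn (N%:R * w k))].
have cE (k : 'I_m.+1) : c k = Num.truncn (N%:R * w k) :> nat.
  rewrite ffunE inordK// ltnS -(ler_nat R).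
  apply: (@le_trans _ _ (N%:R * w k)); first by rewrite truncn_le mulr_ge0.
  by rewrite ler_piMr// wk1.
exists c => f mf f0.
pose S := (\sum_(i < m.+1) (c i).+1)%N.
have S0 : 0 < S%:R :> R by rewrite ltr0n /S big_ord_recl addSn.
have hw (k : 'I_m.+1) : w k <= S%:R / N%:R * (gweight c k)%:num.
  rewrite /gweight /= -/S mulrC mulrA divfK ?gt_eqF// inord_val cE ler_pdivlMr// mulrC.
  by apply: ltW; exact: truncnS_gt.
have hS : S%:R / N%:R <= 1 + m.+1%:R / N%:R :> R.
  rewrite ler_pdivrMr// mulrDl mul1r divfK ?gt_eqF//.
  rewrite /S natr_sum (eq_bigr (fun i : 'I_m.+1 => (c i)%:R + 1)); last by move=> i _; rewrite natr1.
  rewrite big_split /= sumr_const card_ord lerD2r.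
  apply: (@le_trans _ _ (\sum_(i < m.+1) N%:R * w i)).
    by apply: ler_sum => i _; rewrite cE; rewrite truncn_le mulr_ge0.
  by rewrite -mulr_sumr ler_piMr.
have -> : (\int[g]_u f (rnd u) = \sum_(k < m.+1) (w k)%:E * f (gpoint k))%E.
  transitivity (\int[g]_u (\sum_(k < m.+1) f (gpoint k) * (\1_(gcell k) u)%:E))%E.
    apply: ge0_ae_eq_integral => //.
    - exact: measurableT_comp mf measurable_rnd.
    - apply: emeasurable_sum => k; apply: emeasurable_funM => //.
      by apply/measurable_EFinP; exact: measurable_indic.
    - by move=> u _; apply: sume_ge0 => k _; rewrite mule_ge0// lee_fin.
    have := prior_ae g; apply: filterS => u /=; rewrite inE /= in_itv /= => hu _.
    have [k km ku] := gcell_cover hu; rewrite (rndE km ku).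
    rewrite (bigD1 (Ordinal km))//= indicE mem_set// mule1 big1 ?adde0//.
    move=> i ik; rewrite indicE memNset ?mule0// => iu.
    by move/eqP: ik; apply; apply/val_inj; exact: (gcell_disj iu ku).
  rewrite ge0_integral_sum//; last 2 first.
  - move=> k; apply: emeasurable_funM => //.
    by apply/measurable_EFinP; exact: measurable_indic.
  - by move=> k u _; rewrite mule_ge0// lee_fin.
  apply: eq_bigr => k _; rewrite ge0_integralZl//; last first.
    by apply/measurable_EFinP; exact: measurable_indic.
  by rewrite integral_indic// setIT muleC; congr (_ * _)%E; exact: wE.
rewrite ge0_integral_discrete// ge0_sume_distrr; last first.
  by move=> k _; rewrite mule_ge0// lee_fin.
apply: lee_sum => k _; rewrite muleA -EFinM; apply: lee_wpmul2r => //.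
rewrite lee_fin; apply: le_trans (hw k) _; apply: ler_wpM2r => //.
Qed.

End grid.

(** The net is fine in the sense of domination after rounding, not for a distance
    between laws: domination is what survives in the [p]-fold product, where it
    costs the factor [(1 + eta) ^ p]. *)
Lemma net (eta : R) : 0 < eta -> exists (I : finType) (h : I -> prior M),
  forall g : prior M, exists (i : I) (r : R -> R),
  [/\ measurable_fun setT r,
      forall u, - M <= u <= M -> `|r u - u| <= eta /\ - M <= r u <= M
    & forall f : R -> \bar R, measurable_fun setT f -> (forall u, 0 <= f u)%E ->
      (\int[g]_u f (r u) <= (1 + eta)%:E * \int[h i]_u f u)%E].
Proof.
move=> e0.
pose m := (Num.truncn (2 * M / eta)).+1.
have hm : 2 * M / m%:R <= eta.
  rewrite ler_pdivrMr ?ltr0n// [eta * _]mulrC -ler_pdivrMr//; apply: ltW; exact: truncnS_gt.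
pose N := (Num.truncn (m.+1%:R / eta)).+1.
have hN : m.+1%:R / N%:R <= eta.
  rewrite ler_pdivrMr ?ltr0n// [eta * _]mulrC -ler_pdivrMr//; apply: ltW; exact: truncnS_gt.
exists {ffun 'I_m.+1 -> 'I_N.+1}, (@gprior m (ltn0Sn _) N) => g.
have [c hc] := @net_domination m (ltn0Sn _) N (ltn0Sn _) g.
exists c, (rnd m); split.
- exact: measurable_rnd.
- move=> u hu; have [h1 h2] := @rnd_close m (ltn0Sn _) u hu; split => //.
  exact: le_trans h1 hm.
- move=> f mf f0; apply: le_trans (hc f mf f0) _; apply: lee_wpmul2r.
    by apply: integral_ge0 => u _; exact: f0.
  by rewrite lee_fin lerD2l.
Qed.

End net.

(** * Integrals and likelihoods along the net *)

Section net_consequences.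
Context {R : realType} {M : R}.
Hypothesis M0 : 0 < M.
Variables (g h : prior M) (eta : R) (r : R -> R).
Hypothesis e0 : 0 < eta.
Hypothesis mr : measurable_fun setT r.
Hypothesis rclose : forall u, - M <= u <= M -> `|r u - u| <= eta /\ - M <= r u <= M.
Hypothesis rdom : forall f : R -> \bar R, measurable_fun setT f -> (forall u, 0 <= f u)%E ->
      (\int[g]_u f (r u) <= (1 + eta)%:E * \int[h]_u f u)%E.

(** Domination gives one inequality for [B + f] and the reverse one for [B - f]. *)
Lemma net_Rintegral_close (f : R -> R) (B L : R) : measurable_fun setT f ->
  (forall u, `|f u| <= B) -> (forall u v, `|f u - f v| <= L * `|u - v|) -> 0 <= L ->
  `|\int[g]_u f u - \int[h]_u f u| <= (L + 2 * B) * eta.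
Proof.
move=> mf fB fL L0.
have ig (k : prior M) (f' : R -> R) : measurable_fun setT f' -> (forall u, `|f' u| <= B) ->
    k.-integrable setT (EFin \o f').
  by move=> mf' hf'; apply: (@integrable_bounded _ _ _ _ _ B).
have mfr : measurable_fun setT (fun u => f (r u)) by exact: measurableT_comp mf mr.
have ifg := ig g f mf fB; have ifh := ig h f mf fB.
have ifr := ig g _ mfr (fun u => fB (r u)).
have h1 : `|\int[g]_u f u - \int[g]_u f (r u)| <= L * eta.
  have cl u : - M <= u <= M -> `|f u - f (r u)| <= L * eta.
    move=> hu; apply: le_trans (fL _ _) _; rewrite distrC; apply: ler_wpM2l => //.
    by case: (rclose hu).
  rewrite -RintegralB// ler_norml; apply/andP; split.
    rewrite -(RintegralP_cst g (- (L * eta))); apply: prior_le.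
    - exact: integrableR_cst.
    - exact: integrableRB.
    by move=> u /cl; rewrite ler_norml => /andP[].
  rewrite -[leRHS](RintegralP_cst g); apply: prior_le.
  - exact: integrableRB.
  - exact: integrableR_cst.
  by move=> u /cl; rewrite ler_norml => /andP[].
have dom (f' : R -> R) : measurable_fun setT f' -> (forall u, 0 <= f' u <= 2 * B) ->
    \int[g]_u f' (r u) <= (1 + eta) * \int[h]_u f' u.
  move=> mf' hf'.
  have i1 : g.-integrable setT (EFin \o (fun u => f' (r u))).
    apply: (@integrable_bounded _ _ _ _ _ (2 * B)); first exact: measurableT_comp mf' mr.
    by move=> u; case/andP: (hf' (r u)) => a b; rewrite ger0_norm.
  have i2 : h.-integrable setT (EFin \o f').
    apply: (@integrable_bounded _ _ _ _ _ (2 * B)) => //.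
    by move=> u; case/andP: (hf' u) => a b; rewrite ger0_norm.
  rewrite -lee_fin /Rintegral EFinM !fineK; [|exact: integrable_fin_num|exact: integrable_fin_num].
  apply: (rdom (f := EFin \o f')); first exact/measurable_EFinP.
  by move=> u; rewrite lee_fin; case/andP: (hf' u).
have fb u : - B <= f u <= B by rewrite -ler_norml.
have h2 : B + \int[g]_u f (r u) <= (1 + eta) * (B + \int[h]_u f u).
  have := dom (fun u => B + f u); rewrite !RintegralD//; try exact: integrableR_cst.
  rewrite !RintegralP_cst; apply; first exact: measurable_funD.
  by move=> u; case/andP: (fb u) => a b; apply/andP; split; lra.
have h3 : B - \int[g]_u f (r u) <= (1 + eta) * (B - \int[h]_u f u).
  have := dom (fun u => B - f u); rewrite !RintegralB//; try exact: integrableR_cst.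
  rewrite !RintegralP_cst; apply; first exact: measurable_funB.
  by move=> u; case/andP: (fb u) => a b; apply/andP; split; lra.
have h4 : `|\int[h]_u f u| <= B.
  rewrite ler_norml; apply/andP; split.
    rewrite -(RintegralP_cst h (- B)); apply: le_Rintegral => //; first exact: integrableR_cst.
    by move=> u _; case/andP: (fb u).
  rewrite -[leRHS](RintegralP_cst h); apply: le_Rintegral => //; first exact: integrableR_cst.
  by move=> u _; case/andP: (fb u).
move: h1 h2 h3 h4.
move: (\int[g]_u f u) (\int[g]_u f (r u)) (\int[h]_u f u) => a b c.
rewrite !ler_norml => /andP[h1 h1'] h2 h3 /andP[h4 h4'].
have := ler_wpM2r (ltW e0) h4; have := ler_wpM2r (ltW e0) h4'.
by move=> k1 k2; apply/andP; split; lra.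
Qed.

(** The rounding [r] is only controlled on [-M, M]; composing it with the
    truncation makes it controlled everywhere without changing integrals
    against a prior. *)
Definition clamp (u : R) : R := Num.max (- M) (Num.min M u).

Lemma clamp_itv u : - M <= clamp u <= M.
Proof.
rewrite /clamp le_max lexx /= ge_max ge_min lexx /= andbT.
by rewrite (le_trans (y := 0))// ?oppr_le0 ltW.
Qed.

Lemma clampE u : - M <= u <= M -> clamp u = u.
Proof. by move=> /andP[u1 u2]; rewrite /clamp min_r// max_r. Qed.

Lemma measurable_clamp : measurable_fun setT clamp.
Proof. by apply: measurable_maxr => //; apply: measurable_minr. Qed.

Lemma prior_clamp (k : prior M) (f : R -> \bar R) (q : R -> R) : measurable_fun setT f ->
  measurable_fun setT q -> (forall u, 0 <= f u)%E ->
  (\int[k]_u f (q u) = \int[k]_u f (q (clamp u)))%E.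
Proof.
move=> mf mq f0; apply: ge0_ae_eq_integral => //.
- exact: measurableT_comp mf mq.
- exact: measurableT_comp mf (measurableT_comp mq measurable_clamp).
have := prior_ae k; apply: filterS => u /=; rewrite inE /= in_itv /= => hu _.
by rewrite clampE.
Qed.

Lemma tmap_id k (t : k.-tuple R) : tmap id t = t.
Proof. by apply: eq_from_tnth => i; rewrite tnth_mktuple. Qed.

Let mid : measurable_fun setT (id : R -> R).
Proof. exact: measurable_id. Qed.

Lemma power_clamp (p : nat) (F : p.-tuple R -> \bar R) : measurable_fun setT F ->
  (forall t, 0 <= F t)%E ->
  (\int[power_prob g p]_t F t <= \int[power_prob g p]_t F (tmap clamp t))%E.
Proof.
move=> mF F0.
have H1 (f : R -> \bar R) : measurable_fun setT f -> (forall x, 0 <= f x)%E ->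
    (\int[g]_x f (id x) <= 1%:E * \int[g]_x f (clamp x))%E.
  by move=> mf f0; rewrite mul1e -(prior_clamp g mf mid f0).
have := power_domination mid measurable_clamp ler01 H1 mF F0.
rewrite expr1n mul1e (_ : (fun t => F (tmap id t)) = F); first exact.
by apply/funext => t; rewrite tmap_id.
Qed.

Lemma power_rnd (p : nat) (F : p.-tuple R -> \bar R) : measurable_fun setT F ->
  (forall t, 0 <= F t)%E ->
  (\int[power_prob g p]_t F (tmap (r \o clamp) t) <=
    ((1 + eta) ^+ p)%:E * \int[power_prob h p]_t F t)%E.
Proof.
move=> mF F0.
have a0 : 0 <= 1 + eta by apply: addr_ge0; [exact: ler01 | exact: ltW].
have mrc : measurable_fun setT (r \o clamp) by exact: measurableT_comp mr measurable_clamp.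
have H3 (f : R -> \bar R) : measurable_fun setT f -> (forall x, 0 <= f x)%E ->
    (\int[g]_x f ((r \o clamp) x) <= (1 + eta)%:E * \int[h]_x f (id x))%E.
  move=> mf f0; apply: le_trans (rdom mf f0).
  by rewrite -(prior_clamp g mf mr f0).
have := power_domination mrc mid a0 H3 mF F0.
rewrite (_ : (fun t => F (tmap id t)) = F); first exact.
by apply/funext => t; rewrite tmap_id.
Qed.

Lemma power_kern_le (p : nat) (c : R) (F : p.-tuple R -> \bar R) : 0 <= c ->
  measurable_fun setT F -> (forall t, 0 <= F t)%E ->
  (forall t, F (tmap clamp t) <= c%:E * F (tmap (r \o clamp) t))%E ->
  (\int[power_prob g p]_t F t <= (c * (1 + eta) ^+ p)%:E * \int[power_prob h p]_t F t)%E.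
Proof.
move=> c0 mF F0 Fc.
have mrc : measurable_fun setT (r \o clamp) by exact: measurableT_comp mr measurable_clamp.
have mF2 : measurable_fun setT (fun t => F (tmap (r \o clamp) t)).
  exact: measurableT_comp mF (measurable_tmap mrc).
apply: le_trans (power_clamp mF F0) _.
apply: (@le_trans _ _ (c%:E * \int[power_prob g p]_t F (tmap (r \o clamp) t))%E).
  rewrite -ge0_integralZl; [|exact: measurableT|exact: mF2|by move=> t _; exact: F0|by rewrite lee_fin].
  apply: ge0_le_integral => //.
  - exact: measurableT_comp mF (measurable_tmap measurable_clamp).
  - exact: emeasurable_funM.
rewrite EFinM -muleA; apply: lee_wpmul2l; first by rewrite lee_fin.
exact: power_rnd.
Qed.

Section lik_domination.
Variables (n p : nat) (X : 'M[R]_(n, p)) (s : R).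
Hypothesis s0 : 0 < s.

(** Expanding the squares, the exponents differ by a term linear in [X^T y] and
    one that the operator norm bounds. *)
Lemma kern_ratio (t t' : p.-tuple R) y :
  (forall i, - M <= tnth t i <= M) -> (forall i, - M <= tnth t' i <= M) ->
  (forall i, `|tnth t' i - tnth t i| <= eta) ->
  kern X s t y <= expR (eta * (l2norm (X^T *m y) * Num.sqrt p%:R + p%:R * M * opnorm X ^+ 2)
     / s ^+ 2) * kern X s t' y.
Proof.
move=> ht ht' htt'; rewrite /kern -expRD ler_expR.
set a := X *m tcol t; set b := X *m tcol t'.
have hab : l2norm (tcol t' - tcol t) <= eta * Num.sqrt p%:R.
  by apply: l2norm_unif; [exact: ltW | move=> i; rewrite tcolB].
have hB (u : p.-tuple R) : (forall i, - M <= tnth u i <= M) ->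
    l2norm (X *m tcol u) <= opnorm X * (M * Num.sqrt p%:R).
  move=> hu; apply: le_trans (l2norm_mul _ _) _; apply: ler_wpM2l; first exact: opnorm_ge0.
  apply: l2norm_unif; first exact: ltW.
  by move=> i; rewrite mxE ler_norml.
(* difference of the exponents, as a pairing with X^T y and one with b + a *)
have e1 : l2norm (y - b) ^+ 2 - l2norm (y - a) ^+ 2 =
   2 * dotv (X^T *m y) (tcol t - tcol t') + dotv (b - a) (b + a).
  rewrite -dotv_mul mulmxBr -/a -/b -!dotvv !dotvBr !dotvDr ![dotv (_ - _) _]dotvC !dotvBr.
  by rewrite (dotvC a y) (dotvC b y) (dotvC a b); ring.
have sp : Num.sqrt p%:R ^+ 2 = p%:R :> R by rewrite sqr_sqrtr.
have sq0 : 0 <= Num.sqrt (p%:R : R) by exact: sqrtr_ge0.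
have o0 := opnorm_ge0 X.
have h1 : dotv (X^T *m y) (tcol t - tcol t') <= l2norm (X^T *m y) * (eta * Num.sqrt p%:R).
  apply: le_trans (ler_norm _) _; apply: le_trans (cauchy_schwarz _ _) _.
  by apply: ler_wpM2l; [exact: l2norm_ge0 | rewrite -l2normN opprB].
have h2 : dotv (b - a) (b + a) <= opnorm X * (eta * Num.sqrt p%:R) * (2 * (opnorm X * (M * Num.sqrt p%:R))).
  apply: le_trans (ler_norm _) _; apply: le_trans (cauchy_schwarz _ _) _.
  apply: ler_pM; [exact: l2norm_ge0|exact: l2norm_ge0| |].
    rewrite /a /b -mulmxBr; apply: le_trans (l2norm_mul _ _) _; exact: ler_wpM2l.
  apply: le_trans (l2normD _ _) _.
  by have := hB _ ht; have := hB _ ht'; rewrite -/a -/b; lra.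
have s20 : 0 < 2 * s ^+ 2 by rewrite mulr_gt0// exprn_gt0.
rewrite -lerBlDr opprK -mulNr -mulrDl [leRHS](_ : _ =
  (2 * (l2norm (X^T *m y) * (eta * Num.sqrt p%:R)) +
  opnorm X * (eta * Num.sqrt p%:R) * (2 * (opnorm X * (M * Num.sqrt p%:R)))) / (2 * s ^+ 2)).
  by rewrite ler_pM2r ?invr_gt0// addrC e1; lra.
rewrite (_ : p%:R * M * opnorm X ^+ 2 = Num.sqrt p%:R ^+ 2 * M * opnorm X ^+ 2); last by rewrite sp.
by field; rewrite gt_eqF.
Qed.

Lemma kern_ratio' (t : p.-tuple R) y : ((kern X s (tmap clamp t) y)%:E <=
  (expR (eta * (l2norm (X^T *m y) * Num.sqrt p%:R + p%:R * M * opnorm X ^+ 2)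
     / s ^+ 2))%:E * (kern X s (tmap (r \o clamp) t) y)%:E)%E.
Proof.
rewrite -EFinM lee_fin; apply: kern_ratio => i; rewrite !tnth_mktuple /=.
- exact: clamp_itv.
- by case: (rclose (clamp_itv (tnth t i))).
- by case: (rclose (clamp_itv (tnth t i))).
Qed.

Lemma lik_domination y :
  lik X s g y <= expR (eta * (l2norm (X^T *m y) * Num.sqrt p%:R + p%:R * M * opnorm X ^+ 2)
     / s ^+ 2) * (1 + eta) ^+ p * lik X s h y.
Proof.
have mk := measurable_kern1 X s y.
have mF : measurable_fun setT (fun t => (kern X s t y)%:E) by exact/measurable_EFinP.
have F0 t : (0 <= (kern X s t y)%:E)%E by rewrite lee_fin ltW ?kern_gt0.
have s2 := power_kern_le (expR_ge0 _) mF F0 (fun t => kern_ratio' t y).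
rewrite -lee_fin EFinM /lik /Rintegral !fineK; first exact: s2.
- exact: integrable_fin_num (integrable_kern _ _ _ _).
- exact: integrable_fin_num (integrable_kern _ _ _ _).
Qed.

End lik_domination.
End net_consequences.

(** * Bernstein approximation *)

Section bernstein.
Context {R : realType}.

(** By contradiction, with the Bolzano-Weierstrass theorem. *)
Lemma heine_cantor (f : R -> R) (a b e : R) : continuous f -> 0 < e ->
  exists2 dl, 0 < dl & forall x y, a <= x <= b -> a <= y <= b -> `|x - y| < dl ->
    `|f x - f y| < e.
Proof.
move=> cf e0; apply: contrapT => H.
have H' (n : nat) : exists xy : R * R, [/\ a <= xy.1 <= b, a <= xy.2 <= b,
    `|xy.1 - xy.2| < n.+1%:R^-1 & e <= `|f xy.1 - f xy.2|].
  apply: contrapT => Hn; apply: H; exists n.+1%:R^-1; first by rewrite invr_gt0.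
  move=> x y hx hy hxy; rewrite ltNge; apply/negP => he; apply: Hn.
  by exists (x, y).
have [u hu] := choice H'.
have bu : bounded_fun (fun n => (u n).1).
  exists (`|a| + `|b|); split; first exact: num_real.
  move=> x hx n _; have [/andP[h1 h2] _ _ _] := hu n.
  apply: le_trans (ltW hx); rewrite ler_norml; apply/andP; split.
    by apply: le_trans h1; have := lerNnormlW (lexx `|a|); have := normr_ge0 b; lra.
  by apply: le_trans h2 _; have := ler_norm b; have := normr_ge0 a; lra.
have [g gi /cvg_ex[/= l gl]] := bolzano_weierstrass bu.
have gn n : (n <= g n)%N.
  elim: n => // n IH; apply: (leq_ltn_trans IH).
  by rewrite ltnNge; apply/negP; rewrite -[(_ <= _)%N]/(g n.+1 <= g n)%O gi ltnn.
have /cvgrPdist_lt/(_ _ (divr_gt0 e0 (ltr0n R 2))) := cf l.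
move=> /nbhs_ballP[r /= r0 hr].
have r20 : 0 < r / 2 by rewrite divr_gt0.
have r2r : r / 2 < r by rewrite [X in _ < X]splitr ltrDl.
have /cvgrPdist_lt/(_ _ r20)[n1 _ hn1] := gl.
pose n := maxn n1 (Num.truncn (2 / r)).
have hx := hn1 n (leq_maxl _ _).
have [_ _ hd he] := hu (g n).
have hg : (g n).+1%:R^-1 < r / 2.
  rewrite invf_plt ?posrE// invf_div; apply: lt_le_trans (truncnS_gt _) _.
  by rewrite ler_nat ltnS (leq_trans _ (gn n))// leq_maxr.
move: he; apply/negP; rewrite -ltNge.
have h1 := hr (u (g n)).1; have h2 := hr (u (g n)).2.
rewrite /ball /= in h1 h2.
have {}h1 := h1 (lt_trans hx r2r).
have hy : `|l - (u (g n)).2| < r.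
  rewrite (_ : l - _ = (l - (u (g n)).1) + ((u (g n)).1 - (u (g n)).2)); last by ring.
  apply: le_lt_trans (ler_normD _ _) _; rewrite [r]splitr.
  by apply: ltrD => //; exact: lt_trans hd hg.
have {}h2 := h2 hy.
rewrite (_ : f _ - f _ = (f l - f (u (g n)).2) - (f l - f (u (g n)).1)); last by ring.
apply: le_lt_trans (ler_normB _ _) _; rewrite [e]splitr.
exact: ltrD.
Qed.

(** Expectation of [h] under the binomial law with parameters [n] and [u], by
    recursion on [n]; as a function of [u] it is a Bernstein polynomial. *)
Fixpoint bern (n : nat) (h : nat -> R) (u : R) : R :=
  if n is n'.+1 then u * bern n' (h \o S) u + (1 - u) * bern n' h u else h 0%N.

Lemma bern_le n h1 h2 u : 0 <= u <= 1 -> (forall k, h1 k <= h2 k) ->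
  bern n h1 u <= bern n h2 u.
Proof.
move=> /andP[u0 u1]; elim: n => [|n IH] in h1 h2 * => h12 //=.
by apply: lerD; apply: ler_wpM2l; rewrite ?subr_ge0//; apply: IH => k; exact: h12.
Qed.

Lemma bern_lin n a b h1 h2 u :
  bern n (fun k => a * h1 k + b * h2 k) u = a * bern n h1 u + b * bern n h2 u.
Proof.
elim: n => [|n IH] in h1 h2 * => //=.
by rewrite (IH (h1 \o S) (h2 \o S)) IH; ring.
Qed.

(** Bias and variance of the binomial law. *)
Lemma bern_sqr n a u :
  bern n (fun k => (k%:R - a) ^+ 2) u = (n%:R * u - a) ^+ 2 + n%:R * (u * (1 - u)).
Proof.
elim: n => [|n IH] in a * => /=; first by ring.
rewrite IH (_ : (fun k : nat => (k%:R - a) ^+ 2) \o S = (fun k => (k%:R - (a - 1)) ^+ 2)).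
  by rewrite IH -(natr1 n); ring.
by apply/funext => k /=; rewrite -(natr1 k); ring.
Qed.

Lemma bern_cst n c u : bern n (fun=> c) u = c.
Proof.
elim: n => [|n IH] //=; rewrite (_ : (fun=> c) \o S = (fun=> c)) // IH; ring.
Qed.

(** Chebyshev: at a node [v] the error is at most [e] if [v] is within [dl] of
    [u], and at most [2 K (v - u)^2 / dl^2] otherwise.  The truncation keeps
    the nodes in the unit interval whatever the index. *)
Lemma bern_approx (phi : R -> R) (K e dl : R) (n : nat) (u : R) :
  0 <= u <= 1 -> 0 < dl -> (0 < n)%N ->
  (forall x, `|phi x| <= K) ->
  (forall x y, 0 <= x <= 1 -> 0 <= y <= 1 -> `|x - y| < dl -> `|phi x - phi y| < e) ->
  `|bern n (fun k => phi (Num.min 1 (k%:R / n%:R))) u - phi u| <= e + 2 * K / (dl ^+ 2 * n%:R).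
Proof.
move=> hu dl0 n0 hK hunif; have /andP[u0 u1] := hu.
have n0' : 0 < n%:R :> R by rewrite ltr0n.
have K0 : 0 <= K by exact: le_trans (hK 0).
have e0 : 0 < e by apply: le_lt_trans (hunif 0 0 _ _ _); rewrite ?lexx ?ler01 ?subrr ?normr0.
pose c := 2 * K / (dl ^+ 2 * n%:R ^+ 2).
have c0 : 0 <= c by rewrite /c; apply: divr_ge0; apply: mulr_ge0 => //; exact: sqr_ge0.
have pt k : `|phi (Num.min 1 (k%:R / n%:R)) - phi u| <= e * 1 + c * (k%:R - n%:R * u) ^+ 2.
  rewrite mulr1.
  set v := Num.min 1 _.
  have v01 : 0 <= v <= 1 by rewrite /v le_min ge_min lexx ler01 divr_ge0.
  case: (ltP `|v - u| dl) => hd.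
    by apply: ler_wpDr; [rewrite mulr_ge0 ?sqr_ge0 | exact: ltW (hunif _ _ v01 hu hd)].
  have h1 : `|phi v - phi u| <= 2 * K.
    by apply: le_trans (ler_normB _ _) _; have := hK v; have := hK u; lra.
  have h2 : dl ^+ 2 <= (v - u) ^+ 2.
    by rewrite -(real_normK (num_real (v - u))) ler_pXn2r ?nnegrE ?(ltW dl0).
  have h3 : (v - u) ^+ 2 <= (k%:R / n%:R - u) ^+ 2.
    rewrite /v; case: (leP 1 (k%:R / n%:R)) => hk //.
    by rewrite ler_pXn2r ?nnegrE ?subr_ge0 ?lerD2r// (le_trans u1).
  apply: le_trans h1 _; apply: ler_wpDl; first exact: ltW.
  have -> : c * (k%:R - n%:R * u) ^+ 2 = 2 * K * ((k%:R / n%:R - u) ^+ 2 / dl ^+ 2).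
    by rewrite /c; field; rewrite !gt_eqF.
  apply: ler_peMr; first by rewrite mulr_ge0.
  by rewrite ler_pdivlMr ?exprn_gt0// mul1r (le_trans h2).
have bnd : bern n (fun k => e * 1 + c * (k%:R - n%:R * u) ^+ 2) u <= e + 2 * K / (dl ^+ 2 * n%:R).
  rewrite (bern_lin n e c (fun=> 1) (fun k => (k%:R - n%:R * u) ^+ 2)) bern_cst bern_sqr.
  rewrite subrr expr0n add0r mulr1 lerD2l /c.
  rewrite (_ : _ * _ = 2 * K / (dl ^+ 2 * n%:R) * (u * (1 - u))); last first.
    by field; rewrite !gt_eqF.
  apply: ler_piMr; first by apply: divr_ge0; apply: mulr_ge0 => //; exact: sqr_ge0.
  by apply: mulr_ile1; rewrite ?subr_ge0// lerBlDr lerDl.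
have up : bern n (fun k => phi (Num.min 1 (k%:R / n%:R))) u - phi u <= e + 2 * K / (dl ^+ 2 * n%:R).
  apply: le_trans bnd; rewrite -[X in _ - X](bern_cst n (phi u) u).
  rewrite -[leLHS](_ : bern n (fun k => 1 * phi (Num.min 1 (k%:R / n%:R)) + (- 1) * phi u) u = _).
    apply: bern_le => // k; rewrite mul1r mulN1r; apply: le_trans (pt k); exact: ler_norm.
  by rewrite (bern_lin n 1 (- 1) _ (fun=> phi u)) mul1r mulN1r.
have lo : phi u - bern n (fun k => phi (Num.min 1 (k%:R / n%:R))) u <= e + 2 * K / (dl ^+ 2 * n%:R).
  apply: le_trans bnd; rewrite -[X in X - _](bern_cst n (phi u) u).
  rewrite -[leLHS](_ : bern n (fun k => (- 1) * phi (Num.min 1 (k%:R / n%:R)) + 1 * phi u) u = _).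
    apply: bern_le => // k; rewrite mul1r mulN1r; apply: le_trans (pt k).
    by rewrite addrC distrC; exact: ler_norm.
  by rewrite (bern_lin n (- 1) 1 _ (fun=> phi u)) mul1r mulN1r addrC.
by rewrite ler_norml lerNl opprB lo up.
Qed.

End bernstein.

(** * Trigonometric moments determine weak convergence *)

Section weak.
Context {R : realType} (M : R).
Hypothesis M0 : 0 < M.

Lemma continuous_mfun (f : R -> R) : continuous f -> measurable_fun setT f.
Proof. exact: continuous_measurable_fun. Qed.

Lemma continuous_cosM (t : R) : continuous (fun x : R => cos (t * x)).
Proof.
by move=> x; apply: (@continuous_comp _ _ _ ( *%R t) cos);
  [exact: mulrl_continuous | exact: continuous_cos].
Qed.

Lemma continuous_sinM (t : R) : continuous (fun x : R => sin (t * x)).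
Proof.
by move=> x; apply: (@continuous_comp _ _ _ ( *%R t) sin);
  [exact: mulrl_continuous | exact: continuous_sin].
Qed.

Section limit.
Variables (gs : nat -> prior M) (g : prior M).

Definition integrals_cvg (f : R -> R) := \int[gs k]_x f x @[k --> \oo] --> \int[g]_x f x.

Definition bounded_meas (f : R -> R) := measurable_fun setT f /\ exists C : R, forall x, `|f x| <= C.

Let bounded_meas_int (h : prior M) f : bounded_meas f -> h.-integrable setT (EFin \o f).
Proof. by move=> [mf [C hC]]; exact: (@integrable_bounded _ _ _ _ _ C). Qed.

Lemma bounded_measD f1 f2 : bounded_meas f1 -> bounded_meas f2 -> bounded_meas (fun x => f1 x + f2 x).
Proof.
move=> [m1 [C1 h1]] [m2 [C2 h2]]; split; first exact: measurable_funD.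
by exists (C1 + C2) => x; apply: le_trans (ler_normD _ _) _; exact: lerD.
Qed.

Lemma bounded_measM f1 f2 : bounded_meas f1 -> bounded_meas f2 -> bounded_meas (fun x => f1 x * f2 x).
Proof.
move=> [m1 [C1 h1]] [m2 [C2 h2]]; split; first exact: measurable_funM.
exists (C1 * C2) => x; rewrite normrM; apply: ler_pM; [exact: normr_ge0|exact: normr_ge0|exact: h1|exact: h2].
Qed.

Lemma bounded_meas_cst c : bounded_meas (fun=> c).
Proof. by split => //; exists `|c|. Qed.

Lemma bounded_meas_cos t : bounded_meas (fun x => cos (t * x)).
Proof.
split; first by apply: continuous_mfun; exact: continuous_cosM.
by exists 1 => x; exact: cos_max.
Qed.

Lemma bounded_meas_sin t : bounded_meas (fun x => sin (t * x)).
Proof.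
split; first by apply: continuous_mfun; exact: continuous_sinM.
by exists 1 => x; exact: sin_max.
Qed.

Lemma integrals_cvgD a b f1 f2 : bounded_meas f1 -> bounded_meas f2 -> integrals_cvg f1 -> integrals_cvg f2 ->
  integrals_cvg (fun x => a * f1 x + b * f2 x).
Proof.
move=> b1 b2 l1 l2; rewrite /integrals_cvg.
have e (h : prior M) : \int[h]_x (a * f1 x + b * f2 x) = a * \int[h]_x f1 x + b * \int[h]_x f2 x.
  have i1 := bounded_meas_int h b1; have i2 := bounded_meas_int h b2.
  rewrite RintegralD//; [|exact: integrableRZ|exact: integrableRZ].
  by rewrite !RintegralZl.
rewrite e (_ : (fun k => _) = fun k => a * \int[gs k]_x f1 x + b * \int[gs k]_x f2 x); last first.
  by apply/funext => k; rewrite e.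
by apply: cvgD; apply: cvgMr.
Qed.

Hypothesis lcos : forall j : nat, integrals_cvg (fun x => cos (j%:R / M * x)).
Hypothesis lsin : forall j : nat, integrals_cvg (fun x => sin (j%:R / M * x)).

Lemma integrals_cvg_cosz (z : int) : integrals_cvg (fun x => cos (z%:~R / M * x)).
Proof.
case: z => j; first exact: lcos.
rewrite (_ : (fun x => _) = (fun x => cos (j.+1%:R / M * x))); first exact: lcos.
by apply/funext => x; rewrite NegzE mulrNz !mulNr cosN.
Qed.

Lemma integrals_cvg_sinz (z : int) : integrals_cvg (fun x => sin (z%:~R / M * x)).
Proof.
case: z => j; first exact: lsin.
rewrite (_ : (fun x => _) = (fun x => 0 * sin (0 * x) + (-1) * sin (j.+1%:R / M * x))).
  apply: integrals_cvgD => //; [exact: bounded_meas_sin|exact: bounded_meas_sin|].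
  have := @lsin 0%N; rewrite (_ : (fun x => _) = (fun x => sin (0 * x))) //.
    by apply/funext => x; rewrite !mul0r.
by apply/funext => x; rewrite NegzE mulrNz !mulNr sinN mul0r add0r mul1r.
Qed.

(** Convergence of integrals that persists after multiplication by trigonometric
    monomials with frequencies in [Z / M].  The functions with this property
    form an algebra over [sin (x / M)]. *)
Definition trig_stable (h : R -> R) := bounded_meas h /\ forall z : int,
  integrals_cvg (fun x => h x * cos (z%:~R / M * x)) /\ integrals_cvg (fun x => h x * sin (z%:~R / M * x)).

Lemma trig_stable_cvg h : trig_stable h -> integrals_cvg h.
Proof.
move=> [_ /(_ 0)[+ _]]; rewrite (_ : (fun x => _) = h) //.
by apply/funext => x; rewrite !mul0r cos0 mulr1.
Qed.

Lemma trig_stable_cst c : trig_stable (fun=> c).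
Proof.
split; first exact: bounded_meas_cst.
move=> z; split.
  rewrite (_ : (fun x => _) = (fun x => c * cos (z%:~R / M * x) + 0 * cos (z%:~R / M * x))).
    by apply: integrals_cvgD; first [exact: bounded_meas_cos | exact: integrals_cvg_cosz].
  by apply/funext => x; rewrite mul0r addr0.
rewrite (_ : (fun x => _) = (fun x => c * sin (z%:~R / M * x) + 0 * sin (z%:~R / M * x))).
  by apply: integrals_cvgD; first [exact: bounded_meas_sin | exact: integrals_cvg_sinz].
by apply/funext => x; rewrite mul0r addr0.
Qed.

Lemma trig_stable_lin a b h1 h2 : trig_stable h1 -> trig_stable h2 -> trig_stable (fun x => a * h1 x + b * h2 x).
Proof.
move=> [b1 l1] [b2 l2]; split.
  by apply: bounded_measD; apply: bounded_measM => //; exact: bounded_meas_cst.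
move=> z; split.
  rewrite (_ : (fun x => _) = (fun x => a * (h1 x * cos (z%:~R / M * x)) + b * (h2 x * cos (z%:~R / M * x)))).
    by apply: integrals_cvgD; [apply: bounded_measM => //; exact: bounded_meas_cos|apply: bounded_measM => //; exact: bounded_meas_cos
      |exact: (l1 z).1|exact: (l2 z).1].
  by apply/funext => x; ring.
rewrite (_ : (fun x => _) = (fun x => a * (h1 x * sin (z%:~R / M * x)) + b * (h2 x * sin (z%:~R / M * x)))).
  by apply: integrals_cvgD; [apply: bounded_measM => //; exact: bounded_meas_sin|apply: bounded_measM => //; exact: bounded_meas_sin
      |exact: (l1 z).2|exact: (l2 z).2].
by apply/funext => x; ring.
Qed.

Lemma trig_stable_sinM h : trig_stable h -> trig_stable (fun x => sin (M^-1 * x) * h x).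
Proof.
move=> [bh lh]; split; first by apply: bounded_measM => //; exact: bounded_meas_sin.
have arg (z : int) x : (z + 1)%:~R / M * x = z%:~R / M * x + M^-1 * x.
  by rewrite intrD; ring.
have arg' (z : int) x : (z - 1)%:~R / M * x = z%:~R / M * x - M^-1 * x.
  by rewrite intrB; ring.
move=> z; split.
  rewrite (_ : (fun x => _) = (fun x => 2^-1 * (h x * sin ((z + 1)%:~R / M * x)) +
     (- 2^-1) * (h x * sin ((z - 1)%:~R / M * x)))).
    by apply: integrals_cvgD; [apply: bounded_measM => //; exact: bounded_meas_sin|apply: bounded_measM => //; exact: bounded_meas_sin
      |exact: (lh _).2|exact: (lh _).2].
  by apply/funext => x; rewrite arg arg' sinB sinD; field.
rewrite (_ : (fun x => _) = (fun x => 2^-1 * (h x * cos ((z - 1)%:~R / M * x)) +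
     (- 2^-1) * (h x * cos ((z + 1)%:~R / M * x)))).
  by apply: integrals_cvgD; [apply: bounded_measM => //; exact: bounded_meas_cos|apply: bounded_measM => //; exact: bounded_meas_cos
      |exact: (lh _).1|exact: (lh _).1].
by apply/funext => x; rewrite arg arg' cosB cosD; field.
Qed.

(** A coordinate on [-M, M] that is both trigonometric and injective, as [x / M]
    stays in [-1, 1]; it takes values in the unit interval. *)
Definition node (x : R) : R := (1 + sin (M^-1 * x)) / 2.

Lemma node01 x : 0 <= node x <= 1.
Proof.
have := sin_geN1 (M^-1 * x); have := sin_le1 (M^-1 * x).
by rewrite /node => h1 h2; apply/andP; split; lra.
Qed.

Lemma trig_stable_bern n (h : nat -> R) : trig_stable (fun x => bern n h (node x)).
Proof.
elim: n => [|n IH] in h * => /=; first exact: trig_stable_cst.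
rewrite (_ : (fun x => _) = (fun x => 2^-1 * (1 * bern n (h \o S) (node x) + 1 * bern n h (node x)) +
    2^-1 * (1 * (sin (M^-1 * x) * bern n (h \o S) (node x)) +
            (- 1) * (sin (M^-1 * x) * bern n h (node x))))).
  apply: trig_stable_lin; apply: trig_stable_lin => //; exact: trig_stable_sinM.
by apply/funext => x; rewrite {1 3}/node; field.
Qed.

(** The truncation at [sin 1] keeps the argument inside the open interval where
    the arcsine is continuous. *)
Definition inv_node (v : R) : R :=
  M * asin (Num.max (- sin 1) (Num.min (sin 1) (2 * v - 1))).

Let sin1_lt1 : sin 1 < 1 :> R.
Proof.
rewrite lt_neqAle sin_le1 andbT; apply/eqP => h.
have h1 := sin1cos0 (x := 1 : R); rewrite h normr1 in h1.
by have := @cos1_gt0 R; rewrite h1// ltxx.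
Qed.

Let sin1_gt0 : 0 < sin 1 :> R.
Proof. by apply: sin2_gt0; rewrite ltr01 ltr1n. Qed.

Lemma inv_nodeK x : - M <= x <= M -> inv_node (node x) = x.
Proof.
move=> /andP[x1 x2]; rewrite /inv_node /node.
have -> : 2 * ((1 + sin (M^-1 * x)) / 2) - 1 = sin (M^-1 * x) by field.
have xM1 : -1 <= M^-1 * x.
  by rewrite -(@ler_pM2l _ M)// mulrA divff ?gt_eqF// mul1r mulrN1.
have xM2 : M^-1 * x <= 1.
  by rewrite -(@ler_pM2l _ M)// mulrA divff ?gt_eqF// mul1r mulr1.
have p1 := @pihalf_ge1 R.
have itv (y : R) : -1 <= y <= 1 -> y \in `[(- (pi / 2)), pi / 2].
  by move=> /andP[y1 y2]; rewrite in_itv /=; apply/andP; split; lra.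
have mono (y z : R) : -1 <= y <= 1 -> -1 <= z <= 1 -> y <= z -> sin y <= sin z.
  move=> hy hz yz; rewrite leNgt; apply/negP.
  by rewrite (ltr_sin (itv z hz) (itv y hy)) ltNge yz.
have h1 : sin (M^-1 * x) <= sin 1 by apply: mono => //; rewrite ?xM1 ?xM2 ?lexx//; lra.
have h2 : - sin 1 <= sin (M^-1 * x).
  by rewrite -sinN; apply: mono => //; rewrite ?xM1 ?xM2 ?lexx//; lra.
rewrite (min_r h1) (max_r h2) sinK; last by apply: itv; rewrite xM1 xM2.
by rewrite mulrA divff ?gt_eqF// mul1r.
Qed.

Lemma continuous_inv_node : continuous inv_node.
Proof.
move=> v; apply: cvgM; first exact: cvg_cst.
pose c (v : R) := Num.max (- sin 1) (Num.min (sin 1) (2 * v - 1)).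
have cc : {for v, continuous c}.
  apply: continuous_max; first exact: cst_continuous.
  apply: continuous_min; first exact: cst_continuous.
  apply: cvgB; last exact: cvg_cst.
  by apply: cvgM; [exact: cvg_cst | exact: cvg_id].
apply: (continuous_comp cc); apply: continuous_asin.
rewrite /c; apply/andP; split.
  by rewrite lt_max ltrN2 sin1_lt1.
rewrite gt_max gt_min sin1_lt1 /= andbT (lt_trans _ ltr01)// oppr_lt0//.
Qed.

(** On [-M, M] a continuous function is a continuous function of [node], hence a
    uniform limit of Bernstein polynomials in [node], which are trigonometric
    polynomials. *)
Lemma trig_weak_cvg : weak_cvg gs g.
Proof.
move=> f cf [K hK].
pose phi v := f (inv_node v).
have cphi : continuous phi.
  by move=> v; apply: continuous_comp; [exact: continuous_inv_node | exact: cf].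
have hphi v : `|phi v| <= K by exact: hK.
have K0 : 0 <= K by exact: le_trans (hK 0).
have bf : bounded_meas f by split; [exact: continuous_mfun | exists K].
apply/cvgrPdist_le => e e0.
have e4 : 0 < e / 4 by rewrite divr_gt0.
have [dl dl0 hdl] := heine_cantor 0 1 cphi (divr_gt0 e4 (ltr0n R 2)).
(* degree for which the second error term of bern_approx is small *)
pose n := (Num.truncn (2 * K / (dl ^+ 2 * (e / 8)))).+1.
have n0 : (0 < n)%N by [].
have hn : 2 * K / (dl ^+ 2 * n%:R) <= e / 8.
  have h : 2 * K / (dl ^+ 2 * (e / 8)) <= n%:R by exact: ltW (truncnS_gt _).
  have p1 : 0 < dl ^+ 2 * (e / 8) by rewrite mulr_gt0 ?exprn_gt0// divr_gt0.
  have p2 : 0 < dl ^+ 2 * n%:R by rewrite mulr_gt0 ?exprn_gt0// ltr0n.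
  by move: h; rewrite !ler_pdivrMr// mulrCA [e / 8 * _]mulrCA [n%:R * _]mulrC.
pose B x := bern n (fun k => phi (Num.min 1 (k%:R / n%:R))) (node x).
have algB : trig_stable B by exact: trig_stable_bern.
have approx x : - M <= x <= M -> `|B x - f x| <= e / 4.
  move=> hx; rewrite -{2}(inv_nodeK hx).
  apply: le_trans (bern_approx (node01 x) dl0 n0 hphi hdl) _.
  by apply: le_trans (lerD (lexx _) hn) _; lra.
have close (h : prior M) : `|\int[h]_x B x - \int[h]_x f x| <= e / 4.
  have iB := bounded_meas_int h algB.1; have if_ := bounded_meas_int h bf.
  rewrite -RintegralB// ler_norml; apply/andP; split.
    rewrite -(RintegralP_cst h (- (e / 4))); apply: prior_le.
    - exact: integrableR_cst.
    - exact: integrableRB.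
    by move=> x /approx; rewrite ler_norml => /andP[].
  rewrite -[leRHS](RintegralP_cst h); apply: prior_le.
  - exact: integrableRB.
  - exact: integrableR_cst.
  by move=> x /approx; rewrite ler_norml => /andP[].
have /cvgrPdist_le/(_ _ e4) := trig_stable_cvg algB.
apply: filterS => k hk.
have h1 := close g; have h2 := close (gs k).
rewrite (_ : _ - _ = (\int[g]_x B x - \int[gs k]_x B x) -
  (\int[g]_x B x - \int[g]_x f x) + (\int[gs k]_x B x - \int[gs k]_x f x)); last by ring.
apply: le_trans (ler_normD _ _) _.
have := ler_normB (\int[g]_x B x - \int[gs k]_x B x) (\int[g]_x B x - \int[g]_x f x).
by lra.
Qed.

End limit.

(** By contradiction: priors violating it for every [K] and [eta] would form a
    sequence whose trigonometric moments all converge to those of [gstar]. *)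
Lemma trig_determines (gstar : prior M) (d : prior M -> prior M -> R)
    (hd : metrizes_weak_cvg d) (e : R) : 0 < e ->
  exists (K : nat) (eta : R), 0 < eta /\ forall g : prior M,
    (forall j, (j <= K)%N ->
      `|\int[g]_x cos (j%:R / M * x) - \int[gstar]_x cos (j%:R / M * x)| <= eta /\
      `|\int[g]_x sin (j%:R / M * x) - \int[gstar]_x sin (j%:R / M * x)| <= eta) ->
    d g gstar < e.
Proof.
move=> e0; apply: contrapT => H.
have H' (n : nat) : exists g : prior M, (forall j, (j <= n)%N ->
      `|\int[g]_x cos (j%:R / M * x) - \int[gstar]_x cos (j%:R / M * x)| <= n.+1%:R^-1 /\
      `|\int[g]_x sin (j%:R / M * x) - \int[gstar]_x sin (j%:R / M * x)| <= n.+1%:R^-1)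
    /\ e <= d g gstar.
  apply: contrapT => Hn; apply: H; exists n, n.+1%:R^-1; split.
    by rewrite invr_gt0.
  move=> g hg; rewrite ltNge; apply/negP => he; apply: Hn.
  by exists g.
have [gs hgs] := choice H'.
have conv (F : nat -> R -> R) j :
   (forall n, (j <= n)%N -> `|\int[gs n]_x F j x - \int[gstar]_x F j x| <= n.+1%:R^-1) ->
   integrals_cvg gs gstar (F j).
  move=> hF; apply/cvgrPdist_le => r r0; near=> n.
  rewrite distrC; apply: (@le_trans _ _ n.+1%:R^-1); first by apply: hF; near: n; exact: nbhs_infty_ge.
  by near: n; by apply: filterS (near_infty_natSinv_lt (PosNum r0)) => k /= /ltW.
have wc : weak_cvg gs gstar.
  apply: trig_weak_cvg => j.
    by apply: (conv (fun j x => cos (j%:R / M * x))) => n jn; exact: ((hgs n).1 j jn).1.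
  by apply: (conv (fun j x => sin (j%:R / M * x))) => n jn; exact: ((hgs n).1 j jn).2.
have [[d0 _ _ _] hw] := hd.
have /cvgrPdist_lt/(_ _ e0)[n _ hn] := (hw gs gstar).2 wc.
have := hn n (leqnn n); rewrite /= sub0r normrN ger0_norm//.
by have [_ h] := hgs n; rewrite ltNge h.
Unshelve. all: by end_near. Qed.

End weak.

(** * Taylor bounds for sine and cosine *)

Section trig_taylor.
Context {R : realType}.
Implicit Types (F f : R -> R) (x : R).

Lemma ge0_from_derive F f : (forall x, is_derive x 1 F (f x)) ->
  (forall x, 0 <= x -> 0 <= f x) -> F 0 = 0 -> forall x, 0 <= x -> 0 <= F x.
Proof.
move=> dF f0 F0 x x0.
have [|c] := @MVT_segment R F f 0 x x0 (fun y _ => dF y).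
  apply: continuous_subspaceT => y; apply: differentiable_continuous.
  by apply/derivable1_diffP; have [] := dF y.
rewrite in_itv /= F0 !subr0 => /andP[c0 _] ->.
by apply: mulr_ge0 => //; exact: f0.
Qed.

Let Fcos1 x := cos x - (1 - x).
Let Fsin2 x := sin x - (x - x ^+ 2 / 2).
Let Fsin1 x := x - sin x.
Let Fcos2 x := cos x - (1 - x ^+ 2 / 2).
Let Fsin3 x := sin x - (x - x ^+ 3 / 6).
Let Fcos3 x := 1 - x ^+ 2 / 2 + x ^+ 3 / 6 - cos x.

Lemma cos_lower1 x : 0 <= x -> 0 <= Fcos1 x.
Proof.
apply: (@ge0_from_derive Fcos1 (fun y => 1 - sin y)).
- by move=> y; rewrite /Fcos1; apply: is_derive_eq; ring.
- by move=> y _; have := sin_le1 y; lra.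
- by rewrite /Fcos1 cos0 subr0 subrr.
Qed.

Lemma sin_lower2 x : 0 <= x -> 0 <= Fsin2 x.
Proof.
apply: (@ge0_from_derive Fsin2 Fcos1).
- move=> y; rewrite ?/Fsin2 ?/Fcos2 ?/Fsin3 ?/Fcos3; apply: is_derive_eq.
  by rewrite /Fcos1 /GRing.scale /=; field.
- exact: cos_lower1.
- by rewrite /Fsin2 sin0 expr0n /= mul0r !subr0.
Qed.

Lemma sin_upper1 x : 0 <= x -> 0 <= Fsin1 x.
Proof.
apply: (@ge0_from_derive Fsin1 (fun y => 1 - cos y)).
- by move=> y; have := cos_le1 y; lra.
- by rewrite /Fsin1 sin0 subr0.
Qed.

Lemma cos_lower2 x : 0 <= x -> 0 <= Fcos2 x.
Proof.
apply: (@ge0_from_derive Fcos2 Fsin1).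
- move=> y; rewrite ?/Fsin2 ?/Fcos2 ?/Fsin3 ?/Fcos3; apply: is_derive_eq.
  by rewrite /Fsin1 /GRing.scale /=; field.
- exact: sin_upper1.
- by rewrite /Fcos2 cos0 expr0n /= mul0r !subr0 subrr.
Qed.

Lemma sin_lower3 x : 0 <= x -> 0 <= Fsin3 x.
Proof.
apply: (@ge0_from_derive Fsin3 Fcos2).
- move=> y; rewrite ?/Fsin2 ?/Fcos2 ?/Fsin3 ?/Fcos3; apply: is_derive_eq.
  by rewrite /Fcos2 /GRing.scale /=; field.
- exact: cos_lower2.
- by rewrite /Fsin3 sin0 expr0n /= mul0r !subr0.
Qed.

Lemma cos_upper3 x : 0 <= x -> 0 <= Fcos3 x.
Proof.
apply: (@ge0_from_derive Fcos3 Fsin2).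
- move=> y; rewrite ?/Fsin2 ?/Fcos2 ?/Fsin3 ?/Fcos3; apply: is_derive_eq.
  by rewrite /Fsin2 /GRing.scale /=; field.
- exact: sin_lower2.
- by rewrite /Fcos3 cos0 !expr0n /= !mul0r !subr0 addr0 subrr.
Qed.

Lemma sinB_le x : `|sin x - x| <= x ^+ 2 / 2.
Proof.
wlog x0 : x / 0 <= x.
  move=> H; case: (leP 0 x) => [/H//|/ltW h].
  have := H (- x); rewrite sinN -opprD normrN sqrrN; apply; rewrite oppr_ge0 //.
have := sin_upper1 x0; have := sin_lower2 x0; rewrite /Fsin1 /Fsin2 => h1 h2.
by rewrite ler_norml; apply/andP; split; have := sqr_ge0 x; lra.
Qed.

Lemma sinB_le3 x : `|sin x - x| <= `|x| ^+ 3 / 6.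
Proof.
wlog x0 : x / 0 <= x.
  move=> H; case: (leP 0 x) => [/H//|/ltW h].
  have := H (- x); rewrite sinN -opprD !normrN; apply; rewrite oppr_ge0 //.
have := sin_upper1 x0; have := sin_lower3 x0; rewrite /Fsin1 /Fsin3 => h1 h2.
rewrite (ger0_norm x0) ler_norml; apply/andP; split; have := exprn_ge0 3 x0; lra.
Qed.

Lemma cosB1_le x : `|cos x - 1| <= x ^+ 2 / 2.
Proof.
wlog x0 : x / 0 <= x.
  move=> H; case: (leP 0 x) => [/H//|/ltW h].
  have := H (- x); rewrite cosN sqrrN; apply; rewrite oppr_ge0 //.
have := cos_lower2 x0; have := cos_le1 x; rewrite /Fcos2 => h1 h2.
by rewrite ler_norml; apply/andP; split; have := sqr_ge0 x; lra.
Qed.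

Lemma cosB_le3 x : `|cos x - (1 - x ^+ 2 / 2)| <= `|x| ^+ 3 / 6.
Proof.
wlog x0 : x / 0 <= x.
  move=> H; case: (leP 0 x) => [/H//|/ltW h].
  have := H (- x); rewrite cosN sqrrN normrN; apply; rewrite oppr_ge0 //.
have := cos_lower2 x0; have := cos_upper3 x0; rewrite /Fcos2 /Fcos3 => h1 h2.
rewrite (ger0_norm x0) ler_norml; apply/andP; split; have := exprn_ge0 3 x0; lra.
Qed.

Lemma cosD_taylor (a b : R) : `|cos (a + b) - cos a + b * sin a| <= b ^+ 2.
Proof.
rewrite cosD [X in `|X|](_ : _ = cos a * (cos b - 1) - sin a * (sin b - b)); last by ring.
apply: le_trans (ler_normB _ _) _; rewrite !normrM [b ^+ 2]splitr; apply: lerD.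
  apply: le_trans (cosB1_le b); apply: ler_piMl => //; exact: cos_max.
apply: le_trans (sinB_le b); apply: ler_piMl => //; exact: sin_max.
Qed.

Lemma cos_lip (a b : R) : `|cos a - cos b| <= `|a - b|.
Proof.
have [c _] : exists2 c, c \in `[Num.min a b, Num.max a b]%R &
    cos (Num.max a b) - cos (Num.min a b) = - sin c * (Num.max a b - Num.min a b).
  apply: MVT_segment; first by rewrite ge_min !le_max !lexx.
  apply: continuous_subspaceT; exact: continuous_cos.
move=> h; rewrite -[leLHS](_ : `|cos (Num.max a b) - cos (Num.min a b)| = _); last first.
  by case: (leP a b) => _ //; rewrite distrC.
rewrite -[leRHS](_ : `|Num.max a b - Num.min a b| = _); last first.
  by case: (leP a b) => _ //; rewrite distrC.
by rewrite h normrM normrN; apply: ler_piMl => //; exact: sin_max.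
Qed.

Lemma sin_lip (a b : R) : `|sin a - sin b| <= `|a - b|.
Proof.
rewrite -(cosBpihalf a) -(cosBpihalf b); apply: le_trans (cos_lip _ _) _.
by rewrite opprB addrA subrK.
Qed.

End trig_taylor.

(** * The characteristic function of the Gaussian law *)

Section derivative.
Context {R : realType}.

Lemma is_derive_quad (F : R -> R) (x D C : R) :
  (forall h, `|h| <= 1 -> `|F (x + h) - F x - h * D| <= C * h ^+ 2) -> is_derive x 1 F D.
Proof.
move=> H.
have C0 : 0 <= C.
  by have := H 1; rewrite normr1 lexx => /(_ isT); rewrite expr1n mulr1; exact: le_trans.
have c : h^-1 *: ((F \o shift x) (h *: 1) - F x) @[h --> 0^'] --> D.
  apply/cvgrPdist_le => e e0; near=> h.
  have h0 : h != 0 by near: h; exact: nbhs_dnbhs_neq.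
  rewrite /= /shift /= /GRing.scale /= mulr1 distrC addrC.
  rewrite (_ : _ + _ = h^-1 * (F (x + h) - F x - h * D)); last by rewrite [h + x]addrC; field.
  rewrite normrM normfV ler_pdivrMl ?normr_gt0//.
  apply: (@le_trans _ _ (C * h ^+ 2)).
    by apply: H; near: h; apply: dnbhs0_le.
  rewrite -(real_normK (num_real h)) expr2 mulrA mulrC ler_pM2l ?normr_gt0//.
  rewrite (@le_trans _ _ ((C + 1) * `|h|))//; first by rewrite ler_wpM2r// lerDl.
  rewrite -ler_pdivlMl ?ltr_wpDl//.
  by near: h; apply: dnbhs0_le; rewrite mulr_gt0 ?invr_gt0 ?ltr_wpDl.
apply: DeriveDef.
- by apply/cvg_ex; exists D.
- exact: cvg_lim.
Unshelve. all: by end_near. Qed.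

Lemma expR_taylor (u : R) : `|expR u - 1 - u| <= u ^+ 2 * expR `|u|.
Proof.
have h1 := expR_ge1Dx u; have h2 := expR_ge1Dx (- u).
have e0 := expR_gt0 u; have e1 : expR u * expR (- u) = 1 by rewrite -expRD subrr expR0.
have h3 : expR u - 1 - u <= u * (expR u - 1).
  have : expR u * (1 - u) <= 1 by rewrite -[leRHS]e1; apply: ler_wpM2l; [exact: ltW|exact: h2].
  by rewrite mulrBr mulr1 !mulrBr mulr1; lra.
rewrite ger0_norm; last by lra.
apply: le_trans h3 _.
case: (leP 0 u) => u0.
  rewrite (ger0_norm u0) expr2 -mulrA ler_wpM2l//.
  have : expR u * (1 - u) <= 1 by rewrite -[leRHS]e1; apply: ler_wpM2l; [exact: ltW|exact: h2].
  by rewrite mulrBr mulr1; lra.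
have -> : u * (expR u - 1) = - u * (1 - expR u) by ring.
have -> : u ^+ 2 * expR `|u| = - u * (- u * expR `|u|) by ring.
rewrite ler_pM2l ?oppr_gt0//.
have h4 : 1 <= expR `|u| by rewrite -[leLHS]expR0 ler_expR.
have : - u * 1 <= - u * expR `|u| by rewrite ler_pM2l ?oppr_gt0.
lra.
Qed.

End derivative.

Section gauss_cf.
Context {R : realType}.
Variable s : R.
Hypothesis s0 : s != 0.
Local Notation G := (gauss s).

Lemma le_expRabs (x : R) : `|x| <= expR `|x|.
Proof. by have := expR_ge1Dx `|x|; lra. Qed.

Lemma sqr_le_expRabs (x : R) : x ^+ 2 <= 8 * expR `|x|.
Proof.
apply: le_trans (sqr_le_cosh x) _.
have h1 : expR x <= expR `|x| by rewrite ler_expR ler_norm.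
have h2 : expR (- x) <= expR `|x| by rewrite ler_expR -normrN ler_norm.
lra.
Qed.

Lemma gauss_dominated (f : R -> R) (C t : R) : measurable_fun setT f ->
  (forall x, `|f x| <= C * expR (t * `|x|)) -> G.-integrable setT (EFin \o f).
Proof.
move=> mf hf; apply: (@integrable_dominated _ _ _ _ f (fun x => C * expR (t * `|x|))) => //.
by apply: integrableRZ; exact: integrable_gauss_expRabs.
Qed.

(** The shift formula for [1 + cos], which is nonnegative. *)
Lemma gauss_tilt (a t b : R) :
  \int[G]_x (expR (a * x) * (1 + cos (t * x + b))) =
  expR (a ^+ 2 * s ^+ 2 / 2) * \int[G]_x (1 + cos (t * x + (t * (a * s ^+ 2) + b))).
Proof.
have mc c : measurable_fun setT (fun x : R => 1 + cos (t * x + c)).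
  apply: measurable_funD => //; apply: (measurableT_comp (continuous_measurable_fun (@continuous_cos R))).
  by apply: measurable_funD => //; exact: measurable_funM.
have c0 (y : R) : 0 <= 1 + cos y by have := cos_geN1 y; lra.
have h := @ge0_integral_gauss_shift R s (a * s ^+ 2) (fun x => (1 + cos (t * x + b))%:E) s0
  (proj2 (measurable_EFinP _ _) (mc b)) (fun x => c0 _).
rewrite /Rintegral.
have -> : (\int[G]_x (1 + cos (t * x + (t * (a * s ^+ 2) + b)))%:E =
   \int[G]_x (1 + cos (t * (a * s ^+ 2 + x) + b))%:E)%E.
  by apply: eq_integral => x _; congr (1 + cos _)%:E; ring.
rewrite h.
have -> : (\int[G]_x (expR (a * x) * (1 + cos (t * x + b)))%:E =
  (expR (a ^+ 2 * s ^+ 2 / 2))%:E * \int[G]_x ((1 + cos (t * x + b))%:E *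
   (expR (a * s ^+ 2 * x / s ^+ 2 - (a * s ^+ 2) ^+ 2 / (2 * s ^+ 2)))%:E))%E.
  rewrite -ge0_integralZl//; last first.
    - apply: emeasurable_funM; first exact/measurable_EFinP.
    apply/measurable_EFinP; apply: measurableT_comp => //.
    by apply: measurable_funB => //; apply: measurable_funM => //; exact: measurable_funM.

  apply: eq_integral => x _; rewrite -!EFinM; congr EFin.
  rewrite [X in _ = _ * X]mulrC mulrA -expRD; congr (expR _ * _).
  by field.
rewrite fineM//.
rewrite -h.
have hb : G.-integrable setT (EFin \o (fun x => 1 + cos (t * x + (t * (a * s ^+ 2) + b)))).
  apply: (@integrable_bounded _ _ _ _ _ 2) => // x.
  by rewrite ger0_norm//; have := cos_le1 (t * x + (t * (a * s ^+ 2) + b)); lra.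
have := integrable_fin_num measurableT hb.
congr (_ \is a fin_num); apply: eq_integral => x _; congr (1 + cos _)%:E; ring.
Qed.

Let C t b := \int[G]_x cos (t * x + b).
Let S t b := \int[G]_x sin (t * x + b).
Let XC t b := \int[G]_x (x * cos (t * x + b)).
Let XS t b := \int[G]_x (x * sin (t * x + b)).
Let Q := \int[G]_x (x ^+ 2).
Let Q' := \int[G]_x (x ^+ 2 * expR `|x|).

Let maff (t b : R) : measurable_fun setT (fun x : R => t * x + b).
Proof. by apply: measurable_funD => //; exact: measurable_funM. Qed.

Lemma measurable_cosA (t b : R) : measurable_fun setT (fun x : R => cos (t * x + b)).
Proof. exact: measurableT_comp (continuous_measurable_fun (@continuous_cos R)) (maff t b). Qed.

Lemma measurable_sinA (t b : R) : measurable_fun setT (fun x : R => sin (t * x + b)).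
Proof. exact: measurableT_comp (continuous_measurable_fun (@continuous_sin R)) (maff t b). Qed.

Let ibnd (f : R -> R) : measurable_fun setT f -> (forall x, `|f x| <= 1) ->
  G.-integrable setT (EFin \o f) /\ G.-integrable setT (EFin \o (fun x => x * f x)).
Proof.
move=> mf hf; split; first exact: (@integrable_bounded _ _ _ _ _ 1).
apply: (@gauss_dominated _ 1 1) => //; first exact: measurable_funM.
move=> x; rewrite !mul1r normrM; apply: le_trans (le_expRabs x).
by apply: ler_piMr.
Qed.

Let icos t b : G.-integrable setT (EFin \o (fun x => cos (t * x + b))) /\
  G.-integrable setT (EFin \o (fun x => x * cos (t * x + b))).
Proof. exact: ibnd (measurable_cosA t b) (fun x => cos_max _). Qed.

Let isin t b : G.-integrable setT (EFin \o (fun x => sin (t * x + b))) /\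
  G.-integrable setT (EFin \o (fun x => x * sin (t * x + b))).
Proof. exact: ibnd (measurable_sinA t b) (fun x => sin_max _). Qed.

Let iQ : G.-integrable setT (EFin \o (fun x => x ^+ 2)).
Proof.
apply: (@gauss_dominated _ 8 1) => // x.
by rewrite mul1r ger0_norm ?sqr_ge0//; exact: sqr_le_expRabs.
Qed.

Let iQ' : G.-integrable setT (EFin \o (fun x => x ^+ 2 * expR `|x|)).
Proof.
apply: (@gauss_dominated _ 8 2).
  apply: measurable_funM => //; apply: measurableT_comp => //.
move=> x; rewrite normrM (ger0_norm (sqr_ge0 x)) (ger0_norm (expR_ge0 _)).
rewrite [2 * _](_ : _ = `|x| + `|x|); last by ring.
rewrite expRD mulrA; apply: ler_wpM2r; first exact: expR_ge0.
exact: sqr_le_expRabs.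
Qed.

Lemma norm_Rintegral_le (f h : R -> R) (D : R) : G.-integrable setT (EFin \o f) ->
  G.-integrable setT (EFin \o h) -> (forall x, `|f x| <= D * h x) ->
  `|\int[G]_x f x| <= D * \int[G]_x h x.
Proof.
move=> fi hi fh; rewrite -RintegralZl//.
have hN x : - (D * h x) <= f x <= D * h x by rewrite -ler_norml.
rewrite ler_norml; apply/andP; split; last first.
  by apply: le_Rintegral => //; [exact: integrableRZ | move=> x _; case/andP: (hN x)].
rewrite -mulN1r -RintegralZl//; last exact: integrableRZ.
apply: le_Rintegral => //; first by apply: integrableRZ; exact: integrableRZ.
by move=> x _; rewrite mulN1r; case/andP: (hN x).
Qed.

Lemma is_derive_gauss_cos (t b : R) : is_derive t (1 : R) (fun t : R => C t b) (- XS t b).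
Proof.
apply: (@is_derive_quad _ _ _ _ Q) => h _; rewrite mulrC /C /XS.
have i1 := (icos (t + h) b).1; have i2 := (icos t b).1; have i3 := (isin t b).2.
rewrite -RintegralB// mulNr opprK [_ * h]mulrC -RintegralZl// -RintegralD//; last 2 first.
- exact: integrableRB.
- exact: integrableRZ.
rewrite mulrC; apply: norm_Rintegral_le => //.
  by apply: integrableRD; [exact: integrableRB | exact: integrableRZ].
move=> x; have := cosD_taylor (t * x + b) (h * x); rewrite exprMn mulrA.
by rewrite (_ : t * x + b + h * x = (t + h) * x + b)//; ring.
Qed.

Let W a t b := \int[G]_x (expR (a * x) * (1 + cos (t * x + b))).

Let i1cos t b : G.-integrable setT (EFin \o (fun x => 1 + cos (t * x + b))).
Proof. by apply: integrableRD; [exact: integrableR_cst | exact: (icos t b).1]. Qed.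

Let ix : G.-integrable setT (EFin \o (id : R -> R)).
Proof.
have mid : measurable_fun setT (id : R -> R) by exact: measurable_id.
apply: (@gauss_dominated _ 1 1) => //.
by move=> x; rewrite !mul1r; exact: le_expRabs.
Qed.

Let ix1cos t b : G.-integrable setT (EFin \o (fun x => x * (1 + cos (t * x + b)))).
Proof.
rewrite (_ : (fun x => _) = (fun x => x + x * cos (t * x + b))).
  by apply: integrableRD => //; exact: (icos t b).2.
by apply/funext => x; rewrite mulrDr mulr1.
Qed.

Let iW a t b : `|a| <= 1 -> G.-integrable setT (EFin \o (fun x => expR (a * x) * (1 + cos (t * x + b)))).
Proof.
move=> a1; apply: (@gauss_dominated _ 2 1).
  apply: measurable_funM; first by apply: measurableT_comp => //; exact: measurable_funM.
  by apply: measurable_funD => //; exact: measurable_cosA.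
move=> x; rewrite mul1r normrM mulrC; apply: ler_pM => //.
  by have := cos_geN1 (t * x + b); have := cos_le1 (t * x + b) => h1 h2;
    rewrite ger0_norm; lra.
rewrite ger0_norm ?expR_ge0// ler_expR; apply: le_trans (ler_norm _) _.
by rewrite normrM; exact: ler_piMl.
Qed.

Lemma is_derive_tilted (t b : R) : is_derive (0 : R) (1 : R) (fun a : R => W a t b) (\int[G]_x x + XC t b).
Proof.
apply: (@is_derive_quad _ _ _ _ (2 * Q')) => a a1; rewrite add0r /W /XC.
have -> : \int[G]_x (expR (0 * x) * (1 + cos (t * x + b))) = \int[G]_x (1 + cos (t * x + b)).
  by apply: eq_Rintegral => x _; rewrite mul0r expR0 mul1r.
have iW1 := @iW a t b a1; have ic := i1cos t b; have ixc := (icos t b).2.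
rewrite -RintegralD//.
have -> : \int[G]_x (x + x * cos (t * x + b)) = \int[G]_x (x * (1 + cos (t * x + b))).
  by apply: eq_Rintegral => x _; rewrite mulrDr mulr1.
have ixx := ix1cos t b.
rewrite -RintegralB// -RintegralZl// -RintegralB//; last 2 first.
- exact: integrableRB.
- exact: integrableRZ.
rewrite mulrAC; apply: norm_Rintegral_le => //.
  by apply: integrableRB; [exact: integrableRB | exact: integrableRZ].
move=> x; set k := 1 + cos _.
have k2 : `|k| <= 2.
  by have := cos_geN1 (t * x + b); have := cos_le1 (t * x + b) => h1 h2;
    rewrite /k ger0_norm; lra.
have -> : expR (a * x) * k - k - a * (x * k) = k * (expR (a * x) - 1 - a * x) by ring.
rewrite normrM -[leRHS]mulrA; apply: ler_pM => //.
apply: le_trans (expR_taylor _) _; rewrite exprMn -[leLHS]mulrA.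
apply: ler_wpM2l; first exact: sqr_ge0.
apply: ler_wpM2l; first exact: sqr_ge0.
by rewrite ler_expR normrM; exact: ler_piMl.
Qed.

Lemma tilted_closed t b : (fun a => W a t b) = (fun a => expR (a ^+ 2 * (s ^+ 2 / 2)) *
  (1 + (cos (a * (t * s ^+ 2)) * C t b - sin (a * (t * s ^+ 2)) * S t b))).
Proof.
apply/funext => a; rewrite /W gauss_tilt -mulrA; congr (_ * _).
have i1 := (icos t b).1; have i2 := (isin t b).1.
rewrite RintegralD//; [|exact: integrableR_cst|exact: (icos _ _).1].
rewrite RintegralP_cst; congr (_ + _); rewrite /C /S.
rewrite -RintegralZl// -RintegralZl// -RintegralB//; [|exact: integrableRZ|exact: integrableRZ].
apply: eq_Rintegral => x _; rewrite -cosD; congr cos; ring.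
Qed.

Lemma is_derive_tilted_closed (t b : R) : is_derive (0 : R) (1 : R) (fun a : R => W a t b) (- (t * s ^+ 2) * S t b).
Proof.
rewrite tilted_closed; apply: is_derive_eq.
rewrite /GRing.scale /= !mul0r expr0n /= mul0r expR0 sin0 cos0; ring.
Qed.

(** Stein's identity: both sides are the derivative at 0 of the exponentially
    tilted integral, computed under the integral sign and from its closed
    form. *)
Lemma stein_cos t b : \int[G]_x x + XC t b = - (t * s ^+ 2) * S t b.
Proof.
have h1 := is_derive_tilted t b; have h2 := is_derive_tilted_closed t b.
by rewrite -(@derive_val _ _ _ _ _ _ _ h1) (@derive_val _ _ _ _ _ _ _ h2).
Qed.

Lemma gauss_mean : \int[G]_x x = 0.
Proof.
have := stein_cos 0 0; rewrite mul0r oppr0 mul0r /XC.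
rewrite (_ : \int[G]_x (x * cos (0 * x + 0)) = \int[G]_x x); first by lra.
by apply: eq_Rintegral => x _; rewrite mul0r addr0 cos0 mulr1.
Qed.

(** With the phase [b] moved by a quarter turn, Stein's identity says that the
    left-hand side solves the equation [F' = - t s^2 F]. *)
Lemma gauss_cosA t b : C t b = cos b * expR (- (t ^+ 2 * (s ^+ 2 / 2))).
Proof.
have dC (u : R) : is_derive u (1 : R) (fun t : R => C t b) (- (u * s ^+ 2) * C u b).
  have := is_derive_gauss_cos u b; rewrite (_ : - XS u b = - (u * s ^+ 2) * C u b)//.
  have := stein_cos u (b - pi / 2); rewrite gauss_mean add0r mulNr /XC /S.
  rewrite (_ : \int[G]_x (x * cos (u * x + (b - pi / 2))) = XS u b); last first.
    by apply: eq_Rintegral => x _; rewrite addrA cosBpihalf.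
  move=> ->; rewrite (_ : \int[G]_x sin (u * x + (b - pi / 2)) = - C u b); first by ring.
  rewrite /C -[RHS]mulN1r -RintegralZl//; last exact: (icos u b).1.
  by apply: eq_Rintegral => x _; rewrite addrA sinBpihalf mulN1r.
have H : forall u : R, is_derive u (1 : R) (fun u => C u b * expR (u ^+ 2 * (s ^+ 2 / 2))) 0.
  move=> u; have dCu := dC u; apply: is_derive_eq.
  by rewrite /GRing.scale /=; field.
have := is_derive_0_is_cst t 0 H; rewrite /= expr0n /= mul0r expR0 mulr1 => h.
have -> : cos b = C 0 b.
  rewrite /C -[LHS](RintegralP_cst G); apply: eq_Rintegral => x _.
  by rewrite mul0r add0r.
by rewrite -h -mulrA -expRD subrr expR0 mulr1.
Qed.

End gauss_cf.

(** * Characteristic functions of linear forms *)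

Section cplx.
Import ComplexField.
Local Open Scope complex_scope.
Context {R : realType}.
Local Notation normc := (@Normc.normc R).

Definition cis (u : R) : R[i] := cos u +i* sin u.

Lemma cisD u v : cis (u + v) = cis u * cis v.
Proof. by rewrite /cis cosD sinD; simpc; congr (_ +i* _); ring. Qed.

Lemma cis0 : cis 0 = 1.
Proof. by rewrite /cis cos0 sin0. Qed.

Lemma normc_cis u : normc (cis u) = 1.
Proof. by rewrite /= cos2Dsin2 sqrtr1. Qed.

Lemma normc_ge0 (z : R[i]) : 0 <= normc z.
Proof. by case: z => a b /=; exact: sqrtr_ge0. Qed.

Lemma normc_real (a : R) : normc a%:C = `|a|.
Proof. by rewrite /= expr0n addr0 sqrtr_sqr. Qed.

Lemma Re_le_normc (z : R[i]) : `|Re z| <= normc z.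
Proof. by case: z => a b /=; rewrite -sqrtr_sqr; apply: ler_wsqrtr; rewrite lerDl sqr_ge0. Qed.

Lemma normc_le_l1 (z : R[i]) : normc z <= `|Re z| + `|Im z|.
Proof.
case: z => a b /=; rewrite -[leRHS]ger0_norm ?addr_ge0// -sqrtr_sqr; apply: ler_wsqrtr.
rewrite sqrrD -(real_normK (num_real a)) -(real_normK (num_real b)).
have := mulr_ge0 (normr_ge0 a) (normr_ge0 b); lra.
Qed.

Lemma normcD (x y : R[i]) : normc (x + y) <= normc x + normc y.
Proof. exact: le_normcD. Qed.

Lemma normc_opp (x : R[i]) : normc (- x) = normc x.
Proof. exact: normcN. Qed.

Lemma normcB (x y : R[i]) : normc (x - y) <= normc x + normc y.
Proof. by rewrite -(normc_opp y); exact: normcD. Qed.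

Lemma normc_mul (x y : R[i]) : normc (x * y) = normc x * normc y.
Proof. exact: Normc.normcM. Qed.

Lemma normc_conj (x : R[i]) : normc (x^*) = normc x.
Proof. by case: x => a b /=; rewrite sqrrN. Qed.

Lemma normc_prod (I : finType) (P : pred I) (F : I -> R[i]) :
  normc (\prod_(i | P i) F i) = \prod_(i | P i) normc (F i).
Proof. apply: big_morph; [exact: normc_mul | exact: Normc.normc1]. Qed.

Lemma ReM (a b : R[i]) : Re (a * b) = Re a * Re b - Im a * Im b.
Proof. by case: a => ? ?; case: b. Qed.

Lemma Re_mulJ (z : R[i]) : Re (z * z^*) = normc z ^+ 2.
Proof. by case: z => a b /=; rewrite sqr_sqrtr ?addr_ge0 ?sqr_ge0//; ring. Qed.

(** Telescope the product; the factors that remain have modulus at most 1. *)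
Lemma normc_prodB (I : finType) (P : pred I) (A B : I -> R[i]) :
  (forall i, normc (A i) <= 1) -> (forall i, normc (B i) <= 1) ->
  [/\ normc (\prod_(i | P i) A i) <= 1, normc (\prod_(i | P i) B i) <= 1 &
  normc (\prod_(i | P i) A i - \prod_(i | P i) B i) <= \sum_(i | P i) normc (A i - B i)].
Proof.
move=> hA hB.
apply: (big_rec3 (fun a b c => [/\ normc a <= 1, normc b <= 1 & normc (a - b) <= c])).
  by rewrite subrr Normc.normc0 Normc.normc1 lexx.
move=> i a b c _ [ha hb hab]; split.
- by rewrite normc_mul mulr_ile1 ?normc_ge0.
- by rewrite normc_mul mulr_ile1 ?normc_ge0.
rewrite (_ : _ * _ - _ = (A i - B i) * a + B i * (a - b)); last by ring.
apply: le_trans (normcD _ _) _; rewrite !normc_mul; apply: lerD.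
  by apply: ler_piMr => //; exact: normc_ge0.
by apply: le_trans hab; apply: ler_piMl => //; exact: normc_ge0.
Qed.

End cplx.

Section char_fun.
Import ComplexField.
Local Open Scope complex_scope.
Context {R : realType}.
Local Notation normc := (@Normc.normc R).

Definition ecis d (T : measurableType d) (mu : probability T R) (f : T -> R) : R[i] :=
  (\int[mu]_x cos (f x)) +i* (\int[mu]_x sin (f x)).

Definition cf (mu : probability R R) (t : R) : R[i] := ecis mu (fun x => t * x).

Section ecis.
Import ComplexField.
Local Open Scope complex_scope.
Context d (T : measurableType d) (mu : probability T R).
Implicit Types f : T -> R.

Lemma measurable_cosC f : measurable_fun setT f -> measurable_fun setT (fun x => cos (f x)).
Proof. exact: measurableT_comp (continuous_measurable_fun (@continuous_cos R)). Qed.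

Lemma measurable_sinC f : measurable_fun setT f -> measurable_fun setT (fun x => sin (f x)).
Proof. exact: measurableT_comp (continuous_measurable_fun (@continuous_sin R)). Qed.

Lemma integrable_cosC f : measurable_fun setT f ->
  mu.-integrable setT (EFin \o (fun x => cos (f x))).
Proof.
move=> mf; apply: (@integrable_bounded _ _ _ _ _ 1); first exact: measurable_cosC.
by move=> x; exact: cos_max.
Qed.

Lemma integrable_sinC f : measurable_fun setT f ->
  mu.-integrable setT (EFin \o (fun x => sin (f x))).
Proof.
move=> mf; apply: (@integrable_bounded _ _ _ _ _ 1); first exact: measurable_sinC.
by move=> x; exact: sin_max.
Qed.

Lemma ecis_mulr f (z : R[i]) : measurable_fun setT f ->
  (\int[mu]_x Re (cis (f x) * z)) +i* (\int[mu]_x Im (cis (f x) * z)) = ecis mu f * z.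
Proof.
move=> mf; have ic := integrable_cosC mf; have is_ := integrable_sinC mf.
case: z => a b; apply/eqP; rewrite eq_complex /=; apply/andP; split; apply/eqP.
  rewrite [in RHS]mulrC [X in _ - X]mulrC -!RintegralZl//.
  rewrite -RintegralB//; [|exact: integrableRZ|exact: integrableRZ].
  by apply: eq_Rintegral => x _; rewrite mulrC [sin _ * b]mulrC.
rewrite [X in X + _]mulrC [X in _ + X]mulrC -!RintegralZl//.
rewrite -RintegralD//; [|exact: integrableRZ|exact: integrableRZ].
by apply: eq_Rintegral => x _; rewrite mulrC [sin _ * a]mulrC.
Qed.

Lemma ecisD f (b : R) : measurable_fun setT f -> ecis mu (fun x => f x + b) = ecis mu f * cis b.
Proof.
move=> mf; rewrite -(ecis_mulr _ mf) /ecis; congr (_ +i* _); apply: eq_Rintegral => x _.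
  by rewrite -cisD.
by rewrite -cisD.
Qed.

(** Rotate to the positive axis: the squared modulus is the integral of the real
    part of [cis f] times the conjugate of the value, which is at most the
    modulus. *)
Lemma normc_ecis f : measurable_fun setT f -> normc (ecis mu f) <= 1.
Proof.
move=> mf; set z := ecis mu f.
have [z0|z0] := eqVneq (normc z) 0; first by rewrite z0.
have zp : 0 < normc z by rewrite lt_neqAle eq_sym z0 normc_ge0.
rewrite -(@ler_pM2r _ (normc z))// mul1r.
have zz : Re (z * z^*) = normc z * normc z.
  by rewrite Re_mulJ expr2.
rewrite -zz -(ecis_mulr _ mf) /=.
have mre : measurable_fun setT (fun x => Re (cis (f x) * z^*)).
  rewrite (_ : (fun x => _) = fun x => cos (f x) * Re z^* - sin (f x) * Im z^*); last first.
    by apply/funext => x; rewrite ReM.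
  apply: measurable_funB; apply: measurable_funM => //.
  exact: measurable_cosC.
  exact: measurable_sinC.
have bre x : `|Re (cis (f x) * z^*)| <= normc z.
  by apply: le_trans (Re_le_normc _) _; rewrite normc_mul normc_cis mul1r normc_conj.
rewrite -[leRHS](RintegralP_cst mu); apply: le_Rintegral => //.
- exact: (@integrable_bounded _ _ _ _ _ (normc z)).
- exact: integrableR_cst.
by move=> x _; apply: le_trans (bre x); exact: ler_norm.
Qed.

End ecis.

Definition lin n (w : 'I_n -> R) (x : n.-tuple R) : R := \sum_i w i * tnth x i.

Lemma measurable_lin n (w : 'I_n -> R) : measurable_fun setT (lin w).
Proof.
apply: measurable_sum => i; apply: measurable_funM => //; exact: measurable_tnth.
Qed.

Lemma lin_tcons n (w : 'I_n.+1 -> R) u x :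
  lin w (tcons u x) = w ord0 * u + lin (fun i => w (lift ord0 i)) x.
Proof.
rewrite /lin big_ord_recl !tnth0; congr (_ + _).
by apply: eq_bigr => i _; rewrite !tnthS.
Qed.

Lemma ecis_power (mu : probability R R) n (w : 'I_n -> R) :
  ecis (power_prob mu n) (lin w) = \prod_i cf mu (w i).
Proof.
elim: n => [|n IH] in w *.
  rewrite /ecis !integral_power0 big_ord0 /lin big_ord0.
  by rewrite cos0 sin0.
rewrite big_ord_recl -IH; set w' := fun i => _.
have mw := @measurable_lin n w'.
rewrite /ecis (Rintegral_powerS (integrable_cosC _ (measurable_lin w))).
rewrite (Rintegral_powerS (integrable_sinC _ (measurable_lin w))).
have mu0 : measurable_fun setT (fun u : R => w ord0 * u) by exact: measurable_funM.
rewrite /cf -(ecis_mulr _ _ mu0).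
have e u : (\int[power_prob mu n]_x cos (lin w (tcons u x))) +i*
           (\int[power_prob mu n]_x sin (lin w (tcons u x))) =
   cis (w ord0 * u) * ecis (power_prob mu n) (lin w').
  rewrite mulrC -(ecisD _ _ mw) /ecis; congr (_ +i* _); apply: eq_Rintegral => x _;
  by rewrite lin_tcons addrC.
by congr (_ +i* _); apply: eq_Rintegral => u _; rewrite -e.
Qed.

Lemma cf_gauss (s t : R) : s != 0 -> cf (gauss s) t = (expR (- (t ^+ 2 * (s ^+ 2 / 2))))%:C.
Proof.
move=> s0; rewrite /cf /ecis.
have := gauss_cosA s0 t 0; rewrite cos0 mul1r => <-.
have := gauss_cosA s0 t (- (pi / 2)); rewrite cosN cos_pihalf mul0r => h.
congr (_ +i* _); first by apply: eq_Rintegral => x _; rewrite addr0.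
by rewrite -h; apply: eq_Rintegral => x _; rewrite cosBpihalf.
Qed.

Lemma ecis_gauss (s : R) n (w : 'I_n -> R) : s != 0 ->
  ecis (power_prob (gauss s) n) (lin w) = (expR (- ((\sum_i w i ^+ 2) * (s ^+ 2 / 2))))%:C.
Proof.
move=> s0; rewrite ecis_power mulr_suml -sumrN expR_sum rmorph_prod /=.
by apply: eq_bigr => i _; exact: cf_gauss.
Qed.

Lemma lin_tcol n (z : 'cV[R]_n) x : dotv z (tcol x) = lin (fun i => z i 0) x.
Proof. by rewrite dotvE; apply: eq_bigr => i _; rewrite mxE. Qed.

Lemma trmul_entry n p (X : 'M[R]_(n, p)) (z : 'cV[R]_n) k :
  (X^T *m z) k 0 = dotv z (col k X).
Proof.
rewrite dotvC dotvE mxE; apply: eq_bigr => i _; by rewrite !mxE.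
Qed.

Lemma dotv_obs n p (X : 'M[R]_(n, p)) (z : 'cV[R]_n) zz :
  dotv z (obs X zz) = lin (fun k => dotv z (col k X)) zz.1 + lin (fun i => z i 0) zz.2.
Proof.
rewrite /obs dotvDr dotv_mul !lin_tcol; congr (_ + _); apply: eq_bigr => k _.
by rewrite trmul_entry.
Qed.

Lemma ecis_prod d1 d2 (T1 : measurableType d1) (T2 : measurableType d2)
    (m1 : probability T1 R) (m2 : probability T2 R) (f1 : T1 -> R) (f2 : T2 -> R) :
  measurable_fun setT f1 -> measurable_fun setT f2 ->
  ecis (m1 \x m2)%E (fun z => f1 z.1 + f2 z.2) = ecis m1 f1 * ecis m2 f2.
Proof.
move=> mf1 mf2.
have mf : measurable_fun setT (fun z : T1 * T2 => f1 z.1 + f2 z.2).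
  by apply: measurable_funD; [exact: measurableT_comp mf1 measurable_fst
    |exact: measurableT_comp mf2 measurable_snd].
rewrite /ecis (Rintegral_prod (integrable_cosC _ mf)) (Rintegral_prod (integrable_sinC _ mf)).
rewrite -/(ecis m2 f2) -/(ecis m1 f1) -(ecis_mulr _ _ mf1).
have e u : (\int[m2]_x cos (f1 u + f2 x)) +i* (\int[m2]_x sin (f1 u + f2 x)) =
   cis (f1 u) * ecis m2 f2.
  rewrite mulrC -(ecisD _ _ mf2) /ecis; congr (_ +i* _); apply: eq_Rintegral => x _;
  by rewrite addrC.
by congr (_ +i* _); apply: eq_Rintegral => u _; rewrite -e.
Qed.

(** The coordinates are independent, so that the characteristic function factors;
    the noise contributes a positive factor that does not depend on the
    prior. *)
Lemma ecis_joint (M : R) n p (X : 'M[R]_(n, p)) (s tau : R) (g : prior M) (z : 'cV[R]_n) :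
  s != 0 ->
  ecis (joint n p s g) (fun zz => tau * dotv z (obs X zz)) =
  (expR (- (tau ^+ 2 * l2norm z ^+ 2 * (s ^+ 2 / 2))))%:C *
  \prod_k cf g (tau * dotv z (col k X)).
Proof.
move=> s0.
have -> : (fun zz => tau * dotv z (obs X zz)) =
  (fun zz : p.-tuple R * n.-tuple R => lin (fun k => tau * dotv z (col k X)) zz.1 + lin (fun i => tau * z i 0) zz.2).
  apply/funext => zz; rewrite dotv_obs mulrDr /lin !mulr_sumr.
  by congr (_ + _); apply: eq_bigr => i _; rewrite mulrA.
rewrite /joint ecis_prod; [|exact: measurable_lin|exact: measurable_lin].
rewrite mulrC; congr (_ * _); last exact: ecis_power.
rewrite (ecis_gauss (fun i => tau * z i 0) s0).
have -> // : \sum_i (tau * z i 0) ^+ 2 = tau ^+ 2 * l2norm z ^+ 2.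
by rewrite l2norm_sqr mulr_sumr; apply: eq_bigr => i _; rewrite exprMn.
Qed.

End char_fun.

(** * Lindeberg comparison of products of characteristic functions *)

Section prior_cf.
Import ComplexField.
Local Open Scope complex_scope.
Context {R : realType} (M : R).
Hypothesis M0 : 0 < M.
Local Notation normc := (@Normc.normc R).

Definition mean (g : prior M) : R := \int[g]_x x.
Definition var (g : prior M) : R := \int[g]_x (x - mean g) ^+ 2.

Let mid : measurable_fun setT (id : R -> R).
Proof. exact: measurable_id. Qed.

Let maff (t m : R) : measurable_fun setT (fun x : R => t * (x - m)).
Proof. by apply: measurable_funM => //; exact: measurable_funB. Qed.

Lemma prior_norm_le (g : prior M) (f : R -> R) C : measurable_fun setT f ->
  (forall x, - M <= x <= M -> `|f x| <= C) -> `|\int[g]_x f x| <= C.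
Proof.
move=> mf h; have fi := prior_integrable g mf h.
rewrite ler_norml; apply/andP; split.
  rewrite -[leLHS](RintegralP_cst g); apply: prior_le => //; first exact: integrableR_cst.
  by move=> x /h; rewrite ler_norml => /andP[].
rewrite -[leRHS](RintegralP_cst g); apply: prior_le => //; first exact: integrableR_cst.
by move=> x /h; rewrite ler_norml => /andP[].
Qed.

Lemma itv_norm (x : R) : (- M <= x <= M) = (`|x| <= M).
Proof. by rewrite ler_norml. Qed.

Lemma mean_le (g : prior M) : `|mean g| <= M.
Proof. by apply: prior_norm_le => // x; rewrite itv_norm. Qed.

Lemma itv_center (g : prior M) x : - M <= x <= M -> `|x - mean g| <= 2 * M.
Proof.
rewrite itv_norm => hx; apply: le_trans (ler_normB _ _) _; have := mean_le g; lra.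
Qed.

Lemma prior_integrable_id (g : prior M) : g.-integrable setT (EFin \o (id : R -> R)).
Proof. by apply: (@prior_integrable _ _ g (id : R -> R) M) => // x; rewrite itv_norm. Qed.

Lemma prior_integrable_center (g : prior M) t :
  g.-integrable setT (EFin \o (fun x : R => t * (x - mean g))).
Proof.
apply: integrableRZ; apply: integrableRB; [exact: prior_integrable_id|exact: integrableR_cst].
Qed.

Lemma prior_integrable_var (g : prior M) m : g.-integrable setT (EFin \o (fun x : R => (x - m) ^+ 2)).
Proof.
apply: (@prior_integrable _ _ g _ ((M + `|m|) ^+ 2)).
  by apply: measurable_funX; exact: measurable_funB.
move=> x; rewrite itv_norm => hx; rewrite normrX.
rewrite ler_pXn2r ?nnegrE ?addr_ge0 ?(ltW M0)//.
by apply: le_trans (ler_normB _ _) _; exact: lerD.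
Qed.

Lemma var_ge0 (g : prior M) : 0 <= var g.
Proof. by apply: Rintegral_ge0 => x _; exact: sqr_ge0. Qed.

Lemma var_le (g : prior M) : var g <= 4 * M ^+ 2.
Proof.
rewrite -[leLHS]ger0_norm ?var_ge0//; apply: prior_norm_le.
  by apply: measurable_funX; exact: measurable_funB.
move=> x /(itv_center g) h; rewrite normrX (_ : 4 * M ^+ 2 = (2 * M) ^+ 2); last by ring.
by rewrite ler_pXn2r ?nnegrE// mulr_ge0// ltW.
Qed.

Lemma center0 (g : prior M) t : \int[g]_x (t * (x - mean g)) = 0.
Proof.
rewrite RintegralZl//; last first.
  by apply: integrableRB; [exact: prior_integrable_id|exact: integrableR_cst].
by rewrite RintegralB ?RintegralP_cst ?subrr ?mulr0//; [exact: prior_integrable_id|exact: integrableR_cst].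
Qed.

Definition ccf (g : prior M) (t : R) : R[i] := ecis g (fun x => t * (x - mean g)).

Lemma cf_ccf (g : prior M) t : cf g t = ccf g t * cis (t * mean g).
Proof.
rewrite /ccf -ecisD//; congr (ecis _ _); apply/funext => x; ring.
Qed.

Lemma normc_ccf (g : prior M) t : normc (ccf g t) <= 1.
Proof. exact: normc_ecis. Qed.

Lemma normc_cf (g : prior M) t : normc (cf g t) <= 1.
Proof. by apply: normc_ecis; exact: measurable_funM. Qed.

Lemma cube_le (g : prior M) t x : - M <= x <= M ->
  `|t * (x - mean g)| ^+ 3 / 6 <= 4 / 3 * M ^+ 3 * `|t| ^+ 3.
Proof.
move=> /(itv_center g) h; rewrite normrM exprMn.
have : `|x - mean g| ^+ 3 <= (2 * M) ^+ 3.
  by rewrite ler_pXn2r ?nnegrE// mulr_ge0// ltW.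
have := exprn_ge0 3 (normr_ge0 t) => h0 h1; have := ler_wpM2l h0 h1; lra.
Qed.

(** Centring removes the first-order term. *)
Lemma ccf_expansion (g : prior M) t :
  normc (ccf g t - (1 - t ^+ 2 * var g / 2)%:C) <= 3 * M ^+ 3 * `|t| ^+ 3.
Proof.
apply: le_trans (normc_le_l1 _) _.
have ic := integrable_cosC g (maff t (mean g)).
have is_ := integrable_sinC g (maff t (mean g)).
have iv := prior_integrable_var g (mean g).
have il := prior_integrable_center g t.
have reE : Re (ccf g t - (1 - t ^+ 2 * var g / 2)%:C) =
   \int[g]_x (cos (t * (x - mean g)) - (1 - (t * (x - mean g)) ^+ 2 / 2)).
  have iq : g.-integrable setT (EFin \o (fun x => t ^+ 2 / 2 * (x - mean g) ^+ 2)).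
    exact: integrableRZ.
  have iq1 : g.-integrable setT (EFin \o (fun x => 1 - t ^+ 2 / 2 * (x - mean g) ^+ 2)).
    by apply: integrableRB => //; exact: integrableR_cst.
  transitivity (\int[g]_x (cos (t * (x - mean g)) - (1 - t ^+ 2 / 2 * (x - mean g) ^+ 2))).
    rewrite RintegralB// RintegralB//; last exact: integrableR_cst.
    rewrite RintegralP_cst RintegralZl// -/(var g) /=.
    by rewrite (_ : t ^+ 2 * var g / 2 = t ^+ 2 / 2 * var g)//; ring.
  by apply: eq_Rintegral => x _; rewrite exprMn; congr (_ - (_ - _)); ring.
have imE : Im (ccf g t - (1 - t ^+ 2 * var g / 2)%:C) =
   \int[g]_x (sin (t * (x - mean g)) - t * (x - mean g)).
  by rewrite RintegralB// center0 subr0 /= oppr0 addr0.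
rewrite reE imE.
have b1 : `|\int[g]_x (cos (t * (x - mean g)) - (1 - (t * (x - mean g)) ^+ 2 / 2))| <=
   4 / 3 * M ^+ 3 * `|t| ^+ 3.
  apply: prior_norm_le.
    apply: measurable_funB; first exact: measurable_cosC.
    by apply: measurable_funB => //; apply: measurable_funM => //; exact: measurable_funX.
  by move=> x hx; apply: le_trans (cosB_le3 _) (cube_le _ _ hx).
have b2 : `|\int[g]_x (sin (t * (x - mean g)) - t * (x - mean g))| <= 4 / 3 * M ^+ 3 * `|t| ^+ 3.
  apply: prior_norm_le; first by apply: measurable_funB => //; exact: measurable_sinC.
  by move=> x hx; apply: le_trans (sinB_le3 _) (cube_le _ _ hx).
apply: le_trans (lerD b1 b2) _.
have : 0 <= M ^+ 3 * `|t| ^+ 3 by rewrite mulr_ge0// ?exprn_ge0// ltW.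
move: (M ^+ 3) (`|t| ^+ 3) => a b; lra.
Qed.

Lemma ccf_close (g h : prior M) t :
  normc (ccf g t - ccf h t) <= t ^+ 2 * `|var g - var h| + 6 * M ^+ 3 * `|t| ^+ 3.
Proof.
set a := (1 - t ^+ 2 * var g / 2)%:C; set b := (1 - t ^+ 2 * var h / 2)%:C.
have -> : ccf g t - ccf h t = (ccf g t - a) - (ccf h t - b) + (a - b) by ring.
apply: le_trans (normcD _ _) _.
have h1 := le_trans (normcB _ _) (lerD (ccf_expansion g t) (ccf_expansion h t)).
have h2 : normc (a - b) <= t ^+ 2 * `|var g - var h|.
  rewrite /a /b -rmorphB normc_real distrC.
  rewrite (_ : _ - _ = (t ^+ 2 / 2) * (var g - var h)); last by ring.
  rewrite normrM ger0_norm ?divr_ge0 ?sqr_ge0//; apply: ler_wpM2r => //.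
  by have := sqr_ge0 t; lra.
move: h1; rewrite -/a -/b => h1; have := lerD h1 h2; lra.
Qed.

Lemma cis_lip u v : normc (cis u - cis v) <= 2 * `|u - v|.
Proof.
apply: le_trans (normc_le_l1 _) _; have := cos_lip u v; have := sin_lip u v => /=; lra.
Qed.

Lemma cf_lip (g : prior M) t u : normc (cf g t - cf g u) <= 2 * M * `|t - u|.
Proof.
have mt v : measurable_fun setT (fun x : R => v * x) by exact: measurable_funM.
have ic v := integrable_cosC g (mt v); have is_ v := integrable_sinC g (mt v).
apply: le_trans (normc_le_l1 _) _.
have bnd x : - M <= x <= M -> `|t * x - u * x| <= M * `|t - u|.
  by rewrite itv_norm => hx; rewrite -mulrBl normrM mulrC ler_wpM2r.
have b1 : `|Re (cf g t - cf g u)| <= M * `|t - u|.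
  rewrite (_ : Re _ = \int[g]_x (cos (t * x) - cos (u * x))); last by rewrite RintegralB.
  apply: prior_norm_le; first by apply: measurable_funB; exact: measurable_cosC.
  by move=> x /bnd; apply: le_trans; exact: cos_lip.
have b2 : `|Im (cf g t - cf g u)| <= M * `|t - u|.
  rewrite (_ : Im _ = \int[g]_x (sin (t * x) - sin (u * x))); last by rewrite RintegralB.
  apply: prior_norm_le; first by apply: measurable_funB; exact: measurable_sinC.
  by move=> x /bnd; apply: le_trans; exact: sin_lip.
have := lerD b1 b2; lra.
Qed.

Section products.
Import ComplexField.
Local Open Scope complex_scope.
Variables (I : finType) (P : pred I) (t : I -> R).

Lemma prod_cf (g : prior M) :
  \prod_(k | P k) cf g (t k) = \prod_(k | P k) ccf g (t k) * cis (mean g * \sum_(k | P k) t k).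
Proof.
under eq_bigr do rewrite cf_ccf.
rewrite big_split /=; congr (_ * _).
rewrite mulr_sumr (big_morph cis cisD cis0).
by apply: eq_bigr => k _; rewrite mulrC.
Qed.

(** Lindeberg's comparison.  A centred factor depends on the prior, up to third
    order, only through the variance, and the centring contributes the phase of
    the mean times the sum of the [t k].  Centring first is essential: in the
    application this sum is bounded, but the sum of the moduli is not. *)
Lemma prod_cf_close (g h : prior M) :
  normc (\prod_(k | P k) cf g (t k) - \prod_(k | P k) cf h (t k)) <=
  2 * `|mean g - mean h| * `|\sum_(k | P k) t k| +
  `|var g - var h| * (\sum_(k | P k) t k ^+ 2) + 6 * M ^+ 3 * \sum_(k | P k) `|t k| ^+ 3.
Proof.
rewrite !prod_cf; set S := \sum_(k | P k) t k.
have [a1 b1 c1] := normc_prodB P (fun k => normc_ccf g (t k)) (fun k => normc_ccf h (t k)).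
set A := \prod_(k | P k) ccf g (t k) in a1 c1 *; set B := \prod_(k | P k) ccf h (t k) in b1 c1 *.
have -> : A * cis (mean g * S) - B * cis (mean h * S) =
  A * (cis (mean g * S) - cis (mean h * S)) + (A - B) * cis (mean h * S) by ring.
apply: le_trans (normcD _ _) _; rewrite !normc_mul normc_cis mulr1 -addrA; apply: lerD.
  apply: (@le_trans _ _ (normc (cis (mean g * S) - cis (mean h * S)))).
    by apply: ler_piMl => //; exact: normc_ge0.
  by apply: le_trans (cis_lip _ _) _; rewrite -mulrBl normrM mulrA.
apply: le_trans c1 _; rewrite !mulr_sumr -big_split /=; apply: ler_sum => k _.
by rewrite (mulrC `|var g - var h|); exact: ccf_close.
Qed.

Lemma Re_ccf_ge (g : prior M) u : 1 - 2 * M ^+ 2 * u ^+ 2 <= Re (ccf g u).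
Proof.
rewrite -[leLHS](RintegralP_cst g) /=; apply: prior_le.
- exact: integrableR_cst.
- exact: integrable_cosC.
move=> x /(itv_center g) hx.
have := cosB1_le (u * (x - mean g)); rewrite ler_norml => /andP[h _].
have : (x - mean g) ^+ 2 <= (2 * M) ^+ 2.
  by rewrite -(real_normK (num_real (x - mean g))) ler_pXn2r ?nnegrE// mulr_ge0// ltW.
move=> h2; have := ler_wpM2l (sqr_ge0 u) h2; rewrite -exprMn; lra.
Qed.

Lemma expR_le1B (x : R) : 0 <= x <= 2^-1 -> expR (- (2 * x)) <= 1 - x.
Proof.
move=> /andP[x0 x1]; rewrite expRN -div1r ler_pdivrMr ?expR_gt0//.
have h := expR_ge1Dx (2 * x).
have h1 : 0 <= 1 - x by lra.
apply: le_trans (ler_wpM2l h1 h); nra.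
Qed.

(** The phase drops out, and each centred factor is at least [1 - O (t^2)]. *)
Lemma prod_cf_lower (g : prior M) :
  (forall k, P k -> 2 * M ^+ 2 * t k ^+ 2 <= 2^-1) ->
  expR (- (4 * M ^+ 2 * \sum_(k | P k) t k ^+ 2)) <= normc (\prod_(k | P k) cf g (t k)).
Proof.
move=> ht; rewrite prod_cf normc_mul normc_cis mulr1 normc_prod mulr_sumr -sumrN expR_sum.
apply: ler_prod => k Pk; rewrite expR_ge0 /=.
apply: le_trans (le_trans (Re_ccf_ge g (t k)) (le_trans (ler_norm _) (Re_le_normc _))).
have -> : 4 * M ^+ 2 * t k ^+ 2 = 2 * (2 * M ^+ 2 * t k ^+ 2) by ring.
by apply: expR_le1B; rewrite ht// andbT mulr_ge0 ?sqr_ge0// mulr_ge0 ?sqr_ge0.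
Qed.

End products.

End prior_cf.

(** * First and second moments of linear forms *)

Section power_moments.
Context {R : realType} (mu : probability R R).
Hypothesis emu : expmom mu.

Let m := \int[mu]_x x.
Let v := \int[mu]_x (x - m) ^+ 2.

Let mid : measurable_fun setT (id : R -> R).
Proof. exact: measurable_id. Qed.

Lemma expmom_dominated (f : R -> R) (C t : R) : measurable_fun setT f ->
  (forall x, `|f x| <= C * expR (t * `|x|)) -> mu.-integrable setT (EFin \o f).
Proof.
move=> mf hf; apply: (@integrable_dominated _ _ _ _ f (fun x => C * expR (t * `|x|))) => //.
by apply: integrableRZ; exact: emu.
Qed.

Lemma expmom_id : mu.-integrable setT (EFin \o (id : R -> R)).
Proof.
by apply: (@expmom_dominated _ 1 1) => // x; rewrite !mul1r; exact: le_expRabs.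
Qed.

Lemma expmom_sqr (c : R) : mu.-integrable setT (EFin \o (fun x => (x - c) ^+ 2)).
Proof.
apply: (@expmom_dominated _ (8 * expR `|c|) 1).
  by apply: measurable_funX; exact: measurable_funB.
move=> x; rewrite mul1r ger0_norm ?sqr_ge0//; apply: le_trans (sqr_le_expRabs _) _.
by rewrite -mulrA ler_pM2l// -expRD ler_expR [leRHS]addrC; exact: ler_normB.
Qed.

Lemma affine_sqr (c d : R) : \int[mu]_x (c * x + d) ^+ 2 = v * c ^+ 2 + (m * c + d) ^+ 2.
Proof.
have e x : (c * x + d) ^+ 2 = c ^+ 2 * (x - m) ^+ 2 + (2 * c * (c * m + d) * (x - m) + (c * m + d) ^+ 2).
  by ring.
under eq_Rintegral do rewrite e.
have i1 := expmom_sqr m; have i2 := expmom_id.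
have i3 : mu.-integrable setT (EFin \o (fun x => x - m)).
  by apply: integrableRB => //; exact: integrableR_cst.
rewrite RintegralD//; [|exact: integrableRZ|by apply: integrableRD; [exact: integrableRZ|exact: integrableR_cst]].
rewrite RintegralD//; [|exact: integrableRZ|exact: integrableR_cst].
have h0 : \int[mu]_x (x - m) = 0.
  by rewrite RintegralB//; [rewrite RintegralP_cst subrr|exact: integrableR_cst].
rewrite [X in X + (_ + _)](_ : _ = c ^+ 2 * v); last by rewrite RintegralZl.
rewrite [X in _ + (X + _)](_ : _ = 2 * c * (c * m + d) * 0); last by rewrite -h0 RintegralZl.
rewrite RintegralP_cst; ring.
Qed.

Lemma loglip_lin n (w : 'I_n -> R) (b : R) :
  loglip (\sum_i `|w i|) (fun x : n.-tuple R => expR (lin w x + b)).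
Proof.
split.
- by apply: measurableT_comp => //; apply: measurable_funD => //; exact: measurable_lin.
- by move=> x; exact: expR_gt0.
move=> x y; rewrite -expRD ler_expR addrA lerD2r -lerBlDr /lin -sumrB.
rewrite /l1dist mulr_sumr; apply: ler_sum => i _; rewrite -mulrBr.
apply: le_trans (ler_norm _) _; rewrite normrM; apply: ler_wpM2r => //.
by rewrite (bigD1 i)//= lerDl; exact: sumr_ge0.
Qed.

Lemma integrable_lin_sqr n (w : 'I_n -> R) (b : R) :
  (power_prob mu n).-integrable setT (EFin \o (fun x => (lin w x + b) ^+ 2)).
Proof.
have ml := @measurable_lin R n w.
apply: (@integrable_dominated _ _ _ _ _ (fun x : n.-tuple R => 4 * (expR (lin w x + b) +
   expR (lin (fun i => - w i) x + (- b))))).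
- by apply: measurable_funX; exact: measurable_funD.
- apply: integrableRZ; apply: integrableRD.
    exact: loglip_integrable emu (loglip_lin w b).
  exact: loglip_integrable emu (loglip_lin (fun i => - w i) (- b)).
move=> x; rewrite ger0_norm ?sqr_ge0//; apply: le_trans (sqr_le_cosh _) _.
rewrite ler_pM2l// (_ : lin (fun i => - w i) x = - lin w x); last first.
  by rewrite /lin -sumrN; apply: eq_bigr => i _; rewrite mulNr.
by rewrite -opprD lerBlDr lerDl.
Qed.

Lemma power_lin_sqr n (w : 'I_n -> R) (b : R) :
  \int[power_prob mu n]_x (lin w x + b) ^+ 2 =
  v * (\sum_i w i ^+ 2) + (m * (\sum_i w i) + b) ^+ 2.
Proof.
elim: n => [|n IH] in w b *.
  by rewrite integral_power0 /lin !big_ord0 !mulr0 !add0r.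
rewrite (Rintegral_powerS (integrable_lin_sqr w b)) !big_ord_recl.
set w' := fun i => w (lift ord0 i).
have e u : \int[power_prob mu n]_x (lin w (tcons u x) + b) ^+ 2 =
    v * (\sum_i w' i ^+ 2) + (w ord0 * u + (m * (\sum_i w' i) + b)) ^+ 2.
  rewrite addrA [w ord0 * u + _]addrC -addrA -IH; apply: eq_Rintegral => x _.
  by rewrite lin_tcons; congr (_ ^+ 2); rewrite -/w'; ring.
under eq_Rintegral do rewrite e.
rewrite RintegralD//; [|exact: integrableR_cst|]; last first.
  have [c0|c0] := eqVneq (w ord0) 0.
    by rewrite c0; under eq_fun do rewrite mul0r; exact: integrableR_cst.
  set d := _ + b.
  rewrite (_ : (fun x => _) = (fun x => w ord0 ^+ 2 * (x - (- (d / w ord0))) ^+ 2)).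
    by apply: integrableRZ; exact: expmom_sqr.
  by apply/funext => x; field.
by rewrite RintegralP_cst affine_sqr; ring.
Qed.

(** Polarization of [power_lin_sqr]. *)
Lemma power_lin n (w : 'I_n -> R) : 
  (power_prob mu n).-integrable setT (EFin \o lin w) /\
  \int[power_prob mu n]_x lin w x = m * (\sum_i w i).
Proof.
have i1 := integrable_lin_sqr w 1; have i2 := integrable_lin_sqr w (- 1).
have e : lin w = (fun x => 4^-1 * ((lin w x + 1) ^+ 2 - (lin w x + (- 1)) ^+ 2)).
  by apply/funext => x; field.
split; rewrite e; first by apply: integrableRZ; exact: integrableRB.
rewrite RintegralZl//; last exact: integrableRB.
by rewrite RintegralB// !power_lin_sqr; field.
Qed.

End power_moments.

Section gauss_variance.
Context {R : realType}.

(** A crude bound of the right order suffices for the estimates below. *)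
Lemma gauss_var_le (s : R) : 0 < s -> \int[gauss s]_x (x - \int[gauss s]_x x) ^+ 2 <= 8 * expR 2^-1 * s ^+ 2.
Proof.
move=> sp; have s0 : s != 0 by rewrite gt_eqF.
rewrite gauss_mean//; under eq_Rintegral do rewrite subr0.
have iq := expmom_sqr (expmom_gauss s0) 0.
have ie (t : R) : (gauss s).-integrable setT (EFin \o (fun x => expR (t * x))).
  apply: (@expmom_dominated _ _ (expmom_gauss s0) _ 1 `|t|).
    by apply: measurableT_comp => //; exact: measurable_funM.
  by move=> x; rewrite mul1r ger0_norm ?expR_ge0// ler_expR -normrM ler_norm.
have mgf (t : R) : \int[gauss s]_x expR (t * x) = expR (t ^+ 2 * s ^+ 2 / 2).
  by rewrite /Rintegral gauss_expRM.
apply: (@le_trans _ _ (\int[gauss s]_x (4 * s ^+ 2 * (expR (s^-1 * x) + expR (- s^-1 * x))))).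
  apply: le_Rintegral => //.
  - by move: iq; congr (_.-integrable _ _); apply/funext => x /=; rewrite subr0.
  - by apply: integrableRZ; exact: integrableRD.
  move=> x _; have := sqr_le_cosh (s^-1 * x).
  rewrite exprMn exprVn ler_pdivrMl ?exprn_gt0// mulNr => h; apply: le_trans h _.
  rewrite mulrCA mulrA ler_pM2l ?mulr_gt0 ?exprn_gt0//.
  by rewrite lerBlDr lerDl.
rewrite RintegralZl//; last exact: integrableRD.
rewrite RintegralD// !mgf sqrrN.
have -> : s^-1 ^+ 2 * s ^+ 2 / 2 = 2^-1 by field.
by apply: le_of_eq; ring.
Qed.

End gauss_variance.

Section joint_moments.
Context {R : realType} {M : R}.
Variables (n p : nat) (X : 'M[R]_(n, p)) (s : R).
Hypothesis s_gt0 : 0 < s.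

Let s0 : s != 0. Proof. by rewrite gt_eqF. Qed.
Let gv := \int[gauss s]_x (x - \int[gauss s]_x x) ^+ 2.

Lemma mtest_dotv (z : 'cV[R]_n) : mtest (dotv z).
Proof.
rewrite /mtest (_ : (fun x => _) = lin (fun i => z i 0)); first exact: measurable_lin.
by apply/funext => x; exact: lin_tcol.
Qed.

Lemma lipschitz_dotv (z : 'cV[R]_n) : lipschitz (l2norm z) (dotv z).
Proof. by move=> y y'; rewrite -dotvBr; exact: cauchy_schwarz. Qed.

Lemma integrable_dotv_sqr (g : prior M) (z : 'cV[R]_n) :
  (joint n p s g).-integrable setT (EFin \o (fun zz => dotv z (obs X zz) ^+ 2)).
Proof.
have im c := integrable_mgf X s_gt0 (l2norm_ge0 z) (mtest_dotv z) (lipschitz_dotv z) g c.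
apply: (@integrable_dominated _ _ _ _ _ (fun zz => 4 * (expR (1 * dotv z (obs X zz)) + expR (-1 * dotv z (obs X zz))))).
- by apply: measurable_funX; apply: mtest_obs; exact: mtest_dotv.
- by apply: integrableRZ; exact: integrableRD.
move=> zz; rewrite ger0_norm ?sqr_ge0//; apply: le_trans (sqr_le_cosh _) _.
by rewrite mul1r mulN1r ler_pM2l// lerBlDr lerDl.
Qed.

Lemma joint_dotv_sqr (g : prior M) (z : 'cV[R]_n) :
  \int[joint n p s g]_zz dotv z (obs X zz) ^+ 2 =
  gv * l2norm z ^+ 2 + var g * (\sum_k dotv z (col k X) ^+ 2)
  + (mean g * \sum_k dotv z (col k X)) ^+ 2.
Proof.
rewrite /joint (Rintegral_prod (integrable_dotv_sqr g z)).
have eg := expmom_prior g; have es := expmom_gauss s0.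
set a := fun k => dotv z (col k X).
have e th : \int[power_prob (gauss s) n]_x dotv z (obs X (th, x)) ^+ 2 =
   gv * l2norm z ^+ 2 + (lin a th + 0) ^+ 2.
  transitivity (\int[power_prob (gauss s) n]_x (lin (fun i => z i 0) x + lin a th) ^+ 2).
    by apply: eq_Rintegral => x _; rewrite dotv_obs addrC.
  by rewrite (power_lin_sqr es) /gv gauss_mean// mul0r add0r addr0 l2norm_sqr.
under eq_Rintegral do rewrite e.
rewrite RintegralD//; [|exact: integrableR_cst|exact: integrable_lin_sqr].
by rewrite RintegralP_cst (power_lin_sqr eg) addr0 -addrA.
Qed.

Lemma joint_dotv (g : prior M) (z : 'cV[R]_n) :
  \int[joint n p s g]_zz dotv z (obs X zz) = mean g * \sum_k dotv z (col k X).
Proof.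
have eg := expmom_prior g; have es := expmom_gauss s0.
rewrite /joint (Rintegral_prod (integrable_test X s_gt0 (l2norm_ge0 z) (mtest_dotv z) (lipschitz_dotv z) g)).
set a := fun k => dotv z (col k X).
have [iz ez] := power_lin es (fun i => z i 0); have [ia ea] := power_lin eg a.
have e th : \int[power_prob (gauss s) n]_x dotv z (obs X (th, x)) = lin a th.
  transitivity (\int[power_prob (gauss s) n]_x (lin (fun i => z i 0) x + lin a th)).
    by apply: eq_Rintegral => x _; rewrite dotv_obs addrC.
  rewrite RintegralD//; last exact: integrableR_cst.
  by rewrite ez gauss_mean// mul0r add0r RintegralP_cst.
under eq_Rintegral do rewrite e.
exact: ea.
Qed.

Lemma sum_dotv_col (z : 'cV[R]_n) : \sum_k dotv z (col k X) = dotv z (X *m ones p).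
Proof.
rewrite dotv_mul dotvE; apply: eq_bigr => k _.
by rewrite trmul_entry mxE mulr1.
Qed.

Lemma sum_sqr_dotv_col (z : 'cV[R]_n) : \sum_k dotv z (col k X) ^+ 2 = l2norm (X^T *m z) ^+ 2.
Proof. by rewrite l2norm_sqr; apply: eq_bigr => k _; rewrite trmul_entry. Qed.

(** The squared Frobenius norm of the Gram matrix [X^T X]. *)
Definition gram2 : R := \sum_l l2norm (X^T *m col l X) ^+ 2.

Lemma joint_trmul_sqr (g : prior M) :
  (joint n p s g).-integrable setT (EFin \o (fun zz => l2norm (X^T *m obs X zz) ^+ 2)) /\
  \int[joint n p s g]_zz l2norm (X^T *m obs X zz) ^+ 2 =
  gv * Fnorm X ^+ 2 + var g * gram2 + mean g ^+ 2 * l2norm (X^T *m (X *m ones p)) ^+ 2.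
Proof.
have e zz : l2norm (X^T *m obs X zz) ^+ 2 = \sum_l dotv (col l X) (obs X zz) ^+ 2.
  by rewrite l2norm_sqr; apply: eq_bigr => l _; rewrite trmul_entry dotvC.
have [H1 H2] := Rintegral_sum (index_enum 'I_p) (fun l => integrable_dotv_sqr g (col l X)).
split; first by under eq_fun do rewrite e; exact: H1.
under eq_Rintegral do rewrite e.
rewrite H2; under eq_bigr do rewrite joint_dotv_sqr sum_sqr_dotv_col sum_dotv_col.
rewrite !big_split /= Fnorm_sqr /gram2 !mulr_sumr; congr (_ + _ + _).
rewrite l2norm_sqr mulr_sumr; apply: eq_bigr => l _.
by rewrite trmul_entry exprMn [dotv (col _ _) _]dotvC.
Qed.

End joint_moments.

(** * The separating statistics *)

Section design.
Import ComplexField.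
Local Open Scope complex_scope.
Context {R : realType}.
Variables Cs cs : R.
Hypotheses (Cs0 : 0 < Cs) (cs0 : 0 < cs).

(** The assumption on the design for one sample size, with the limits replaced by
    a tolerance [r].  The condition on the powers [2 + beta] enters through
    the uniform bound of the entries off the diagonal. *)
Record design (r : R) n p (X : 'M[R]_(n, p)) (s : R) (S : {set 'I_p})
    (z : 'I_p -> 'cV[R]_n) : Prop := Design {
  design_p : (0 < p)%N ;
  design_s : 0 < s ;
  design_noise_ge : cs * opnorm X ^+ 2 <= s ^+ 2 ;
  design_noise_le : s ^+ 2 <= Cs / p%:R * Fnorm X ^+ 2 ;
  design_ones : cs * opnorm X ^+ 2 <= p%:R^-1 * l2norm (X *m ones p) ^+ 2 ;
  design_card : cs * p%:R <= #|S|%:R ;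
  design_z : forall j, j \in S -> opnorm X * l2norm (z j) <= Cs ;
  design_z1 : forall j, j \in S -> `|dotv (z j) (X *m ones p)| <= Cs ;
  design_diag : forall j, j \in S -> `|dotv (z j) (col j X) - 1| <= r ;
  design_off : forall j k, j \in S -> k != j -> `|dotv (z j) (col k X)| <= r ;
  design_sum : forall a : 'I_p -> R, (forall j, j \in S -> `|a j| <= 1) ->
     opnorm X ^+ 2 * l2norm (\sum_(j in S) a j *: z j) ^+ 2 <= Cs * p%:R ;
  design_size : (Num.sqrt p%:R)^-1 <= r }.

Section facts.
Import ComplexField.
Local Open Scope complex_scope.
Variables (r : R) (n p : nat) (X : 'M[R]_(n, p)) (s : R) (S : {set 'I_p}) (z : 'I_p -> 'cV[R]_n).
Hypothesis hD : design r X s S z.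
Let N := opnorm X.
Let q : R := p%:R.
Let w : R := Num.sqrt q.

Lemma design_q : 0 < q.
Proof. by rewrite ltr0n; exact: design_p hD. Qed.

Lemma design_w : 0 < w /\ w ^+ 2 = q.
Proof. by rewrite sqrtr_gt0 design_q sqr_sqrtr// ltW ?design_q. Qed.

Lemma design_N : 0 < N.
Proof.
have s0 := design_s hD; have q0 := design_q.
rewrite lt_neqAle opnorm_ge0 andbT eq_sym; apply/eqP => N0.
have := Fnorm_le X; rewrite -/N N0 expr0n mulr0 => F0.
have := design_noise_le hD; have := exprn_gt0 2 s0.
have c0 : 0 <= Cs / p%:R by rewrite divr_ge0// ltW.
by have := ler_wpM2l c0 F0; rewrite mulr0; lra.
Qed.

Lemma design_s2_le : s ^+ 2 <= Cs * N ^+ 2.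
Proof.
have q0 := design_q; apply: le_trans (design_noise_le hD) _.
rewrite -mulrA ler_pM2l// ler_pdivrMl//; exact: Fnorm_le.
Qed.

Lemma ones_norm : l2norm (ones p : 'cV[R]_p) = w.
Proof.
rewrite /l2norm; congr Num.sqrt; rewrite (eq_bigr (fun=> 1)); last first.
  by move=> i _; rewrite mxE expr1n.
by rewrite sumr_const card_ord.
Qed.

Lemma X1_le : l2norm (X *m ones p) <= N * w.
Proof. by rewrite -ones_norm; exact: l2norm_mul. Qed.

Definition stat_scale (L : R) := L / (w * N).

Lemma good_statP (L : R) T : 0 <= L -> mtest T -> lipschitz (stat_scale L) T ->
  good_stat (L ^+ 2 * (1 + Cs)) X s T (stat_scale L).
Proof.
move=> L0 mT lT; have [w0 w2] := design_w; have N0 := design_N.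
have sN := design_s2_le.
split => //.
- by rewrite divr_ge0// mulr_ge0// ltW.
- rewrite -/N -/q -w2 /stat_scale (_ : _ * _ = L ^+ 2); last by field; rewrite !gt_eqF.
  by rewrite mulrDr mulr1 lerDl mulr_ge0 ?sqr_ge0// ltW.
rewrite -/q -w2 /stat_scale (_ : _ * _ = L ^+ 2 * (s ^+ 2 / N ^+ 2)); last by field; rewrite !gt_eqF.
apply: ler_wpM2l; first exact: sqr_ge0.
by rewrite ler_pdivrMr ?exprn_gt0//; apply: le_trans sN _; rewrite mulrDl mul1r lerDr sqr_ge0.
Qed.

Lemma lipschitzW m (l l' : R) (T : 'cV[R]_m -> R) : l <= l' -> lipschitz l T -> lipschitz l' T.
Proof.
by move=> ll lT y y'; apply: le_trans (lT y y') _; apply: ler_wpM2r => //; exact: l2norm_ge0.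
Qed.

Lemma stat_scale_le (L L' : R) : L <= L' -> stat_scale L <= stat_scale L'.
Proof.
move=> LL; have [w0 w2] := design_w; have N0 := design_N.
by rewrite /stat_scale ler_pM2r// invr_gt0 mulr_gt0.
Qed.

(** Its mean is the mean of the prior times a constant bounded away from 0. *)
Definition mean_stat (y : 'cV[R]_n) : R := (q * N ^+ 2)^-1 * dotv (X *m ones p) y.
(** The mean of its square is affine in the variance and the squared mean of the
    prior. *)
Definition energy_stat (y : 'cV[R]_n) : R := (w * N ^+ 2)^-1 * l2norm (X^T *m y).
(** Its mean reads the characteristic function of the prior at [tau], after the
    coefficients [c] have undone the contribution of the other coordinates. *)
Definition phase_stat (tau : R) (c : 'I_p -> R[i]) (y : 'cV[R]_n) : R :=
  q^-1 * \sum_(j in S) Re (cis (tau * dotv (z j) y) * c j).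

Lemma mtest_mean_stat : mtest mean_stat.
Proof. by apply: measurable_funM => //; exact: mtest_dotv. Qed.

Lemma mtest_trmul : mtest (fun y : 'cV[R]_n => l2norm (X^T *m y)).
Proof.
rewrite /mtest (_ : (fun y => _) = fun x : n.-tuple R => Num.sqrt (\sum_k dotv (col k X) (tcol x) ^+ 2)).
  apply: measurableT_comp; first exact: (continuous_measurable_fun (@sqrt_continuous R)).
  by apply: measurable_sum => k; apply: measurable_funX; exact: mtest_dotv.
by apply/funext => x; congr Num.sqrt; apply: eq_bigr => k _; rewrite trmul_entry dotvC.
Qed.

Lemma mtest_energy_stat : mtest energy_stat.
Proof. by apply: measurable_funM => //; exact: mtest_trmul. Qed.

Lemma mtest_phase_stat tau c : mtest (phase_stat tau c).
Proof.
apply: measurable_funM => //.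
rewrite (_ : (fun x => _) = (fun x : n.-tuple R => \sum_(j <- enum S) Re (cis (tau * dotv (z j) (tcol x)) * c j))).
  apply: measurable_sum => j.
  under eq_fun do rewrite ReM /=.
  have md : measurable_fun setT (fun x : n.-tuple R => tau * dotv (z j) (tcol x)).
    by apply: measurable_funM => //; exact: mtest_dotv.
  by apply: measurable_funB; apply: measurable_funM => //; [exact: measurable_cosC|exact: measurable_sinC].
by apply/funext => x; rewrite big_enum.
Qed.

Lemma lipschitz_mean_stat : lipschitz (stat_scale 1) mean_stat.
Proof.
move=> y y'; have [w0 w2] := design_w; have N0 := design_N; have q0 := design_q.
rewrite /mean_stat -mulrBr -dotvBr normrM gtr0_norm ?invr_gt0 ?mulr_gt0 ?exprn_gt0//.
rewrite mulrC ler_pdivrMr ?mulr_gt0 ?exprn_gt0//.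
apply: le_trans (cauchy_schwarz _ _) _.
rewrite (_ : _ * _ * _ = N * w * l2norm (y - y')); last first.
  by rewrite /stat_scale -w2; field; rewrite !gt_eqF.
by apply: ler_wpM2r; [exact: l2norm_ge0|exact: X1_le].
Qed.

Lemma lipschitz_energy_stat : lipschitz (stat_scale 1) energy_stat.
Proof.
move=> y y'; have [w0 w2] := design_w; have N0 := design_N.
rewrite /energy_stat -mulrBr normrM gtr0_norm ?invr_gt0 ?mulr_gt0 ?exprn_gt0//.
rewrite mulrC ler_pdivrMr ?mulr_gt0 ?exprn_gt0//.
apply: le_trans (l2norm_dist _ _) _; rewrite -mulmxBr.
rewrite (_ : _ * _ * _ = N * l2norm (y - y')); last first.
  by rewrite /stat_scale; field; rewrite !gt_eqF.
exact: l2norm_trmul.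
Qed.

(** With the signs of [z_j . (y - y')] as coefficients, the sum of their moduli is
    the pairing of [y - y'] with a combination of the [z_j] whose norm the
    assumption bounds. *)
Lemma lipschitz_phase_stat tau c : (forall j, Normc.normc (c j) <= 1) ->
  lipschitz (stat_scale (2 * `|tau| * Num.sqrt Cs)) (phase_stat tau c).
Proof.
move=> hc y y'; have [w0 w2] := design_w; have N0 := design_N; have q0 := design_q.
rewrite /phase_stat -mulrBr -sumrB normrM gtr0_norm ?invr_gt0//.
rewrite ler_pdivrMl//.
pose a j : R := Num.sg (dotv (z j) (y - y')).
have h1 : `|\sum_(j in S) (Re (cis (tau * dotv (z j) y) * c j) - Re (cis (tau * dotv (z j) y') * c j))|
   <= 2 * `|tau| * dotv (\sum_(j in S) a j *: z j) (y - y').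
  apply: le_trans (ler_norm_sum _ _ _) _.
  rewrite dotvC dotv_sumr mulr_sumr; apply: ler_sum => j _.
  rewrite -raddfB -mulrBl; apply: le_trans (Re_le_normc _) _; rewrite normc_mul.
  apply: le_trans (ler_piMr (normc_ge0 _) (hc j)) _.
  apply: le_trans (cis_lip _ _) _; rewrite -mulrA ler_pM2l// -mulrBr normrM.
  apply: ler_wpM2l => //; rewrite -dotvBr dotvZr (dotvC (y - y')) /a.
  by rewrite -normrEsg.
apply: le_trans h1 _.
have h2 : l2norm (\sum_(j in S) a j *: z j) <= Num.sqrt Cs * w / N.
  rewrite ler_pdivlMr// mulrC -(@ler_pXn2r _ 2) ?nnegrE ?mulr_ge0 ?sqrtr_ge0 ?l2norm_ge0 ?(ltW N0)//.
  rewrite !exprMn w2 (sqr_sqrtr (ltW Cs0)). apply: (design_sum hD) => j _.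
  by rewrite /a normr_sg; case: (_ == _).
have h3 := le_trans (ler_norm _) (cauchy_schwarz (\sum_(j in S) a j *: z j) (y - y')).
have h4 := le_trans h3 (ler_wpM2r (l2norm_ge0 _) h2).
have t0 : 0 <= 2 * `|tau| by rewrite mulr_ge0.
apply: le_trans (ler_wpM2l t0 h4) _.
apply: le_of_eq; rewrite /stat_scale -w2.
by field; rewrite !gt_eqF.
Qed.

End facts.

End design.

(** * Mean and variance *)

Section identifiability.
Import ComplexField.
Local Open Scope complex_scope.
Context {R : realType} {M : R}.
Hypothesis M0 : 0 < M.
Variables Cs cs : R.
Hypotheses (Cs0 : 0 < Cs) (cs0 : 0 < cs).
Variables (r : R) (n p : nat) (X : 'M[R]_(n, p)) (s : R) (S : {set 'I_p}) (z : 'I_p -> 'cV[R]_n).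
Hypothesis hD : design Cs cs r X s S z.
Local Notation normc := (@Normc.normc R).
Let N := opnorm X.
Let q : R := p%:R.
Let w : R := Num.sqrt q.

Definition expect (g : prior M) (T : 'cV[R]_n -> R) : R := \int[joint n p s g]_zz T (obs X zz).

Lemma mean_gap (g h : prior M) :
  cs * `|mean g - mean h| <= `|expect g (mean_stat X) - expect h (mean_stat X)|.
Proof.
have q0 : 0 < q := design_q hD; have N0 : 0 < N := design_N Cs0 hD.
have e k : expect k (mean_stat X) = mean k * (l2norm (X *m ones p) ^+ 2 / (q * N ^+ 2)).
  rewrite /expect /mean_stat RintegralZl//; last first.
    exact: (integrable_test X (design_s hD) (l2norm_ge0 (X *m ones p)) (@mtest_dotv _ _ _) (@lipschitz_dotv _ _ _)).
  by rewrite (joint_dotv X (design_s hD)) sum_dotv_col dotvv; ring.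
rewrite !e -mulrBl normrM mulrC; apply: ler_wpM2l => //.
rewrite ger0_norm ?divr_ge0 ?sqr_ge0 ?mulr_ge0 ?(ltW q0) ?sqr_ge0//.
rewrite ler_pdivlMr ?mulr_gt0 ?exprn_gt0// mulrCA mulrC -ler_pdivlMr//.
by rewrite [leRHS]mulrC; exact: design_ones hD.
all: exact: ltW.
Qed.

(** The coefficient of the variance of the prior in [energy_stat_sqr]. *)
Definition kappa : R := gram2 X / (q * N ^+ 4).

Lemma gram2_le : gram2 X <= q * N ^+ 4.
Proof.
have N0 : 0 <= N := ltW (design_N Cs0 hD).
apply: (@le_trans _ _ (\sum_l N ^+ 2 * l2norm (col l X) ^+ 2)).
  apply: ler_sum => l _; rewrite -exprMn ler_pXn2r ?nnegrE ?mulr_ge0 ?l2norm_ge0//.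
  exact: l2norm_trmul.
rewrite -mulr_sumr -Fnorm_sqr (_ : q * N ^+ 4 = N ^+ 2 * (q * N ^+ 2)); last by ring.
by apply: ler_wpM2l; [exact: sqr_ge0 | exact: Fnorm_le].
Qed.

(** Keep the diagonal of the Gram matrix and apply the Cauchy-Schwarz inequality:
    [|X^T X|_F^2 >= |X|_F^4 / p], while [|X|_F^2] is of order at least
    [p |X|^2], because the noise level lies between the two norms. *)
Lemma kappa_ge : (cs / Cs) ^+ 2 <= kappa.
Proof.
have q0 : 0 < q := design_q hD; have N0 : 0 < N := design_N Cs0 hD.
have h1 : Fnorm X ^+ 4 <= q * gram2 X.
  pose f (l : 'I_p) : R := l2norm (col l X) ^+ 2.
  have f2 : (\sum_l f l) ^+ 2 <= q * \sum_l f l ^+ 2.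
    have := cauchy_schwarz (ones p : 'cV[R]_p) (\col_l f l).
    rewrite dotvE (eq_bigr f); last by move=> l _; rewrite !mxE mul1r.
    rewrite -(@ler_pXn2r _ 2) ?nnegrE ?mulr_ge0 ?l2norm_ge0//.
    rewrite exprMn (real_normK (num_real _)) !l2norm_sqr.
    have -> : \sum_i (ones p : 'cV[R]_p) i 0 ^+ 2 = q.
      rewrite (eq_bigr (fun=> 1)); first by rewrite sumr_const card_ord.
      by move=> l _; rewrite mxE expr1n.
    rewrite [X in _ <= _ * X](eq_bigr (fun l => f l ^+ 2))// => l _; by rewrite mxE.
  rewrite (_ : Fnorm X ^+ 4 = (Fnorm X ^+ 2) ^+ 2); last by ring.
  rewrite Fnorm_sqr; apply: le_trans f2 _; apply: ler_wpM2l; first exact: ltW.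
  apply: ler_sum => l _; rewrite /f -sum_sqr_dotv_col (bigD1 l)//= dotvv lerDl.
  by apply: sumr_ge0 => k _; exact: sqr_ge0.
have h2 : cs * N ^+ 2 <= Cs / q * Fnorm X ^+ 2.
  exact: le_trans (design_noise_ge hD) (design_noise_le hD).
have h3 : (cs / Cs * (q * N ^+ 2)) <= Fnorm X ^+ 2.
  rewrite -(@ler_pM2l _ (Cs / q)) ?divr_gt0//.
  by rewrite [leLHS](_ : _ = cs * N ^+ 2)//; field; rewrite !gt_eqF.
have h4 : (cs / Cs * (q * N ^+ 2)) ^+ 2 <= (Fnorm X ^+ 2) ^+ 2.
  rewrite ler_pXn2r ?nnegrE ?sqr_ge0//.
  by apply: mulr_ge0; [rewrite divr_ge0// ltW | rewrite mulr_ge0 ?sqr_ge0// ltW].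
rewrite /kappa ler_pdivlMr ?mulr_gt0 ?exprn_gt0// -(@ler_pM2l _ q)//.
apply: le_trans h1; apply: le_trans (le_trans h4 _).
  by apply: le_of_eq; ring.
by apply: le_of_eq; ring.
Qed.

Let gv := \int[gauss s]_x (x - \int[gauss s]_x x) ^+ 2.

(** The coefficient of the squared mean of the prior in [energy_stat_sqr]. *)
Definition ones2 : R := l2norm (X^T *m (X *m ones p)) ^+ 2 / (q * N ^+ 4).

Lemma ones2_le : 0 <= ones2 <= 1.
Proof.
have q0 : 0 < q := design_q hD; have N0 : 0 < N := design_N Cs0 hD; have [w0 w2] : 0 < w /\ w ^+ 2 = q by exact: design_w hD.
rewrite /ones2 divr_ge0 ?sqr_ge0 ?mulr_ge0 ?exprn_ge0 ?(ltW q0) ?(ltW N0)//=.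
rewrite ler_pdivrMr ?mulr_gt0 ?exprn_gt0// mul1r.
have h : l2norm (X^T *m (X *m ones p)) <= N * (N * w).
  apply: le_trans (l2norm_trmul _ _) _; apply: ler_wpM2l; first exact: ltW.
  exact: X1_le.
rewrite -w2 (_ : w ^+ 2 * N ^+ 4 = (N * (N * w)) ^+ 2); last by ring.
by rewrite ler_pXn2r ?nnegrE ?l2norm_ge0 ?mulr_ge0 ?(ltW N0) ?(ltW w0).
Qed.

Lemma energy_stat_sqr (g : prior M) :
  (joint n p s g).-integrable setT (EFin \o (fun zz => energy_stat X (obs X zz) ^+ 2)) /\
  expect g (fun y => energy_stat X y ^+ 2) =
  gv * Fnorm X ^+ 2 / (q * N ^+ 4) + var g * kappa + mean g ^+ 2 * ones2.
Proof.
have q0 : 0 < q := design_q hD; have N0 : 0 < N := design_N Cs0 hD; have [w0 w2] : 0 < w /\ w ^+ 2 = q by exact: design_w hD.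
have [i1 e1] := joint_trmul_sqr X (design_s hD) g.
have e zz : energy_stat X (obs X zz) ^+ 2 = (q * N ^+ 4)^-1 * l2norm (X^T *m obs X zz) ^+ 2.
  rewrite /energy_stat exprMn -/q -/w -/N -w2; congr (_ * _).
  by field; rewrite !gt_eqF.
split; first by under eq_fun do rewrite e; exact: integrableRZ.
rewrite /expect; under eq_Rintegral do rewrite e.
rewrite RintegralZl// e1 /kappa /ones2 -/gv.
by field; rewrite !gt_eqF.
Qed.

Let B := 2 + 8 * expR 2^-1 * Cs + 5 * M ^+ 2.

Lemma expect_energy_sqr_le (g : prior M) : expect g (fun y => energy_stat X y ^+ 2) <= B - 2.
Proof.
have q0 : 0 < q := design_q hD; have N0 : 0 < N := design_N Cs0 hD.
have [_ ->] := energy_stat_sqr g.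
have h1 : gv * Fnorm X ^+ 2 / (q * N ^+ 4) <= 8 * expR 2^-1 * Cs.
  rewrite ler_pdivrMr ?mulr_gt0 ?exprn_gt0//.
  have g1 : gv <= 8 * expR 2^-1 * (Cs * N ^+ 2).
    apply: le_trans (gauss_var_le (design_s hD)) _; apply: ler_wpM2l.
      by rewrite mulr_ge0// expR_ge0.
    exact: design_s2_le hD.
  have g0 : 0 <= gv by apply: Rintegral_ge0 => x _; exact: sqr_ge0.
  apply: le_trans (ler_pM g0 (sqr_ge0 _) g1 (Fnorm_le X)) _.
  by apply: le_of_eq; rewrite -/N -/q; ring.
have h2 : kappa <= 1 by rewrite /kappa ler_pdivrMr ?mulr_gt0 ?exprn_gt0// mul1r; exact: gram2_le.
have h3 := var_le M0 g; have h4 := var_ge0 g.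
case/andP: (ones2_le) => o0 o1.
have h5 : mean g ^+ 2 <= M ^+ 2.
  by rewrite -(real_normK (num_real (mean g))) ler_pXn2r ?nnegrE ?(ltW M0)//; exact: mean_le.
have h6 := ler_wpM2l h4 h2; have h7 := ler_wpM2l (sqr_ge0 (mean g)) o1.
by rewrite /B; move: h1 h3 h5 h6 h7; rewrite !mulr1 => *; lra.
Qed.

Let K := 2 * (1 ^+ 2 * (1 + Cs)) + 32 * M ^+ 4.

(** The variance of the statistic is of order [p^(-1/2)]. *)
Lemma energy_stat_var (g : prior M) : expect g (energy_stat X) ^+ 2 <= expect g (fun y => energy_stat X y ^+ 2)
  <= expect g (energy_stat X) ^+ 2 + 8 * expR K * r.
Proof.
set m := expect g (energy_stat X); have [w0 w2] : 0 < w /\ w ^+ 2 = q by exact: design_w hD.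
have GT := good_statP Cs0 hD (ler01 : (0:R) <= 1) (mtest_energy_stat X) (lipschitz_energy_stat Cs0 hD).
have [i1 h1] := variance_good (M := M) g (design_p hD) (design_s hD) GT.
have [i2 _] := energy_stat_sqr g.
have it : (joint n p s g).-integrable setT (EFin \o (fun zz => energy_stat X (obs X zz))).
  exact: (integrable_test X (design_s hD) (good_l0 GT) (good_mtest GT) (good_lip GT)).
have e : \int[joint n p s g]_zz (energy_stat X (obs X zz) - m) ^+ 2 = expect g (fun y => energy_stat X y ^+ 2) - m ^+ 2.
  transitivity (\int[joint n p s g]_zz (energy_stat X (obs X zz) ^+ 2 - (2 * m * energy_stat X (obs X zz) - m ^+ 2))).
    by apply: eq_Rintegral => zz _; ring.
  rewrite RintegralB//; last first.
    by apply: integrableRB; [exact: integrableRZ | exact: integrableR_cst].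
  rewrite RintegralB//; [|exact: integrableRZ|exact: integrableR_cst].
  rewrite RintegralZl// RintegralP_cst -/(expect g (energy_stat X)) -/m /expect; ring.
apply/andP; split.
  by rewrite -subr_ge0 -e; apply: Rintegral_ge0 => zz _; exact: sqr_ge0.
rewrite addrC -lerBlDr -e; apply: le_trans h1 _.
by apply: ler_wpM2l; [rewrite mulr_ge0// expR_ge0 | exact: design_size hD].
Qed.

Lemma sqr_le_norm (x b : R) : x ^+ 2 <= b -> `|x| <= 1 + b.
Proof.
rewrite -(real_normK (num_real x)); move: `|x| (normr_ge0 x) => a a0 h; nra.
Qed.

(** The noise contributes the same amount to [energy_stat_sqr] for all priors, so
    that the difference of the variances is visible in the mean of the square;
    this mean is the square of the mean up to [energy_stat_var]. *)
Lemma var_gap (g h : prior M) : (cs / Cs) ^+ 2 * `|var g - var h| <=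
  2 * B * `|expect g (energy_stat X) - expect h (energy_stat X)| + 2 * M * `|mean g - mean h| + 8 * expR K * r.
Proof.
case/andP: (energy_stat_var g) => a1 a2; case/andP: (energy_stat_var h) => b1 b2.
have c1 := sqr_le_norm (le_trans a1 (expect_energy_sqr_le g)).
have c2 := sqr_le_norm (le_trans b1 (expect_energy_sqr_le h)).
have [_ ea] := energy_stat_sqr g; have [_ eb] := energy_stat_sqr h.
move: a1 a2 b1 b2; rewrite ea eb; move: c1 c2.
set mg := expect g (energy_stat X); set mh := expect h (energy_stat X) => c1 c2 a1 a2 b1 b2.
apply: (@le_trans _ _ (kappa * `|var g - var h|)).
  by apply: ler_wpM2r => //; exact: kappa_ge.
have k0 : 0 <= kappa by apply: le_trans kappa_ge; exact: sqr_ge0.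
rewrite -[X in X * _]ger0_norm// -normrM.
have d1 : `|mg ^+ 2 - mh ^+ 2| <= 2 * B * `|mg - mh|.
  rewrite subr_sqr normrM mulrC; apply: ler_wpM2r => //.
  apply: le_trans (ler_normD _ _) _; lra.
have d2 : `|mean g ^+ 2 * ones2 - mean h ^+ 2 * ones2| <= 2 * M * `|mean g - mean h|.
  case/andP: (ones2_le) => o0 o1.
  rewrite -mulrBl normrM (ger0_norm o0); apply: le_trans (ler_piMr (normr_ge0 _) o1) _.
  rewrite subr_sqr normrM mulrC; apply: ler_wpM2r => //.
  by apply: le_trans (ler_normD _ _) _; have := mean_le g; have := mean_le h; lra.
move: d1 d2 a1 a2 b1 b2; rewrite mulrBr.
set D1 := 2 * B * _; set D2 := 2 * M * _; set V := 8 * expR K * r.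
rewrite [var g * _]mulrC [var h * _]mulrC.
move: (kappa * var g) (kappa * var h) (mean g ^+ 2 * ones2) (mean h ^+ 2 * ones2)
  (mg ^+ 2) (mh ^+ 2) (gv * Fnorm X ^+ 2 / (q * N ^+ 4)) D1 D2 V.
move=> x1 x2 y1 y2 m1 m2 G D1' D2' V; rewrite !ler_norml => /andP[? ?] /andP[? ?] ? ? ? ?.
by apply/andP; split; lra.
Qed.

End identifiability.

(** * Characteristic function at one frequency *)

Section cf_gap.
Import ComplexField.
Local Open Scope complex_scope.
Context {R : realType} {M : R}.
Hypothesis M0 : 0 < M.
Variables Cs cs : R.
Hypotheses (Cs0 : 0 < Cs) (cs0 : 0 < cs).
Variables (r : R) (n p : nat) (X : 'M[R]_(n, p)) (s : R) (S : {set 'I_p}) (z : 'I_p -> 'cV[R]_n).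
Hypothesis hD : design Cs cs r X s S z.
Local Notation normc := (@Normc.normc R).
Let N := opnorm X.
Let q : R := p%:R.
Variables (tm tau : R).
Hypotheses (tau_le : `|tau| <= tm) (r0 : 0 <= r) (r1 : r <= 1) (rtm : 2 * M * tm * r <= 1).
Variable gstar : prior M.

Let a j k := dotv (z j) (col k X).

(** What the coordinates other than [j] contribute to the mean of [exp (i tau z_j . y)]. *)
Definition others_cf (g : prior M) (j : 'I_p) : R[i] := \prod_(k | k != j) cf g (tau * a j k).

Lemma others_cf_le1 g j : normc (others_cf g j) <= 1.
Proof.
by have [] := normc_prodB (fun k => k != j) (fun k => normc_cf g (tau * a j k))
  (fun k => normc_cf g (tau * a j k)).
Qed.

(** Conjugation makes the contribution of the other coordinates a squared modulus;
    [u] is used to read real and imaginary parts. *)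
Definition weight (u : R[i]) (j : 'I_p) : R[i] := u * (others_cf gstar j)^*.

Lemma weight_le1 u j : normc u <= 1 -> normc (weight u j) <= 1.
Proof.
by move=> u1; rewrite normc_mul normc_conj mulr_ile1 ?normc_ge0 ?others_cf_le1.
Qed.

(** The factor contributed by the noise. *)
Definition damp (j : 'I_p) : R := expR (- (tau ^+ 2 * l2norm (z j) ^+ 2 * (s ^+ 2 / 2))).

Lemma expect_phase_stat (g : prior M) u :
  expect X s g (phase_stat S z tau (weight u)) =
  q^-1 * \sum_(j in S) damp j * Re (cf g (tau * a j j) * others_cf g j * weight u j).
Proof.
have s0 : s != 0 by rewrite gt_eqF// (design_s hD).
have md j : measurable_fun setT (fun zz => tau * dotv (z j) (obs X zz)).
  by apply: measurable_funM => //; apply: mtest_obs; exact: mtest_dotv.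
have mR j : measurable_fun setT (fun zz => Re (cis (tau * dotv (z j) (obs X zz)) * weight u j)).
  under eq_fun do rewrite ReM /=.
  by apply: measurable_funB; apply: measurable_funM => //; [exact: measurable_cosC|exact: measurable_sinC].
have iR j : (joint n p s g).-integrable setT
    (EFin \o (fun zz => Re (cis (tau * dotv (z j) (obs X zz)) * weight u j))).
  apply: (@integrable_bounded _ _ _ _ _ (normc (weight u j))) => // zz.
  by apply: le_trans (Re_le_normc _) _; rewrite normc_mul normc_cis mul1r.
have e j : \int[joint n p s g]_zz Re (cis (tau * dotv (z j) (obs X zz)) * weight u j) =
    damp j * Re (cf g (tau * a j j) * others_cf g j * weight u j).
  have := ecis_mulr (joint n p s g) (weight u j) (md j).
  move=> /(congr1 (@Re R)) /= ->.
  rewrite ecis_joint// (bigD1 j)//= -/(damp j) -mulrA.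
  by rewrite ReM /= mul0r subr0.
rewrite /expect /phase_stat.
have [H1 H2] := Rintegral_sum (enum S) iR.
under eq_Rintegral do rewrite -big_enum.
rewrite RintegralZl// H2 big_enum /=; congr (_ * _).
by apply: eq_bigr => j _; exact: e.
Qed.

Lemma sqr_sum_le j : j \in S -> \sum_(k | k != j) (tau * a j k) ^+ 2 <= tm ^+ 2 * Cs ^+ 2.
Proof.
move=> jS; have N0 : 0 <= N := opnorm_ge0 X.
apply: (@le_trans _ _ (tau ^+ 2 * l2norm (X^T *m z j) ^+ 2)).
  rewrite -sum_sqr_dotv_col mulr_sumr [leRHS](bigD1 j)//=; apply: ler_wpDl; first by apply: mulr_ge0; exact: sqr_ge0.
  by apply: ler_sum => k _; rewrite exprMn.
apply: ler_pM; rewrite ?sqr_ge0//.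
  by rewrite -(real_normK (num_real tau)) ler_pXn2r ?nnegrE// (le_trans _ tau_le).
rewrite ler_pXn2r ?nnegrE ?l2norm_ge0 ?(ltW Cs0)//.
by apply: le_trans (l2norm_trmul _ _) _; exact: (design_z hD).
Qed.

Lemma cube_sum_le j : j \in S ->
  \sum_(k | k != j) `|tau * a j k| ^+ 3 <= tm ^+ 3 * Cs ^+ 2 * r.
Proof.
move=> jS; have t0 : 0 <= tm by apply: le_trans tau_le.
apply: (@le_trans _ _ (tm * r * \sum_(k | k != j) (tau * a j k) ^+ 2)).
  rewrite mulr_sumr; apply: ler_sum => k kj.
  rewrite exprS (real_normK (num_real _)); apply: ler_wpM2r; first exact: sqr_ge0.
  by rewrite normrM; apply: ler_pM => //; exact: (design_off hD).
have c0 : 0 <= tm * r by exact: mulr_ge0.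
apply: le_trans (ler_wpM2l c0 (sqr_sum_le jS)) _.
by apply: le_of_eq; ring.
Qed.

Lemma sum_le j : j \in S -> `|\sum_(k | k != j) tau * a j k| <= tm * (Cs + 2).
Proof.
move=> jS; rewrite -mulr_sumr normrM; apply: ler_pM => //.
have := sum_dotv_col X (z j); rewrite (bigD1 j)//= => e.
have -> : \sum_(k | k != j) a j k = dotv (z j) (X *m ones p) - (a j j - 1) - 1.
  by rewrite -e /a; ring.
have h1 := design_z1 hD jS; have h2 := design_diag hD jS.
apply: le_trans (ler_normB _ _) _; rewrite normr1.
have := ler_normB (dotv (z j) (X *m ones p)) (a j j - 1); rewrite -/(a j j) in h2.
by move: h1 h2 r1; lra.
Qed.

Definition others_err (g : prior M) : R :=
  2 * (tm * (Cs + 2)) * `|mean g - mean gstar| + tm ^+ 2 * Cs ^+ 2 * `|var g - var gstar| +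
  6 * M ^+ 3 * (tm ^+ 3 * Cs ^+ 2) * r.

Lemma others_cf_close g j : j \in S -> normc (others_cf g j - others_cf gstar j) <= others_err g.
Proof.
move=> jS; have h := prod_cf_close M0 (fun k => k != j) (fun k => tau * a j k) g gstar.
apply: le_trans h _; rewrite /others_err; apply: lerD; [apply: lerD|].
- rewrite [leRHS]mulrAC; apply: ler_wpM2l; last exact: sum_le.
  by rewrite mulr_ge0.
- by rewrite mulrC; apply: ler_wpM2r => //; exact: sqr_sum_le.
rewrite -[leRHS]mulrA; apply: ler_wpM2l; last exact: cube_sum_le.
by rewrite mulr_ge0// exprn_ge0// ltW.
Qed.

Definition others_low : R := expR (- (4 * M ^+ 2 * (tm ^+ 2 * Cs ^+ 2))).

Lemma others_cf_lower j : j \in S -> others_low <= normc (others_cf gstar j).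
Proof.
move=> jS; apply: (@le_trans _ _ (expR (- (4 * M ^+ 2 * \sum_(k | k != j) (tau * a j k) ^+ 2)))).
  rewrite ler_expR lerN2; apply: ler_wpM2l; last exact: sqr_sum_le.
  by rewrite mulr_ge0// sqr_ge0.
apply: prod_cf_lower => // k kj.
have h : `|2 * M * (tau * a j k)| <= 1.
  apply: le_trans rtm; rewrite !normrM ger0_norm// (gtr0_norm M0) -!mulrA ler_pM2l// ler_pM2l//.
  by apply: ler_pM => //; exact: (design_off hD).
have : (2 * M * (tau * a j k)) ^+ 2 <= 1.
  by rewrite -(real_normK (num_real _)) exprn_ile1.
move: (tau * a j k) => t; lra.
Qed.

Definition damp_low : R := expR (- (tm ^+ 2 * Cs ^+ 3 / 2)).

Lemma damp_bounds j : j \in S -> damp_low <= damp j <= 1.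
Proof.
move=> jS; have N0 : 0 <= N := opnorm_ge0 X.
rewrite /damp_low /damp; apply/andP; split; last first.
  rewrite -[leRHS]expR0 ler_expR oppr_le0; apply: mulr_ge0.
    by apply: mulr_ge0; exact: sqr_ge0.
  by apply: divr_ge0 => //; exact: sqr_ge0.
rewrite ler_expR lerN2.
rewrite mulrA ler_pM2r ?invr_gt0// -mulrA; apply: ler_pM;
  [exact: sqr_ge0|by apply: mulr_ge0; exact: sqr_ge0| |].
  by rewrite -(real_normK (num_real tau)) ler_pXn2r ?nnegrE// (le_trans _ tau_le).
apply: (@le_trans _ _ (l2norm (z j) ^+ 2 * (Cs * N ^+ 2))).
  by apply: ler_wpM2l; [exact: sqr_ge0 | exact: design_s2_le hD].
have h : (N * l2norm (z j)) ^+ 2 <= Cs ^+ 2.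
  by rewrite ler_pXn2r ?nnegrE ?mulr_ge0 ?l2norm_ge0 ?(ltW Cs0)//; exact: (design_z hD).
rewrite (_ : _ * _ = Cs * (N * l2norm (z j)) ^+ 2); last by ring.
by rewrite exprS ler_pM2l.
Qed.

(** In the [j]-th term under [g], replace the contribution of the other coordinates
    by the one under [gstar] and [z_j . x_j] by 1.  What is left is the
    difference of the characteristic functions at [tau] times
    [damp j * |others_cf gstar j|^2], which is positive and bounded away
    from 0, so that the terms do not cancel in the sum over [j]. *)
Lemma cf_gap (g : prior M) (u : R[i]) : normc u <= 1 ->
  cs * damp_low * others_low ^+ 2 * `|Re (u * (cf g tau - cf gstar tau))| <=
  `|expect X s g (phase_stat S z tau (weight u)) - expect X s gstar (phase_stat S z tau (weight u))|
  + others_err g + 4 * M * tm * r.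
Proof.
move=> u1.
have q0 : 0 < q := design_q hD.
set V := Re (u * (cf g tau - cf gstar tau)).
(* all that is not proportional to the difference at tau *)
pose err j := weight u j * (cf g (tau * a j j) * (others_cf g j - others_cf gstar j) +
  ((cf g (tau * a j j) - cf g tau) - (cf gstar (tau * a j j) - cf gstar tau)) * others_cf gstar j).
have errE j : cf g (tau * a j j) * others_cf g j * weight u j - cf gstar (tau * a j j) * others_cf gstar j * weight u j
   = u * (cf g tau - cf gstar tau) * (others_cf gstar j * (others_cf gstar j)^*) + err j.
  by rewrite /err /weight; ring.
have realE (D : R[i]) (x : R[i]) : Re (x * (D * D^*)) = Re x * normc D ^+ 2.
  by rewrite ReM Re_mulJ (_ : Im (D * D^*) = 0) ?mulr0 ?subr0//; case: D => ? ? /=; ring.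
have err_le j : j \in S -> normc (err j) <= others_err g + 4 * M * tm * r.
  move=> jS; rewrite /err normc_mul; apply: le_trans (ler_piMl (normc_ge0 _) (weight_le1 _ u1)) _.
  apply: le_trans (normcD _ _) _; rewrite !normc_mul; apply: lerD.
    by apply: le_trans (ler_piMl (normc_ge0 _) (normc_cf _ _)) _; exact: others_cf_close.
  apply: le_trans (ler_piMr (normc_ge0 _) (others_cf_le1 _ _)) _.
  apply: le_trans (normcB _ _) _.
  have d : `|tau * a j j - tau| <= tm * r.
    rewrite -[X in _ - X]mulr1 -mulrBr normrM; apply: ler_pM => //; exact: (design_diag hD).
  have M2 : 0 <= 2 * M by rewrite mulr_ge0// ltW.
  have c1 := le_trans (cf_lip g _ _) (ler_wpM2l M2 d).
  have c2 := le_trans (cf_lip gstar _ _) (ler_wpM2l M2 d).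
  apply: le_trans (lerD c1 c2) _.
  by apply: le_of_eq; ring.
rewrite !expect_phase_stat -mulrBr -sumrB.
have e : \sum_(j in S) (damp j * Re (cf g (tau * a j j) * others_cf g j * weight u j) -
    damp j * Re (cf gstar (tau * a j j) * others_cf gstar j * weight u j)) =
  (\sum_(j in S) damp j * normc (others_cf gstar j) ^+ 2) * V + \sum_(j in S) damp j * Re (err j).
  rewrite mulr_suml -big_split /=; apply: eq_bigr => j _.
  rewrite -mulrBr -raddfB errE raddfD /= realE -/V; ring.
rewrite e; set A := \sum_(j in S) _ * _; set Bs := \sum_(j in S) _.
have Aq : cs * damp_low * others_low ^+ 2 * q <= A.
  apply: (@le_trans _ _ (\sum_(j in S) damp_low * others_low ^+ 2)).
    rewrite sumr_const -mulr_natl (_ : _ * q = (cs * q) * (damp_low * others_low ^+ 2)); last by ring.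
    apply: ler_wpM2r; last exact: design_card hD.
    by rewrite mulr_ge0 ?sqr_ge0// expR_ge0.
  apply: ler_sum => j jS; apply: ler_pM; rewrite ?expR_ge0 ?sqr_ge0//.
    by case/andP: (damp_bounds jS).
  rewrite ler_pXn2r ?nnegrE ?expR_ge0 ?normc_ge0//; exact: others_cf_lower.
have Bq : `|Bs| <= q * (others_err g + 4 * M * tm * r).
  have t0 : 0 <= tm by apply: le_trans tau_le.
  have E0 : 0 <= others_err g + 4 * M * tm * r.
    have M3 : 0 <= M ^+ 3 by rewrite exprn_ge0// ltW.
    have M1 := ltW M0; have C1 := ltW Cs0.
    by rewrite !addr_ge0 ?mulr_ge0 ?exprn_ge0 ?addr_ge0.
  apply: le_trans (ler_norm_sum _ _ _) _.
  apply: (@le_trans _ _ (\sum_(j in S) (others_err g + 4 * M * tm * r))).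
    apply: ler_sum => j jS; rewrite normrM; case/andP: (damp_bounds jS) => _ d1.
    have d0 : 0 <= damp j by exact: expR_ge0.
    rewrite (ger0_norm d0); apply: le_trans (ler_piMl (normr_ge0 _) d1) _.
    exact: le_trans (Re_le_normc _) (err_le _ jS).
  rewrite sumr_const -[leLHS]mulr_natl; apply: ler_wpM2r => //.
  by rewrite ler_nat (leq_trans (max_card _))// card_ord.
rewrite -addrA; move: (others_err g + 4 * M * tm * r) Bq => E Bq.
rewrite -(@ler_pM2l _ q)// [leRHS]mulrDr.
have -> : q * `|q^-1 * (A * V + Bs)| = `|A * V + Bs|.
  by rewrite normrM gtr0_norm ?invr_gt0// mulrA divff ?gt_eqF// mul1r.
have A0 : 0 <= A.
  by apply: sumr_ge0 => j _; rewrite mulr_ge0 ?sqr_ge0// expR_ge0.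
have h1 : q * (cs * damp_low * others_low ^+ 2 * `|V|) <= `|A * V|.
  by rewrite normrM (ger0_norm A0) mulrA; apply: ler_wpM2r => //; rewrite mulrC.
have h2 : `|A * V| <= `|A * V + Bs| + `|Bs|.
  by rewrite -{1}[A * V](addrK Bs); exact: ler_normB.
by apply: le_trans h1 (le_trans h2 _); rewrite lerD2l.
Qed.

End cf_gap.

(** * Quantitative identification *)

Section identification.
Import ComplexField.
Local Open Scope complex_scope.
Context {R : realType} {M : R}.
Hypothesis M0 : 0 < M.
Variables Cs cs : R.
Hypotheses (Cs0 : 0 < Cs) (cs0 : 0 < cs).
Local Notation normc := (@Normc.normc R).

Lemma gap_arith (P Q V1 A1 A2 A3 A4 B E x m v d1 d2 d3 r : R) :
  0 < P -> 0 < Q -> 0 <= A1 -> 0 <= A2 -> 0 <= A3 -> 0 <= A4 -> 0 <= B -> 0 <= E -> 0 < V1 ->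
  0 <= d1 -> 0 <= d2 -> 0 <= d3 -> 0 <= r ->
  P * x <= d3 + (A1 * m + A2 * v + A3 * r) + A4 * r ->
  Q * m <= d1 -> V1 * v <= 2 * B * d2 + 2 * M * m + E * r ->
  x <= P^-1 * (1 + A1 / Q + A2 / V1 * (2 * B + 2 * M / Q + E) + A3 + A4) * (d1 + d2 + d3 + r).
Proof.
move=> P0 Q0 A10 A20 A30 A40 B0 E0 V0 d10 d20 d30 r0 hx hm hv.
rewrite -mulrA -ler_pdivrMl ?invr_gt0// invrK.
set D := d1 + d2 + d3 + r.
have D0 : 0 <= D by rewrite !addr_ge0.
have i1 : d1 <= D by rewrite /D; lra.
have i2 : d2 <= D by rewrite /D; lra.
have i3 : d3 <= D by rewrite /D; lra.
have i4 : r <= D by rewrite /D; lra.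
have m1 : m <= Q^-1 * D.
  by rewrite -ler_pdivrMl ?invr_gt0// invrK; exact: le_trans hm i1.
have v1 : v <= V1^-1 * ((2 * B + 2 * M / Q + E) * D).
  rewrite -ler_pdivrMl ?invr_gt0// invrK; apply: le_trans hv _.
  have M20 : 0 <= 2 * M by rewrite mulr_ge0// ltW.
  have B20 : 0 <= 2 * B by rewrite mulr_ge0.
  have j1 := ler_wpM2l B20 i2; have j2 := ler_wpM2l M20 m1; have j3 := ler_wpM2l E0 i4.
  rewrite [leRHS](_ : _ = 2 * B * D + 2 * M * (Q^-1 * D) + E * D); last by ring.
  by apply: lerD => //; exact: lerD.
have j1 := ler_wpM2l A10 m1; have j2 := ler_wpM2l A20 v1; have j3 := ler_wpM2l A30 i4.
have j4 := ler_wpM2l A40 i4.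
apply: le_trans hx _.
rewrite [leRHS](_ : _ = D + (A1 * (Q^-1 * D) + A2 * (V1^-1 * ((2 * B + 2 * M / Q + E) * D)) + A3 * D)
   + A4 * D); last by ring.
by apply: lerD => //; apply: lerD => //; apply: lerD => //; exact: lerD.
Qed.

(** The three gaps in a row: mean, then variance, then characteristic function. *)
Lemma identification (tm : R) : 0 <= tm -> exists2 C0, 0 < C0 &
  forall r n p (X : 'M[R]_(n, p)) s (S : {set 'I_p}) z, design Cs cs r X s S z ->
  0 <= r -> r <= 1 -> 2 * M * tm * r <= 1 ->
  forall (tau : R) (g h : prior M) (u : R[i]), `|tau| <= tm -> normc u <= 1 ->
  `|Re (u * (cf g tau - cf h tau))| <=
   C0 * (`|expect X s g (mean_stat X) - expect X s h (mean_stat X)| + `|expect X s g (energy_stat X) - expect X s h (energy_stat X)| +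
     `|expect X s g (phase_stat S z tau (weight X z tau h u)) - expect X s h (phase_stat S z tau (weight X z tau h u))| + r).
Proof.
move=> tm0.
pose P := cs * damp_low Cs tm * (others_low (M := M) Cs tm) ^+ 2.
have P0 : 0 < P by rewrite !mulr_gt0 ?exprn_gt0 ?expR_gt0.
pose V1 := (cs / Cs) ^+ 2.
have V0 : 0 < V1 by rewrite exprn_gt0// divr_gt0.
pose B := 2 + 8 * expR 2^-1 * Cs + 5 * M ^+ 2.
have B0 : 0 <= B by rewrite !addr_ge0// ?mulr_ge0 ?sqr_ge0 ?expR_ge0// ltW.
pose E := 8 * expR (2 * (1 ^+ 2 * (1 + Cs)) + 32 * M ^+ 4).
have E0 : 0 <= E by rewrite mulr_ge0// expR_ge0.
pose A1 := 2 * (tm * (Cs + 2)).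
pose A2 := tm ^+ 2 * Cs ^+ 2.
pose A3 := 6 * M ^+ 3 * (tm ^+ 3 * Cs ^+ 2).
pose A4 := 4 * M * tm.
have A10 : 0 <= A1 by rewrite !mulr_ge0// addr_ge0// ltW.
have A20 : 0 <= A2 by rewrite mulr_ge0// sqr_ge0.
have M3 : 0 <= M ^+ 3 by rewrite exprn_ge0// ltW.
have A30 : 0 <= A3 by apply: mulr_ge0; apply: mulr_ge0; rewrite ?exprn_ge0// ltW.
have A40 : 0 <= A4 by rewrite !mulr_ge0// ltW.
exists (P^-1 * (1 + A1 / cs + A2 / V1 * (2 * B + 2 * M / cs + E) + A3 + A4)).
  rewrite mulr_gt0 ?invr_gt0//; apply: ltr_pwDl => //; apply: ltr_pwDl => //.
  apply: ltr_pwDl; last first.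
    rewrite mulr_ge0 ?divr_ge0 ?(ltW V0)// !addr_ge0 ?mulr_ge0//.
      exact: ltW.
    by rewrite invr_ge0 ltW.
  by apply: ltr_pwDl => //; rewrite divr_ge0// ltW.
move=> r n p X s S z hD r0 r1 rtm tau g h u taule u1.
apply: (gap_arith P0 cs0 A10 A20 A30 A40 B0 E0 V0 _ _ _ r0
  (cf_gap M0 Cs0 hD taule r0 r1 rtm h g u1) (mean_gap Cs0 hD g h)
  (var_gap M0 Cs0 cs0 hD g h)) => //.
Qed.

End identification.

(** * Likelihoods on a typical event *)

Section union_bound.
Import ComplexField.
Local Open Scope complex_scope.
Context {R : realType} d (T : measurableType d) (mu : probability T R).

Lemma union_bound (I : finType) (F : I -> set T) (e : R) :
  (forall i, measurable (F i)) -> (forall i, (mu (F i) <= e%:E)%E) ->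
  measurable [set x | exists i, F i x] /\
  (mu [set x | exists i, F i x] <= (#|I|%:R * e)%:E)%E.
Proof.
move=> mF hF.
have H (s : seq I) : measurable [set x | exists2 i, i \in s & F i x] /\
    (mu [set x | exists2 i, i \in s & F i x] <= ((size s)%:R * e)%:E)%E.
  elim: s => [|i s [IH1 IH2]].
    rewrite (_ : [set x | _] = set0) ?mul0r ?measure0//.
    by apply/seteqP; split => x //= -[].
  rewrite (_ : [set x | _] = F i `|` [set x | exists2 i, i \in s & F i x]); last first.
    apply/seteqP; split => x /=.
      move=> [j]; rewrite inE => /orP[/eqP ->|js] h; [by left|by right; exists j].
    move=> [h|[j js h]]; first by exists i; rewrite ?mem_head.
    by exists j => //; rewrite inE js orbT.
  split; first exact: measurableU.
  apply: le_trans (measureU2 _ (mF i) IH1) _.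
  rewrite (_ : (size (i :: s))%:R * e = e + (size s)%:R * e); last first.
    by rewrite /= -(natr1 (size s)) mulrDl mul1r addrC.
  by rewrite EFinD; apply: leeD; [exact: hF|exact: IH2].
have := H (enum I); rewrite -cardE.
rewrite (_ : [set x | exists2 i, i \in enum I & F i x] = [set x | exists i, F i x])//.
apply/seteqP; split => x /= [k]; first by move=> _ h; exists k.
by move=> h; exists k => //; rewrite mem_enum.
Qed.

End union_bound.

Section main_step.
Import ComplexField.
Local Open Scope complex_scope.
Context {R : realType} {M : R}.
Hypothesis M0 : 0 < M.
Variables Cs cs : R.
Hypotheses (Cs0 : 0 < Cs) (cs0 : 0 < cs).
Local Notation normc := (@Normc.normc R).
Let B := 2 + 8 * expR 2^-1 * Cs + 5 * M ^+ 2.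

Lemma expect_energy_le r n p (X : 'M[R]_(n, p)) s (S : {set 'I_p}) z (g : prior M) :
  design Cs cs r X s S z -> `|expect X s g (energy_stat X)| <= B - 1.
Proof.
move=> hD; case/andP: (energy_stat_var Cs0 hD g) => h1 _.
apply: le_trans (sqr_le_norm (le_trans h1 (expect_energy_sqr_le M0 Cs0 hD g))) _.
by rewrite -/B; lra.
Qed.

(** The exponent of [lik_domination] is governed by [|X^T y|], that is by
    [energy_stat], and is of order [eta p] because the noise level dominates
    the norm of [X]. *)
Lemma lik_close r n p (X : 'M[R]_(n, p)) s (S : {set 'I_p}) z (g h : prior M) (eta t m : R) (rr : R -> R) y :
  design Cs cs r X s S z -> 0 < eta -> 0 <= t -> measurable_fun setT rr ->
  (forall u, - M <= u <= M -> `|rr u - u| <= eta /\ - M <= rr u <= M) ->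
  (forall f : R -> \bar R, measurable_fun setT f -> (forall u, 0 <= f u)%E ->
      (\int[g]_u f (rr u) <= (1 + eta)%:E * \int[h]_u f u)%E) ->
  `|m| <= B - 1 -> `|energy_stat X y - m| < t ->
  lik X s g y <= expR (eta * ((B + t + M) / cs + 1) * p%:R) * lik X s h y.
Proof.
move=> hD e0 t0 mr rc rd hm hT.
have N0 : 0 < opnorm X := design_N Cs0 hD.
have [w0 w2] := design_w hD.
have s0 := design_s hD.
have q0 : 0 < p%:R :> R := design_q hD.
apply: le_trans (lik_domination M0 e0 mr rc rd X s0 y) _.
apply: ler_wpM2r; first by apply: ltW; exact: lik_gt0.
have B1 : 0 <= B - 1 by exact: le_trans hm.
rewrite [X in _ <= expR X](_ : _ = eta * ((B + t + M) / cs) * p%:R + eta * p%:R); last by ring.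
rewrite expRD; apply: ler_pM; rewrite ?expR_ge0 ?exprn_ge0//.
- by rewrite addr_ge0// ltW.
- rewrite ler_expR -!mulrA ler_pM2l// [leRHS]mulrC.
  have hX : l2norm (X^T *m y) <= (B + t) * (Num.sqrt p%:R * opnorm X ^+ 2).
    have h1 : energy_stat X y <= B + t.
      have := ler_norm m; have := ler_norm (energy_stat X y - m); move: hT hm; lra.
    rewrite -ler_pdivrMr ?mulr_gt0 ?exprn_gt0// mulrC; exact: h1.
  have h2 : l2norm (X^T *m y) * Num.sqrt p%:R + p%:R * (M * opnorm X ^+ 2) <=
     (B + t + M) * (p%:R * opnorm X ^+ 2).
    have := ler_wpM2r (ltW w0) hX.
    rewrite (_ : (B + t) * _ * _ = (B + t) * (Num.sqrt p%:R ^+ 2 * opnorm X ^+ 2)); last by ring.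
    rewrite w2 => h3.
    rewrite (_ : (B + t + M) * _ = (B + t) * (p%:R * opnorm X ^+ 2) + p%:R * (M * opnorm X ^+ 2)).
      by rewrite lerD2r.
    by ring.
  rewrite ler_pdivrMr ?exprn_gt0//; apply: le_trans h2 _.
  have Bt : 0 <= B + t + M.
    by apply: addr_ge0 (ltW M0); apply: addr_ge0 => //; move: (B) B1 => b; lra.
  have := design_noise_ge hD; rewrite -ler_pdivlMl// => h4.
  have c0 : 0 <= (B + t + M) * p%:R by rewrite mulr_ge0// ltW.
  have h5 := ler_wpM2l c0 h4.
  rewrite mulrA; apply: le_trans h5 _.
  by apply: le_of_eq; ring.
rewrite expRM_natr.
apply: lerXn2r; rewrite ?nnegrE ?expR_ge0 ?addr_ge0 ?(ltW e0)//.
exact: expR_ge1Dx.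
Qed.

End main_step.

(** * The good event *)

Section good_event.
Import ComplexField.
Local Open Scope complex_scope.
Context {R : realType} {M : R}.
Variables (n p : nat) (X : 'M[R]_(n, p)) (s : R) (gstar : prior M).
Variables (St I : finType) (T : St -> 'cV[R]_n -> R) (h : I -> prior M) (t c : R).
Hypotheses (s0 : 0 < s) (c0 : 0 < c).
Hypothesis mT : forall k, mtest (T k).
Hypothesis conc : forall k (g : prior M),
  (joint n p s g [set z | (t / 2 <= `|T k (obs X z) - expect X s g (T k)|)%R]
   <= (2 * expR (- (c * p%:R)))%:E)%E.

Let near : set (n.-tuple R) := [set x | forall k, `|T k (tcol x) - expect X s gstar (T k)| < t / 2].

Let mdev (g : prior M) k : measurable [set x : n.-tuple R | t / 2 <= `|T k (tcol x) - expect X s g (T k)|].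
Proof.
apply: measurable_le_set => //; apply: (measurableT_comp (@normr_measurable R setT)).
by apply: measurable_funB => //; exact: mT.
Qed.

Let mnear : measurable near.
Proof.
rewrite (_ : near = ~` [set x | exists k, t / 2 <= `|T k (tcol x) - expect X s gstar (T k)|]).
  apply: measurableC.
  rewrite (_ : [set x | _] = \bigcup_(k in setT) [set x : n.-tuple R | t / 2 <= `|T k (tcol x) - expect X s gstar (T k)|]).
    by apply: fin_bigcup_measurable => // k _; exact: mdev.
  by apply/seteqP; split => x /= [k hk]; exists k.
apply/seteqP; split => x /= hx.
  by move=> [k]; rewrite leNgt hx.
by move=> k; rewrite ltNge; apply/negP => hk; apply: hx; exists k.
Qed.

Let mobs (A : set (n.-tuple R)) : measurable A ->
  measurable [set z : p.-tuple R * n.-tuple R | A (coltup (obs X z))].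
Proof. by move=> mA; have := measurable_obs X measurableT mA; rewrite setTI. Qed.

Let far i := exists k, t <= `|expect X s (h i) (T k) - expect X s gstar (T k)|.

Let a := expR (- (c / 2 * p%:R)).

Let H i : set (p.-tuple R * n.-tuple R) := [set z | far i /\ (near (coltup (obs X z)) /\
   a * lik X s gstar (obs X z) <= lik X s (h i) (obs X z))].

Let mH i : measurable (H i).
Proof.
have [fi|nfi] := pselect (far i); last first.
  by rewrite (_ : H i = set0)//; apply/seteqP; split => z //= -[].
pose D : set (n.-tuple R) := near `&` [set x | a * lik X s gstar (tcol x) <= lik X s (h i) (tcol x)].
have mD : measurable D.
  apply: measurableI => //; apply: measurable_le_set; last exact: measurable_lik.
  by apply: measurable_funM => //; exact: measurable_lik.
rewrite (_ : H i = [set z | D (coltup (obs X z))]); first exact: mobs.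
by apply/seteqP; split => z /=; rewrite /D /= coltupK; [move=> []|split].
Qed.

Let weaken : 2 * expR (- (c * p%:R)) <= 2 * expR (- (c / 4 * p%:R)) :> R.
Proof.
rewrite ler_pM2l// ler_expR lerN2; apply: ler_wpM2r => //; move: c0; lra.
Qed.

Let pH i : (joint n p s gstar (H i) <= (2 * expR (- (c / 4 * p%:R)))%:E)%E.
Proof.
have [fi|nfi] := pselect (far i); last first.
  rewrite (_ : H i = set0); last by apply/seteqP; split => z //= -[].
  by rewrite measure0 lee_fin mulr_ge0// expR_ge0.
have a0 : 0 < a by exact: expR_gt0.
have := lik_ratio_bound X s0 gstar (h i) mnear a0.
rewrite (_ : [set z | near _ /\ _] = H i); last first.
  by apply/seteqP; split => z /=; [split|move=> []].
move=> h1; apply: le_trans h1 _.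
have [k hk] := fi.
have h2 : (joint n p s (h i) [set z | near (coltup (obs X z))] <= (2 * expR (- (c * p%:R)))%:E)%E.
  apply: le_trans (conc k (h i)); apply: le_measure.
  - by rewrite inE; exact: mobs.
  - rewrite inE; have := mobs (mdev (h i) k); congr measurable.
    by apply/seteqP; split => z /=; rewrite coltupK.
  move=> z /(_ k) /=; rewrite coltupK.
  move: hk; set e1 := expect _ _ _ _; set e2 := expect _ _ _ _; set y := T k _ => hk hy.
  have := ler_normD (e1 - y) (y - e2); rewrite addrA subrK => h3.
  rewrite distrC; lra.
have ai : (0 <= a^-1%:E)%E by rewrite lee_fin invr_ge0 ltW.
apply: le_trans (lee_wpmul2l ai h2) _.
rewrite -EFinM lee_fin /a -expRN opprK mulrCA ler_pM2l// -expRD ler_expR.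
have : 0 <= c / 4 * p%:R by rewrite mulr_ge0// divr_ge0// ltW.
by move: (c) (p%:R : R) => x y; lra.
Qed.

(** If some statistic has means at distance [t] under [h i] and [gstar], then under
    [h i] the event that all statistics are within [t / 2] of their means under
    [gstar] is a large deviation.  [lik_ratio_bound] carries this over to the
    law under [gstar], and a union bound over statistics and [i] gives one
    event. *)
Lemma good_event : exists G : set (p.-tuple R * n.-tuple R),
  [/\ measurable G,
   (joint n p s gstar (~` G) <= (#|{: St + I}|%:R * (2 * expR (- (c / 4 * p%:R))))%:E)%E &
   forall z, G z -> (forall k, `|T k (obs X z) - expect X s gstar (T k)| < t / 2) /\
     forall i k, t <= `|expect X s (h i) (T k) - expect X s gstar (T k)| ->
       lik X s (h i) (obs X z) < expR (- (c / 2 * p%:R)) * lik X s gstar (obs X z)].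
Proof.
(* bad events: a statistic deviates, or a separated h i has a large likelihood *)
pose F (x : St + I) : set (p.-tuple R * n.-tuple R) := match x with
  | inl k => [set z | t / 2 <= `|T k (obs X z) - expect X s gstar (T k)|]
  | inr i => H i end.
have mF x : measurable (F x).
  case: x => [k|i]; last exact: mH.
  have := mobs (mdev gstar k); congr measurable.
  by apply/seteqP; split => z /=; rewrite coltupK.
have hF x : (joint n p s gstar (F x) <= (2 * expR (- (c / 4 * p%:R)))%:E)%E.
  case: x => [k|i]; last exact: pH.
  by apply: le_trans (conc k gstar) _; rewrite lee_fin.
have [mU hU] := union_bound mF hF.
exists (~` [set z | exists x, F x z]); split.
- exact: measurableC.
- by rewrite setCK.
move=> z hz.
have hT k : `|T k (obs X z) - expect X s gstar (T k)| < t / 2.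
  by rewrite ltNge; apply/negP => hk; apply: hz; exists (inl k).
split=> // i k hk; rewrite ltNge; apply/negP => hl; apply: hz; exists (inr i) => /=.
split; first by exists k.
by split=> // k' /=; rewrite coltupK.
Qed.

End good_event.

(** * Separation by finitely many statistics *)

Section main_step.
Import ComplexField.
Local Open Scope complex_scope.
Context {R : realType} {M : R}.
Hypothesis M0 : 0 < M.
Variables Cs cs : R.
Hypotheses (Cs0 : 0 < Cs) (cs0 : 0 < cs).
Local Notation normc := (@Normc.normc R).

(** The two numbers that select the real and the imaginary part. *)
Definition phase (b : bool) : R[i] := if b then 1 else 0 -i* 1.

Lemma normc_phase b : normc (phase b) <= 1.
Proof. by case: b; rewrite /= ?sqrrN expr0n expr1n /= ?addr0 ?add0r sqrtr1. Qed.

Lemma Re_phase b (x : R[i]) : Re (phase b * x) = if b then Re x else Im x.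
Proof. by case: b; case: x => u v /=; ring. Qed.

Variables (gstar : prior M) (K : nat).
Let tau (j : nat) : R := j%:R / M.
Let tm : R := K%:R / M.

Definition stat_ix := option (option ('I_K.+1 * bool)).

(** [None] and [Some None] stand for the mean and the energy, the other indices for
    the frequencies [j / M] and the two parts of the characteristic function. *)
Definition stat n p (X : 'M[R]_(n, p)) (S : {set 'I_p}) (z : 'I_p -> 'cV[R]_n)
    (k : stat_ix) : 'cV[R]_n -> R :=
  match k with
  | None => mean_stat X
  | Some None => energy_stat X
  | Some (Some (j, b)) => phase_stat S z (tau j) (weight X z (tau j) gstar (phase b))
  end.

Let L := 1 + 2 * tm * Num.sqrt Cs.

Let tm0 : 0 <= tm.
Proof. by rewrite divr_ge0// ltW. Qed.

Let L0 : 0 <= L.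
Proof. by apply: addr_ge0 => //; apply: mulr_ge0; [exact: mulr_ge0|exact: sqrtr_ge0]. Qed.

Lemma tau_le (j : 'I_K.+1) : `|tau j| <= tm.
Proof.
rewrite ger0_norm ?divr_ge0 ?(ltW M0)// ler_pM2r ?invr_gt0// ler_nat.
by rewrite -ltnS.
Qed.

Lemma stat_good r n p (X : 'M[R]_(n, p)) s (S : {set 'I_p}) z k :
  design Cs cs r X s S z -> 
  good_stat (L ^+ 2 * (1 + Cs)) X s (stat X S z k) (stat_scale X L).
Proof.
move=> hD; apply: (good_statP Cs0 hD L0).
  by case: k => [[[j b]|]|]; [exact: mtest_phase_stat|exact: mtest_energy_stat|exact: mtest_mean_stat].
have c0 : 0 <= 2 * tm * Num.sqrt Cs by apply: mulr_ge0; [exact: mulr_ge0|exact: sqrtr_ge0].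
have l1 : 1 <= L by rewrite /L lerDl.
case: k => [[[j b]|]|] /=.
- apply: lipschitzW (lipschitz_phase_stat Cs0 hD (tau j) (fun j => weight_le1 _ _ _ _ _ (normc_phase b))).
  apply: (stat_scale_le Cs0 hD); rewrite /L ler_wpDl//.
  by apply: ler_wpM2r; [exact: sqrtr_ge0 | rewrite ler_pM2l//; exact: tau_le].
- by apply: lipschitzW (lipschitz_energy_stat Cs0 hD); exact: (stat_scale_le Cs0 hD).
- by apply: lipschitzW (lipschitz_mean_stat Cs0 hD); exact: (stat_scale_le Cs0 hD).
Qed.

Lemma cf_net_close (g h : prior M) (eta : R) (rr : R -> R) b (j : 'I_K.+1) :
  0 < eta -> measurable_fun setT rr ->
  (forall u, - M <= u <= M -> `|rr u - u| <= eta /\ - M <= rr u <= M) ->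
  (forall f : R -> \bar R, measurable_fun setT f -> (forall u, 0 <= f u)%E ->
      (\int[g]_u f (rr u) <= (1 + eta)%:E * \int[h]_u f u)%E) ->
  `|Re (phase b * (cf g (tau j) - cf h (tau j)))| <= (tm + 2) * eta.
Proof.
move=> e0 mr rc rd; rewrite Re_phase.
have mt : measurable_fun setT (fun u : R => tau j * u) by exact: measurable_funM.
have lip (u v : R) : `|tau j * u - tau j * v| <= tm * `|u - v|.
  by rewrite -mulrBr normrM; apply: ler_wpM2r => //; exact: tau_le.
case: b => /=.
- have := @net_Rintegral_close _ _ g h eta rr e0 mr rc rd (fun u => cos (tau j * u)) 1 tm
    (measurable_cosC mt) (fun u => cos_max _) (fun u v => le_trans (cos_lip _ _) (lip u v)) tm0.
  by rewrite mulr1.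
- have := @net_Rintegral_close _ _ g h eta rr e0 mr rc rd (fun u => sin (tau j * u)) 1 tm
    (measurable_sinC mt) (fun u => sin_max _) (fun u v => le_trans (sin_lip _ _) (lip u v)) tm0.
  by rewrite mulr1.
Qed.

(** Contraposition of [identification]: if no mean moved by [t = eta / (4 C0)], the
    characteristic functions would differ by less than [eta]. *)
Lemma separation eta : 0 < eta -> exists t r0, [/\ 0 < t, 0 < r0 &
  forall n p (X : 'M[R]_(n, p)) s (S : {set 'I_p}) z (h : prior M), design Cs cs r0 X s S z ->
  forall (j : 'I_K.+1) b, eta < `|Re (phase b * (cf h (tau j) - cf gstar (tau j)))| ->
  exists k, t <= `|expect X s h (stat X S z k) - expect X s gstar (stat X S z k)|].
Proof.
move=> e0; have [C0 C00 hC] := identification M0 Cs0 cs0 tm0.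
pose t := eta / (4 * C0).
have t0 : 0 < t by rewrite divr_gt0// mulr_gt0.
have M20 : 0 <= 2 * M * tm by apply: mulr_ge0 => //; rewrite mulr_ge0// ltW.
have M21 : 0 < 2 * M * tm + 1 by rewrite ltr_wpDl.
pose r0 := Num.min t (Num.min 1 (2 * M * tm + 1)^-1).
have r00 : 0 < r0 by rewrite !lt_min t0 ltr01 invr_gt0 M21.
have r0t : r0 <= t by rewrite ge_min lexx.
have r01 : r0 <= 1 by rewrite !ge_min lexx orbT.
have r0m : 2 * M * tm * r0 <= 1.
  have : r0 <= (2 * M * tm + 1)^-1 by rewrite !ge_min lexx !orbT.
  move=> h; apply: le_trans (ler_wpM2l M20 h) _.
  by rewrite ler_pdivrMr// mul1r lerDl.
exists t, r0; split => // n p X s S z h hD j b hj.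
apply: contrapT => H.
have {}H k : `|expect X s h (stat X S z k) - expect X s gstar (stat X S z k)| < t.
  by rewrite ltNge; apply/negP => hk; apply: H; exists k.
have := hC r0 n p X s S z hD (ltW r00) r01 r0m (tau j) h gstar (phase b) (tau_le j) (normc_phase b).
have h1 := H None; have h2 := H (Some None); have h3 := H (Some (Some (j, b))).
rewrite /= in h1 h2 h3.
move: h1 h2 h3; set d1 := `|_|; set d2 := `|_|; set d3 := `|_| => h1 h2 h3 h4.
have h5 : d1 + d2 + d3 + r0 < 4 * t by move: h1 h2 h3 r0t; clear; lra.
have := lt_trans hj (le_lt_trans h4 (_ : _ < C0 * (4 * t))).
rewrite ltr_pM2l// => /(_ h5).
by rewrite (_ : C0 * (4 * t) = eta) ?ltxx// /t; field; rewrite gt_eqF.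
Qed.

End main_step.

(** * Priors of large likelihood are close to the truth *)

Section main_step.
Import ComplexField.
Local Open Scope complex_scope.
Context {R : realType} {M : R}.
Hypothesis M0 : 0 < M.
Variables Cs cs : R.
Hypotheses (Cs0 : 0 < Cs) (cs0 : 0 < cs).
Variables (gstar : prior M) (d : prior M -> prior M -> R).
Hypothesis hd : metrizes_weak_cvg d.

Lemma far_cf e : 0 < e -> exists (K : nat) (eta : R), 0 < eta /\ forall g : prior M, e <= d g gstar ->
  exists (j : 'I_K.+1) (b : bool),
    eta < `|Re (phase b * (cf g (j%:R / M) - cf gstar (j%:R / M)))|.
Proof.
move=> e0; have [K [eta [eta0 H]]] := trig_determines M0 gstar hd e0.
exists K, eta; split => // g hg; apply: contrapT => Hn.
move: hg; rewrite leNgt => /negP; apply; apply: H => j jK.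
have hj : (j < K.+1)%N by rewrite ltnS.
split; rewrite leNgt; apply/negP => h; apply: Hn; exists (Ordinal hj).
  by exists true; rewrite Re_phase.
by exists false; rewrite Re_phase.
Qed.

(** The constants are chosen in this order: the frequencies and [eta] from [e], the
    separation [t] from [eta], the rate [c1] of concentration from [t], and last
    the fineness of the net, so that passing to the net costs at most a
    quarter of the rate in the exponent. *)
Lemma testing_step e : 0 < e -> exists r0 c Kc : R, [/\ 0 < r0, 0 < c &
  forall n p (X : 'M[R]_(n, p)) s (S : {set 'I_p}) z, design Cs cs r0 X s S z ->
  exists G : set (p.-tuple R * n.-tuple R), [/\ measurable G,
    (joint n p s gstar (~` G) <= (Kc * expR (- (c * p%:R)))%:E)%E &
    forall zz (g : prior M), G zz ->
      expR (- (c * p%:R)) * lik X s gstar (obs X zz) <= lik X s g (obs X zz) ->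
      d g gstar < e]].
Proof.
move=> e0.
have [K [eta [eta0 Hfar]]] := far_cf e0.
have eta20 : 0 < eta / 2 by rewrite divr_gt0.
have [t [r0 [t0 r00 Hsep]]] := separation M0 Cs0 cs0 gstar K eta20.
pose L := 1 + 2 * (K%:R / M) * Num.sqrt Cs.
have C0 : 0 <= L ^+ 2 * (1 + Cs) by apply: mulr_ge0; [exact: sqr_ge0|rewrite addr_ge0// ltW].
have t20 : 0 < t / 2 by rewrite divr_gt0.
have [c1 c10 Hconc] := concentration M0 t20 C0.
pose A := (2 + 8 * expR 2^-1 * Cs + 5 * M ^+ 2 + t / 2 + M) / cs + 1.
have A0 : 0 < A.
  rewrite /A; apply: ltr_wpDl => //; apply: divr_ge0; last exact: ltW.
  have E1 := expR_ge0 (2^-1 : R); have M2 := sqr_ge0 M.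
  have h1 : 0 <= 8 * expR 2^-1 * Cs by rewrite !mulr_ge0// ltW.
  apply: addr_ge0 (ltW M0); apply: addr_ge0 (ltW t20); apply: addr_ge0; last exact: mulr_ge0.
  exact: addr_ge0.
have tm2 : 0 < K%:R / M + 2 by rewrite ltr_wpDl// divr_ge0// ltW.
(* the first bound keeps the frequencies separated, the second the likelihoods comparable *)
pose et := Num.min (eta / 2 / (K%:R / M + 2)) (c1 / 4 / A).
have et0 : 0 < et by rewrite lt_min !divr_gt0.
have et1 : (K%:R / M + 2) * et <= eta / 2.
  by rewrite mulrC -ler_pdivlMr// ge_min lexx.
have et2 : et * A <= c1 / 4 by rewrite -ler_pdivlMr// ge_min lexx orbT.
have [I [h Hnet]] := net M0 et0.
exists r0, (c1 / 4), (#|{: stat_ix K + I}|%:R * 2); split => //; first by rewrite divr_gt0.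
move=> n p X s S z hD.
have s0 := design_s hD.
have [|G [mG pG HG]] := @good_event _ M n p X s gstar (stat_ix K) I (stat gstar X S z) h t c1 s0 c10
  (fun k => good_mtest (stat_good M0 Cs0 gstar k hD)).
  by move=> k g; exact: (Hconc n p X s _ _ g (design_p hD) s0 (stat_good M0 Cs0 gstar k hD)).
exists G; split => //; first by rewrite -mulrA.
move=> zz g Gzz hlik; rewrite ltNge; apply/negP => hge.
have [hT hI] := HG zz Gzz.
have [j [b hjb]] := Hfar g hge.
have [i [rr [mr rc rd]]] := Hnet g.
have hclose := cf_net_close M0 b j et0 mr rc rd.
have hi : eta / 2 < `|Re (phase b * (cf (h i) (j%:R / M) - cf gstar (j%:R / M)))|.
  move: hjb hclose et1.
  have -> : phase b * (cf g (j%:R / M) - cf gstar (j%:R / M)) =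
    phase b * (cf g (j%:R / M) - cf (h i) (j%:R / M)) +
    phase b * (cf (h i) (j%:R / M) - cf gstar (j%:R / M)) by ring.
  rewrite raddfD /= => h1 h2 h3; have := lt_le_trans h1 (ler_normD _ _).
  by rewrite -ltrBlDl; apply: le_lt_trans; rewrite lerBrDr (le_trans (lerD (lexx _) (le_trans h2 h3)))// -splitr.
have [k hk] := Hsep n p X s S z (h i) hD j b hi.
have := hI i k hk; rewrite ltNge => /negP; apply.
have hT2 := hT (Some None).
have := lik_close M0 Cs0 cs0 hD et0 (ltW t20) mr rc rd (expect_energy_le M0 Cs0 gstar hD) hT2.
rewrite -/A => hcl.
have l0 : 0 <= lik X s (h i) (obs X zz) by apply: ltW; exact: lik_gt0.
have hcl2 : lik X s g (obs X zz) <= expR (c1 / 4 * p%:R) * lik X s (h i) (obs X zz).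
  apply: le_trans hcl _; apply: ler_wpM2r => //; rewrite ler_expR; exact: ler_wpM2r.
have h5 := le_trans hlik hcl2.
have E : expR (- (c1 / 4 * p%:R)) * expR (- (c1 / 4 * p%:R)) = expR (- (c1 / 2 * p%:R)) :> R.
  by rewrite -expRD; congr expR; field.
have h6 := ler_wpM2l (expR_ge0 (- (c1 / 4 * p%:R))) h5.
by move: h6; rewrite !mulrA E -expRD addNr expR0 mul1r.
Qed.

End main_step.

(** * Asymptotics *)

Section asymptotics.
Context {R : realType}.
Variable p : nat -> nat.
Hypothesis hp : p n @[n --> \oo] --> \oo.

Lemma near_large (x : R) : \forall n \near \oo, x <= (p n)%:R.
Proof.
have /cvgnyPge/(_ (Num.truncn x).+1) := hp.
apply: filterS => n /= hn.
by apply: le_trans (ltW (truncnS_gt x)) _; rewrite ler_nat.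
Qed.

Lemma near_expR_small (c K e : R) : 0 < c -> 0 < e -> 
  \forall n \near \oo, K * expR (- (c * (p n)%:R)) <= e.
Proof.
move=> c0 e0; have := near_large (`|K| / (c * e)); apply: filterS => n.
rewrite ler_pdivrMr ?mulr_gt0// => h.
apply: le_trans (ler_wpM2r (expR_ge0 _) (ler_norm K)) _.
rewrite expRN ler_pdivrMr ?expR_gt0//; apply: le_trans h _.
rewrite [c * e]mulrC mulrCA ler_pM2l//.
by have := expR_ge1Dx (c * (p n)%:R); rewrite [c * _]mulrC; lra.
Qed.

(** A single term of a sum is below the maximum over [j] of the sums, so that the
    limits in the assumption become uniform bounds. *)
Lemma assumption_D_design (X : forall n, 'M[R]_(n, p n)) (s2 : nat -> R) :
  (forall n, 0 < s2 n) -> assumption_D X s2 ->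
  exists Cs cs : R, [/\ 0 < Cs, 0 < cs &
    exists (S : forall n, {set 'I_(p n)}) (z : forall n, 'I_(p n) -> 'cV[R]_n),
    forall r, 0 < r -> \forall n \near \oo, design Cs cs r (X n) (Num.sqrt (s2 n)) (S n) (z n)].
Proof.
move=> hs2 [Cs [cs [beta [[Cs0 cs0 b0] [h1 h2 [S [z [h3 h4 h5 h6]]]]]]]].
exists Cs, cs; split => //; exists S, z => r r0.
have h7 := near_large 1; have h8 := near_large (r^-1 ^+ 2).
have rb0 : 0 < r `^ (2 + beta) by exact: powR_gt0.
have /cvgr0Pnorm_lt/(_ _ r0) h4' := h4.
have /cvgr0Pnorm_lt/(_ _ rb0) h5' := h5.
near=> n.
have /andP[n1 n1'] : cs * opnorm (X n) ^+ 2 < s2 n < Cs / (p n)%:R * Fnorm (X n) ^+ 2 by near: n.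
have n2 : cs * opnorm (X n) ^+ 2 <= (p n)%:R^-1 * l2norm (X n *m ones (p n)) ^+ 2 by near: n.
have [n3 n3'] : cs * (p n)%:R <= #|S n|%:R /\
            forall j, j \in S n ->
              cs <= opnorm (X n) * l2norm (z n j) <= Cs /\
              `|dotv (z n j) (X n *m ones (p n))| <= Cs by near: n.
have n6 : forall a : 'I_(p n) -> R,
            (forall j, j \in S n -> `|a j| <= 1) ->
            opnorm (X n) ^+ 2 * l2norm (\sum_(j in S n) a j *: z n j) ^+ 2
              <= Cs * (p n)%:R by near: n.
have n4 : `|\big[Num.max/0]_(j in S n) `|dotv (z n j) (col j (X n)) - 1| | < r by near: n.
have n5 : `|\big[Num.max/0]_(j in S n)
             \sum_(k | k != j) `|dotv (z n j) (col k (X n))| `^ (2 + beta)| < r `^ (2 + beta) by near: n.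
have n7 : 1 <= (p n)%:R :> R by near: n.
have n8 : r^-1 ^+ 2 <= (p n)%:R by near: n.
have p0 : (0 < p n)%N by rewrite -(ltr0n R); exact: lt_le_trans n7.
have s0 : 0 < Num.sqrt (s2 n) by rewrite sqrtr_gt0.
have sE : Num.sqrt (s2 n) ^+ 2 = s2 n by rewrite sqr_sqrtr// ltW.
split => //.
- by rewrite sE ltW.
- by rewrite sE ltW.
- by move=> j /n3'[/andP[]].
- by move=> j /n3'[].
- move=> j jS; apply: ltW; apply: le_lt_trans n4; apply: le_trans (ler_norm _).
  exact: (le_bigmax_cond _ (fun j => `|dotv (z n j) (col j (X n)) - 1|) jS).
- move=> j k jS kj; rewrite leNgt; apply/negP => hk.
  move: n5; apply/negP; rewrite -leNgt; apply: le_trans (ler_norm _).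
  apply: le_trans (le_bigmax_cond _ (fun j => \sum_(k | k != j) `|dotv (z n j) (col k (X n))| `^ (2 + beta)) jS).
  rewrite (bigD1 k)//= ler_wpDr//.
    by apply: sumr_ge0 => i _; exact: powR_ge0.
  by apply: ge0_ler_powR; rewrite ?nnegrE ?(ltW r0) ?(ltW hk)// addr_ge0// ltW.
- have w0 : 0 < Num.sqrt (p n)%:R :> R by rewrite sqrtr_gt0 ltr0n.
  rewrite -[r]invrK lef_pV2 ?posrE ?invr_gt0//.
  by rewrite -(@ler_pXn2r _ 2) ?nnegrE ?invr_ge0 ?(ltW r0) ?(ltW w0)// sqr_sqrtr.
Unshelve. all: by end_near. Qed.

End asymptotics.

Lemma observation_obs {R : realType} d (T : measurableType d) (P : probability T R)
    (n p : nat) (X : 'M[R]_(n, p)) (theta : 'I_p -> {RV P >-> R})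
    (eps : 'I_n -> {RV P >-> R}) (w : T) :
  observation X theta eps w = obs X (model_tuple theta eps w).
Proof.
rewrite /observation /obs; congr (X *m _ + _); apply/colP => i; by rewrite !mxE tnth_mktuple.
Qed.

Lemma lik_of_free_energy {R : realType} (M : R) n p (X : 'M[R]_(n, p)) s (g h : prior M) y (dl c : R) :
  (0 < p)%N -> 0 < s -> dl <= c ->
  - dl <= free_energy X (s ^+ 2) y g - free_energy X (s ^+ 2) y h ->
  expR (- (c * p%:R)) * lik X s g y <= lik X s h y.
Proof.
move=> p0 s0 dc; rewrite (free_energy_sub X s0 g h y p0).
have q0 : 0 < p%:R :> R by rewrite ltr0n.
have lg := lik_gt0 X s g y; have lh := lik_gt0 X s h y.
rewrite -ler_pdivrMl ?invr_gt0// invrK => hl.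
have : - (c * p%:R) <= ln (lik X s h y / lik X s g y).
  by apply: le_trans hl; rewrite mulrN lerN2 mulrC; apply: ler_wpM2r => //; exact: ltW.
move=> hln; by rewrite -ler_pdivlMr// -[leRHS]lnK ?posrE ?divr_gt0// ler_expR.
Qed.

Theorem theorem3p2 (R : realType) (M : R) (hM : 0 < M) (gstar : prior M)
  (p : nat -> nat) (hp : p n @[n --> \oo] --> \oo)
  (X : forall n, 'M[R]_(n, p n)) (s2 : nat -> R) (hs2 : forall n, 0 < s2 n)
  (hD : assumption_D X s2)
  (disp : nat -> measure_display) (T : forall n, measurableType (disp n))
  (P : forall n, probability (T n) R)
  (theta : forall n, 'I_(p n) -> {RV (P n) >-> R})
  (eps : forall n, 'I_n -> {RV (P n) >-> R})
  (hmodel : forall n, model_law gstar (s2 n) (@theta n) (@eps n))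
  (ghat : forall n, 'cV[R]_n -> prior M)
  (delta : nat -> R)
  (hdelta_mono : nonincreasing_seq delta)
  (hdelta_lim : delta n @[n --> \oo] --> 0)
  (hghat : whp P (fun n => [set w : T n |
     let y := observation (X n) (@theta n) (@eps n) w in
     free_energy (X n) (s2 n) y gstar - free_energy (X n) (s2 n) y (ghat n y)
       >= - delta n]))
  (d : prior M -> prior M -> R) (hd : metrizes_weak_cvg d) :
  forall e : R, 0 < e ->
    whp P (fun n => [set w : T n |
      d (ghat n (observation (X n) (@theta n) (@eps n) w)) gstar < e]).
Proof.
move=> e e0.
have [Cs [cs [Cs0 cs0 [S [z hdes]]]]] := assumption_D_design hp hs2 hD.
have [r0 [c [Kc [r00 c0 H]]]] := testing_step hM Cs0 cs0 gstar hd e0.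
have [A0 [mA0 sA0 pA0]] := hghat.
pose good n := design Cs cs r0 (X n) (Num.sqrt (s2 n)) (S n) (z n) /\ delta n <= c.
have ngood : \forall n \near \oo, good n.
  have /cvgr0Pnorm_lt/(_ _ c0) h2 := hdelta_lim.
  near=> n; split; first by near: n; exact: hdes.
  by apply: le_trans (ler_norm _) _; apply: ltW; near: n.
(* for small n the design bounds may fail; the empty event is then harmless *)
have step n : exists A : set (T n), [/\ measurable A,
    A `<=` [set w : T n | d (ghat n (observation (X n) (@theta n) (@eps n) w)) gstar < e] &
    good n -> fine (P n (A0 n)) - Kc * expR (- (c * (p n)%:R)) <= fine (P n A)].
  have [gn|ngn] := pselect (good n); last by exists set0; split => // w.
  have [hdn hdl] := gn.
  have [G [mG pG hG]] := H _ _ _ _ _ _ hdn.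
  pose U := model_tuple (@theta n) (@eps n) @^-1` G.
  have mU : measurable U.
    by rewrite -[U]setTI; exact: measurable_model_tuple.
  exists (A0 n `&` U); split; first exact: measurableI.
    move=> w [hw hU] /=; have := sA0 n w hw => /=.
    rewrite observation_obs => hfe.
    apply: (hG _ _ hU).
    apply: (lik_of_free_energy (design_p hdn) (design_s hdn) hdl).
    by rewrite sqr_sqrtr ?(ltW (hs2 n))//.
  move=> _.
  have hUc : (P n (~` U) <= (Kc * expR (- (c * (p n)%:R)))%:E)%E.
    apply: le_trans pG; apply: le_of_eq.
    exact: (joint_law (hmodel n) (measurableC mG)).
  have : (P n (A0 n) <= P n (A0 n `&` U) + P n (~` U))%E.
    apply: le_trans (measureU2 _ (measurableI _ _ (mA0 n) mU) (measurableC mU)).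
    apply: le_measure; rewrite ?inE//.
      by apply: measurableU; [exact: measurableI | exact: measurableC].
    by move=> w hw; have [hu|hu] := pselect (U w); [left|right].
  move=> h; have {h hUc} := le_trans h (leeD (lexx _) hUc).
  rewrite -[P n (A0 n)]fineK ?fin_num_measure//.
  rewrite -[P n (A0 n `&` U)]fineK ?fin_num_measure//; last exact: measurableI.
  by rewrite -EFinD lee_fin lerBlDr.
exists (fun n => sval (cid (step n))); split.
- by move=> n; case: (cid _) => A [].
- by move=> n; case: (cid _) => A [].
apply/fine_cvgP; split.
  by apply: nearW => n; case: (cid _) => A [mA _ _] /=; exact: fin_num_measure.
apply/cvgrPdist_le => /= x x0.
have x20 : 0 < x / 2 by rewrite divr_gt0.
have /fine_cvgP[_ /cvgrPdist_le/(_ _ x20) h1] := pA0.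
have h2 := near_expR_small hp Kc c0 x20.
near=> n; case: (cid _) => A [mA _ hA] /=.
have n1 : `|1 - fine (P n (A0 n))| <= x / 2 by near: n.
have n2 : Kc * expR (- (c * (p n)%:R)) <= x / 2 by near: n.
have n3 : good n by near: n.
have := hA n3; move: n1; rewrite ler_norml => /andP[_ n1] n4.
have le1 : fine (P n A) <= 1 by rewrite -lee_fin fineK ?fin_num_measure// probability_le1.
rewrite ger0_norm ?subr_ge0//.
have -> : x = x / 2 + x / 2 by field.
lra.
Unshelve. all: by end_near. Qed.
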